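(* Let $F$ be a $\delta$-field of characteristic zero with $F^\delta$ algebraically closed, let $K$ be a Picard-Vessiot extension of $F$ for some $\delta$-$F$-module, let $\mathscr G=\mathscr G(K|F)$ be its $\delta$-Galois group, and let $n\ge 1$. Let $\delta\text{-}\mathrm{CSA}_{K/F,n}$ be the collection of all $\delta$-$F$-algebra isomorphism classes of $\delta$-$F$-central simple algebras of dimension $n^2$ over $F$ that are split by the $\delta$-field $K$, and let $\mathrm{PRep}_{\mathscr G,n}$ be the collection of all equivalence classes of (projective) representations of $\mathscr G$ in $\mathrm{PGL}_n(F^\delta)$. Then the natural assignment $$\Gamma:\ \delta\text{-}\mathrm{CSA}_{K/F,n}\to \mathrm{PRep}_{\mathscr G,n},\qquad \Gamma([A])=[\varphi_A],$$ induced by the Tannakian correspondence $A\mapsto (A\otimes_F K)^{\delta_A\otimes\delta_K}$ (with $\varphi_A$ the projective representation attached to $A$ as defined in the context) is a well-defined bijection.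
   Context: A $\delta$-ring is a ring $R$ with an additive map $\delta_R$ satisfying the Leibniz rule; a $\delta$-field is a field with a derivation. For a $\delta$-field $F$, a $\delta$-$F$-module is a finite-dimensional $F$-vector space $M$ with an additive map $\delta_M$ such that $\delta_M(fx)=\delta_F(f)x+f\delta_M(x)$; $M^\delta=\ker\delta_M$ and $F^\delta=\ker\delta_F$. A $\delta$-$F$-central simple algebra is a (finite-dimensional) central simple $F$-algebra $A$ with a derivation $\delta_A$ restricting to $\delta_F$; isomorphisms of $\delta$-$F$-algebras are $F$-algebra isomorphisms commuting with the derivations. For a $\delta$-field extension $K$ of $F$, $A\otimes_F K$ has the derivation $\delta_A\otimes\delta_K:a\otimes k\mapsto\delta_A(a)\otimes k+a\otimes\delta_K(k)$, and $\mathrm M_n(K)$ the coordinate-wise derivation $\delta^c(a_{ij})=(\delta_K(a_{ij}))$. $K$ splits the $\delta$-$F$-algebra $A$ of dimension $n^2$ if $(A\otimes_F K,\delta_A\otimes\delta_K)\cong(\mathrm M_n(K),\delta^c)$ as $\delta$-$K$-algebras. A Picard-Vessiot extension for a $\delta$-$F$-module $M$ is a $\delta$-field extension $K$ of $F$ such that: (1) $K^\delta=F^\delta$; (2) for any $F$-basis $e_1,\dots,e_m$ of $M$, writing $\delta_M(e_i)=-\sum_j a_{ji}e_j$ with $a_{ij}\in F$, there is $(k_{ij})\in\mathrm{GL}_m(K)$ with $\delta^c(k_{ij})=(a_{ij})(k_{ij})$; (3) $K$ is generated as a field over $F$ by the $k_{ij}$. The $\delta$-Galois group $\mathscr G(K|F)$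 is the group of $\delta$-automorphisms of $K$ over $F$, regarded as a linear algebraic group over $F^\delta$ via $\sigma\mapsto(k_{ij})^{-1}\sigma(k_{ij})\in\mathrm{GL}_m(F^\delta)$ (whose image is Zariski closed). Representations of $\mathscr G$ in $\mathrm{PGL}_n(F^\delta)$ are morphisms of algebraic groups $\mathscr G\to\mathrm{PGL}_n(F^\delta)$; two are equivalent if they are conjugate by an element of $\mathrm{PGL}_n(F^\delta)$. Definition of $\varphi_A$: let $A$ be a $\delta$-$F$-central simple algebra of dimension $n^2$ split by $K$, and let $\mathscr S(A)=(A\otimes_F K)^{\delta_A\otimes\delta_K}$, an $F^\delta$-algebra on which $\mathscr G$ acts by algebra automorphisms via $1\otimes\sigma: a\otimes k\mapsto a\otimes\sigma(k)$. Choose a $\delta$-$K$-algebra isomorphism $\psi_A:(\mathrm M_n(K),\delta^c)\to(A\otimes_F K,\delta_A\otimes\delta_K)$; it restricts to an $F^\delta$-algebra isomorphism $\mathrm M_n(F^\delta)\to\mathscr S(A)$. Then $\sigma\mapsto\psi_A^{-1}\circ(1\otimes\sigma)\circ\psi_A$ is a morphism $\mathscr G\to\mathrm{Aut}(\mathrm M_n(F^\delta))$, and $\varphi_A:\mathscr G\to\mathrm{PGL}_n(F^\delta)$ is its composition with the isomorphism $\mathrm{Aut}(\mathrm M_n(F^\delta))\cong\mathrm{PGL}_n(F^\delta)$ (automorphisms of $\mathrm M_n(F^\delta)$ are conjugations). *)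

(* Defs.v *)
From HB Require Import structures.
From mathcomp Require Import all_boot all_order all_algebra all_field.
From mathcomp Require Import boolp.
From mathcomp Require Import mpoly.

Set Implicit Arguments.
Unset Strict Implicit.
Unset Printing Implicit Defensive.

Import GRing.Theory.
Local Open Scope ring_scope.
Local Open Scope quotient_scope.

HB.mixin Record isDelta R of GRing.NzRing R := {
  delta : R -> R;
  deltaD : {morph delta : x y / x + y};
  deltaM : forall x y, delta (x * y) = delta x * y + x * delta y
}.

#[short(type="deltaRingType")]
HB.structure Definition DeltaRing := {R of isDelta R & GRing.NzRing R}.

(* The join of the next two structures, required by HB. *)
HB.structure Definition DeltaUnitRing := {R of isDelta R & GRing.UnitRing R}.

#[short(type="deltaFieldType")]
HB.structure Definition DeltaField := {F of isDelta F & GRing.Field F}.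

HB.mixin Record isDeltaModule (F : deltaFieldType) M of Vector F M := {
  mdelta : M -> M;
  mdeltaD : {morph mdelta : x y / x + y};
  mdeltaZ : forall (f : F) (x : M),
    mdelta (f *: x) = delta f *: x + f *: mdelta x
}.

#[short(type="deltaModType")]
HB.structure Definition DeltaModule (F : deltaFieldType) :=
  {M of isDeltaModule F M & Vector F M}.

HB.mixin Record isDeltaAlgebra (F : deltaFieldType) A
    of Falgebra F A & isDelta A := {
  delta_alg : forall c : F, delta (c%:A : A) = (delta c)%:A
}.

#[short(type="deltaAlgType")]
HB.structure Definition DeltaAlgebra (F : deltaFieldType) :=
  {A of isDeltaAlgebra F A & Falgebra F A & isDelta A}.

Section DeltaRingTheory.
Variable R : deltaRingType.
Implicit Types x y : R.

Lemma delta0 : delta (0 : R) = 0.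
Proof. by apply: (addIr (delta 0)); rewrite -deltaD !add0r. Qed.

Lemma deltaN x : delta (- x) = - delta x.
Proof. by apply/eqP; rewrite -addr_eq0 -deltaD addNr delta0. Qed.

Lemma deltaB x y : delta (x - y) = delta x - delta y.
Proof. by rewrite deltaD deltaN. Qed.

Lemma delta1 : delta (1 : R) = 0.
Proof.
by apply: (addIr (delta 1)); rewrite add0r -{3}[1]mulr1 deltaM mulr1 mul1r.
Qed.

Lemma delta_sum I (r : seq I) (P : pred I) (G : I -> R) :
  delta (\sum_(i <- r | P i) G i) = \sum_(i <- r | P i) delta (G i).
Proof. exact: (big_morph _ deltaD delta0). Qed.

End DeltaRingTheory.

Lemma delta_scale (F : deltaFieldType) (A : deltaAlgType F) (c : F) (a : A) :
  delta (c *: a) = delta c *: a + c *: delta a.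
Proof. by rewrite -mulr_algl deltaM delta_alg !mulr_algl. Qed.

Section Constants.
Variable F : deltaFieldType.

Definition is_const : {pred F} := [pred x | delta x == 0].

Fact is_const_divring : divring_closed is_const.
Proof.
split; first by rewrite inE delta1.
  by move=> x y; rewrite !inE deltaB => /eqP-> /eqP->; rewrite subr0.
have cM x y : x \in is_const -> y \in is_const -> x * y \in is_const.
  by rewrite !inE deltaM => /eqP-> /eqP->; rewrite mulr0 mul0r addr0.
move=> x y xc yc; apply: cM => //.
have [->|y0] := eqVneq y 0; first by rewrite invr0 inE delta0.
move: yc; rewrite !inE => /eqP yc.
have := delta1 F; rewrite -(mulfV y0) deltaM yc mul0r add0r => /eqP.
by rewrite mulf_eq0 (negPf y0).
Qed.

HB.instance Definition _ := GRing.isDivringClosed.Build F is_const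
  is_const_divring.

Definition constants : Type := {x : F | is_const x}.

HB.instance Definition _ := SubChoice.on constants.
HB.instance Definition _ := [SubChoice_isSubIntegralDomain of constants by <:].
HB.instance Definition _ := [SubIntegralDomain_isSubField of constants by <:].

End Constants.

Record deltaExt (F K : deltaFieldType) := DeltaExt {
  ext_map :> {rmorphism F -> K};
  ext_delta : forall x, ext_map (delta x) = delta (ext_map x)
}.

Definition const_ext (F K : deltaFieldType) (iota : deltaExt F K) :
  constants F -> K := iota \o val.

Section MatrixDelta.
Variables (K : deltaFieldType) (n : nat).

Fact mx_deltaD : {morph (fun X : 'M[K]_n.+1 => map_mx delta X) : X Y / X + Y}.
Proof. by move=> X Y; apply/matrixP=> i j; rewrite !mxE deltaD. Qed.

Fact mx_deltaM (X Y : 'M[K]_n.+1) :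
  map_mx delta (X * Y) = map_mx delta X * Y + X * map_mx delta Y.
Proof.
apply/matrixP=> i j; rewrite !mxE delta_sum -big_split /=.
by apply: eq_bigr => k _; rewrite deltaM !mxE.
Qed.

HB.instance Definition _ := isDelta.Build 'M[K]_n.+1 mx_deltaD mx_deltaM.

Fact mx_delta_alg (c : K) : delta (c%:A : 'M[K]_n.+1) = (delta c)%:A.
Proof.
apply/matrixP=> i j; rewrite !mxE deltaM.
by case: (i == j); rewrite ?delta1 ?delta0 !mulr0 addr0.
Qed.

HB.instance Definition _ := isDeltaAlgebra.Build K 'M[K]_n.+1 mx_delta_alg.

End MatrixDelta.

(** A ⊗_F K, in coordinates: the row x stands for the sum of the e_i ⊗ x_i,
    where e is the basis [vbasis {:A}] of A. *)
Definition tensor (F K : deltaFieldType) (iota : deltaExt F K)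
  (A : falgType F) : Type := 'rV[K]_(\dim {:A}).

Section Tensor.
Variables (F K : deltaFieldType) (iota : deltaExt F K).
Local Notation tensor A := (tensor iota A).

HB.instance Definition _ (A : falgType F) :=
  Vector.copy (tensor A) 'rV[K]_(\dim {:A}).

Definition pure (A : falgType F) (a : A) (k : K) : tensor A :=
  \row_i (k * iota (coord (vbasis {:A}) i a)).

Section Algebra.
Variable A : falgType F.
Let e := vbasis {:A}.
Let inc (a : A) : tensor A := pure a 1.
Implicit Types (a b : A) (x y z : tensor A) (k : K).

Let expand a : a = \sum_(i < \dim {:A}) coord e i a *: e`_i.
Proof. exact: coord_vbasis (memvf a). Qed.

Lemma pureE a k : pure a k = k *: pure a 1.
Proof. by apply/rowP=> i; rewrite !mxE mul1r. Qed.

Lemma pureDl a b k : pure (a + b) k = pure a k + pure b k.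
Proof. by apply/rowP=> i; rewrite !mxE linearD rmorphD mulrDr. Qed.

Lemma pureDr a k l : pure a (k + l) = pure a k + pure a l.
Proof. by apply/rowP=> i; rewrite !mxE mulrDl. Qed.

Lemma pureZl (c : F) a k : pure (c *: a) k = pure a (iota c * k).
Proof.
by apply/rowP=> i; rewrite !mxE linearZ /= rmorphM mulrA [k * _]mulrC.
Qed.

Let incD a b : inc (a + b) = inc a + inc b. Proof. exact: pureDl. Qed.

Let incZ (c : F) a : inc (c *: a) = iota c *: inc a.
Proof. by rewrite /inc pureZl pureE mulr1. Qed.

Let inc0 : inc 0 = 0.
Proof. by rewrite -(scale0r 0) incZ rmorph0 scale0r. Qed.

Let inc_sum I (r : seq I) (P : pred I) (G : I -> A) :
  inc (\sum_(i <- r | P i) G i) = \sum_(i <- r | P i) inc (G i).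
Proof. exact: (big_morph _ incD inc0). Qed.

Lemma tensor_expand x : x = \sum_(i < \dim {:A}) pure e`_i (x 0 i).
Proof.
apply/rowP=> j; rewrite summxE (bigD1 j) //= big1 => [|i ij].
  by rewrite addr0 mxE coord_free ?(basis_free (vbasisP _)) // eqxx rmorph1 mulr1.
rewrite mxE coord_free ?(basis_free (vbasisP _)) //.
by rewrite [_ == _](negPf ij) rmorph0 mulr0.
Qed.

Lemma tensor_ind (P : tensor A -> Prop) :
  (forall x y, P x -> P y -> P (x + y)) -> (forall a k, P (pure a k)) ->
  forall x, P x.
Proof.
move=> PD Pp x; rewrite [x]tensor_expand; apply: (big_ind P) => //.
by rewrite -(scale0r (inc 0)) -pureE.
Qed.

Definition tmul x y : tensor A :=
  \sum_(i < \dim {:A}) \sum_(j < \dim {:A}) pure (e`_i * e`_j) (x 0 i * y 0 j).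

Let tmulDl : left_distributive tmul +%R.
Proof.
move=> x y z; rewrite -big_split; apply: eq_bigr => i _ /=.
rewrite -big_split; apply: eq_bigr => j _ /=.
by rewrite mxE mulrDl pureDr.
Qed.

Let tmulDr : right_distributive tmul +%R.
Proof.
move=> x y z; rewrite -big_split; apply: eq_bigr => i _ /=.
rewrite -big_split; apply: eq_bigr => j _ /=.
by rewrite mxE mulrDr pureDr.
Qed.

Lemma tmul_pure a b k l : tmul (pure a k) (pure b l) = pure (a * b) (k * l).
Proof.
rewrite /tmul [RHS]pureE -/(inc _) {2}(expand a) {2}(expand b).
rewrite mulr_suml inc_sum scaler_sumr; apply: eq_bigr => i _.
rewrite mulr_sumr inc_sum scaler_sumr; apply: eq_bigr => j _.
rewrite !mxE pureE -/(inc _) -scalerAl -scalerAr !incZ !scalerA.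
by congr (_ *: _); rewrite mulrACA -!mulrA.
Qed.

Let tmulA : associative tmul.
Proof.
move=> x y z.
elim/tensor_ind: x => [x1 x2|a k]; first by rewrite !tmulDl => -> ->.
elim/tensor_ind: y => [y1 y2|b l]; first by rewrite !(tmulDl, tmulDr) => -> ->.
elim/tensor_ind: z => [z1 z2|c m]; first by rewrite !tmulDr => -> ->.
by rewrite !tmul_pure !mulrA.
Qed.

Let tmul1x : left_id (inc 1) tmul.
Proof.
by elim/tensor_ind=> [x y|a k]; rewrite ?tmulDr ?tmul_pure ?mul1r // => -> ->.
Qed.

Let tmulx1 : right_id (inc 1) tmul.
Proof.
by elim/tensor_ind=> [x y|a k]; rewrite ?tmulDl ?tmul_pure ?mulr1 // => -> ->.
Qed.

Let inc1_neq0 : inc 1 != 0.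
Proof.
apply/eqP=> /rowP i0; have /eqP[] := oner_neq0 A.
rewrite (expand 1) big1 // => i _; apply/eqP; rewrite scaler_eq0.
by move/(_ i): i0; rewrite !mxE mul1r => /eqP; rewrite fmorph_eq0 => ->.
Qed.

HB.instance Definition _ := GRing.Zmodule_isNzRing.Build (tensor A)
  tmulA tmul1x tmulx1 tmulDl tmulDr inc1_neq0.

Lemma pureM a b k l : pure a k * pure b l = pure (a * b) (k * l).
Proof. exact: tmul_pure. Qed.

Lemma pureZ a k l : l *: pure a k = pure a (l * k).
Proof. by rewrite pureE scalerA -pureE. Qed.

Let tensor_scalerAl k x y : k *: (x * y) = (k *: x) * y.
Proof.
elim/tensor_ind: x => [x1 x2|a l].
  by rewrite mulrDl !scalerDr mulrDl => -> ->.
elim/tensor_ind: y => [y1 y2|b m]; first by rewrite !mulrDr scalerDr => -> ->.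
by rewrite pureZ !pureM pureZ mulrA.
Qed.

HB.instance Definition _ := GRing.Lmodule_isLalgebra.Build K (tensor A)
  tensor_scalerAl.

Let tensor_scalerAr k x y : k *: (x * y) = x * (k *: y).
Proof.
elim/tensor_ind: x => [x1 x2|a l].
  by rewrite !mulrDl !scalerDr => -> ->.
elim/tensor_ind: y => [y1 y2|b m].
  by rewrite !scalerDr !mulrDr scalerDr => -> ->.
by rewrite pureZ !pureM pureZ mulrCA.
Qed.

HB.instance Definition _ := GRing.Lalgebra_isAlgebra.Build K (tensor A)
  tensor_scalerAr.

HB.instance Definition _ := Algebra_isFalgebra.Build K (tensor A).

Lemma tensor_univ (V : zmodType) (f : A -> K -> V) :
  (forall a b k, f (a + b) k = f a k + f b k) ->
  (forall a k l, f a (k + l) = f a k + f a l) ->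
  (forall c a k, f (c *: a) k = f a (iota c * k)) ->
  exists! g : tensor A -> V,
    {morph g : x y / x + y} /\ forall a k, g (pure a k) = f a k.
Proof.
move=> fDl fDr fZ; exists (fun x => \sum_(i < \dim {:A}) f e`_i (x 0 i)).
have f0 k : f 0 k = 0 by apply: (addIr (f 0 k)); rewrite -fDl !add0r.
split; last first.
  move=> g [gD gp]; apply/funext; elim/tensor_ind=> [x y xE yE|a k].
    rewrite gD -xE -yE -big_split; apply: eq_bigr => i _ /=.
    by rewrite mxE fDr.
  rewrite gp {2}(expand a) (big_morph (f^~ k) (fun a b => fDl a b k) (f0 k)).
  by apply: eq_bigr => i _; rewrite fZ mxE mulrC.
split=> [x y|a k].
  by rewrite -big_split; apply: eq_bigr => i _ /=; rewrite mxE fDr.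
rewrite {2}(expand a) (big_morph (f^~ k) (fun a b => fDl a b k) (f0 k)).
by apply: eq_bigr => i _; rewrite fZ mxE mulrC.
Qed.

End Algebra.

Section Delta.
Variable A : deltaAlgType F.
Let e := vbasis {:A}.
Implicit Types (a b : A) (x y z : tensor A) (k : K).

Definition tdelta x : tensor A :=
  \sum_(i < \dim {:A}) (pure (delta e`_i) (x 0 i) + pure e`_i (delta (x 0 i))).

Let tdeltaD : {morph tdelta : x y / x + y}.
Proof.
move=> x y; rewrite -big_split; apply: eq_bigr => i _ /=.
by rewrite mxE deltaD !pureDr addrACA.
Qed.

Lemma tdelta_pure a k :
  tdelta (pure a k) = pure (delta a) k + pure a (delta k).
Proof.
rewrite /tdelta.
have pure_sum l I (r : seq I) (G : I -> A) :
    pure (\sum_(i <- r) G i) l = \sum_(i <- r) pure (G i) l.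
  apply: (big_morph (fun a : A => pure a l)) => [b c|]; first exact: pureDl.
  by rewrite -(scale0r 0) pureZl rmorph0 mul0r pureE scale0r.
rewrite {3 4}(coord_vbasis (memvf a)) delta_sum !pure_sum -big_split /=.
apply: eq_bigr => i _; rewrite mxE deltaM delta_scale pureDl !pureZl.
rewrite -ext_delta [k * _]mulrC [k * _]mulrC [delta k * _]mulrC pureDr.
by rewrite addrA [LHS]addrC addrA.
Qed.

Let tdeltaM x y : tdelta (x * y) = tdelta x * y + x * tdelta y.
Proof.
elim/tensor_ind: x => [x1 x2|a k].
  by rewrite mulrDl !tdeltaD !mulrDl => -> ->; rewrite addrACA.
elim/tensor_ind: y => [y1 y2|b l].
  by rewrite mulrDr !tdeltaD !mulrDr => -> ->; rewrite addrACA.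
rewrite pureM !tdelta_pure deltaM mulrDl mulrDr !pureM deltaM.
by rewrite pureDl pureDr addrACA.
Qed.

HB.instance Definition _ := isDelta.Build (tensor A) tdeltaD tdeltaM.

Lemma delta_pure a k :
  delta (pure a k) = pure (delta a) k + pure a (delta k).
Proof. exact: tdelta_pure. Qed.

Let tdelta_alg (c : K) : delta (c%:A : tensor A) = (delta c)%:A.
Proof.
have E l : l%:A = pure (1 : A) l by rewrite [in RHS]pureE.
by rewrite !E delta_pure delta1 -(scale0r 0) pureZl rmorph0 mul0r
   [pure 0 0]pureE scale0r add0r.
Qed.

HB.instance Definition _ := isDeltaAlgebra.Build K (tensor A) tdelta_alg.

(** The algebra S(A). *)
Definition solutions : {pred tensor A} := [pred x | delta x == 0].

End Delta.

End Tensor.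
Arguments solutions {F K} iota A _.


Record deltaIso (F : deltaFieldType) (A B : deltaAlgType F) := DeltaIso {
  iso_map :> {lrmorphism A -> B};
  iso_bij : bijective iso_map;
  iso_delta : forall x, iso_map (delta x) = delta (iso_map x)
}.

Definition isomorphic (F : deltaFieldType) (A B : deltaAlgType F) : Prop :=
  inhabited (deltaIso A B).

Section Isomorphic.
Variable F : deltaFieldType.
Implicit Types A B D : deltaAlgType F.

Lemma isomorphic_refl A : isomorphic A A.
Proof.
by constructor; apply: (@DeltaIso _ _ _ idfun) => //; exists id.
Qed.

Lemma isomorphic_trans A B D :
  isomorphic A B -> isomorphic B D -> isomorphic A D.
Proof.
move=> [f] [g]; constructor; apply: (@DeltaIso _ _ _ (g \o f)).
  exact: bij_comp (iso_bij g) (iso_bij f).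
by move=> x /=; rewrite !iso_delta.
Qed.

Lemma isomorphic_sym A B : isomorphic A B -> isomorphic B A.
Proof.
move=> [f]; have [g fK gK] := iso_bij f.
have gl : linear g := can2_linear fK gK.
have gm : monoid_morphism g := can2_monoid_morphism fK gK.
pose gL := GRing.isLinear.Build F B A *:%R g gl.
pose gM := GRing.isMonoidMorphism.Build B A g gm.
pose G : {lrmorphism B -> A} := HB.pack g gL gM.
constructor; apply: (@DeltaIso _ _ _ G); first by exists f.
by move=> x /=; apply: (can_inj fK); rewrite iso_delta !gK.
Qed.

End Isomorphic.

Section Galois.
Variables (F K : deltaFieldType) (iota : deltaExt F K).

Record deltaGal := DeltaGal {
  gal_map :> {rmorphism K -> K};
  gal_bij : bijective gal_map;
  gal_delta : forall x, gal_map (delta x) = delta (gal_map x);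
  gal_fix : forall a, gal_map (iota a) = iota a
}.

HB.instance Definition _ := gen_eqMixin deltaGal.
HB.instance Definition _ := gen_choiceMixin deltaGal.

Implicit Types s t : deltaGal.

Lemma deltaGalP s t : s =1 t -> s = t.
Proof.
case: s t => [s sb sd sf] [t tb td tf] /= /funext st.
have E : s = t.
  case: s t st {sb sd sf tb td tf} => s [[s1] [s2]] [t [[t1] [t2]]] /= st.
  by rewrite st in s1 s2 *; rewrite (Prop_irrelevance s1 t1) (Prop_irrelevance s2 t2).
by case: t / E tb td tf {st} => *; congr DeltaGal; apply: Prop_irrelevance.
Qed.

Definition gal_one : deltaGal :=
  @DeltaGal idfun (Bijective (frefl _) (frefl _)) (frefl _) (frefl _).

Definition gal_mul s t : deltaGal.
Proof.
apply: (@DeltaGal (s \o t)).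
- exact: bij_comp (gal_bij s) (gal_bij t).
- by move=> x /=; rewrite !gal_delta.
- by move=> x /=; rewrite !gal_fix.
Defined.

Fact gal_inv_ex s : exists t, gal_mul t s = gal_one /\ gal_mul s t = gal_one.
Proof.
have [g sK gK] := gal_bij s.
pose gA := GRing.isZmodMorphism.Build K K g (can2_zmod_morphism sK gK).
pose gM := GRing.isMonoidMorphism.Build K K g (can2_monoid_morphism sK gK).
pose G : {rmorphism K -> K} := HB.pack g gA gM.
unshelve eexists; first apply: (@DeltaGal G).
- by exists s.
- by move=> x /=; apply: (can_inj sK); rewrite gal_delta !gK.
- by move=> x /=; apply: (can_inj sK); rewrite gal_fix gK.
by split; apply: deltaGalP.
Qed.

Definition gal_inv s : deltaGal := sval (cid (gal_inv_ex s)).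

Fact gal_mulA : associative gal_mul. Proof. by move=> *; apply: deltaGalP. Qed.
Fact gal_mul1 : left_id gal_one gal_mul.
Proof. by move=> *; apply: deltaGalP. Qed.
Fact gal_mulr1 : right_id gal_one gal_mul.
Proof. by move=> *; apply: deltaGalP. Qed.
Fact gal_mulV : left_inverse gal_one gal_inv gal_mul.
Proof. by move=> s; rewrite /gal_inv; case: cid => t []. Qed.
Fact gal_mulrV : right_inverse gal_one gal_inv gal_mul.
Proof. by move=> s; rewrite /gal_inv; case: cid => t []. Qed.

HB.instance Definition _ :=
  isGroup.Build deltaGal gal_mulA gal_mul1 gal_mulr1 gal_mulV gal_mulrV.

Definition gal_tensor (A : falgType F) s (x : tensor iota A) : tensor iota A :=
  map_mx s x.

Lemma gal_tensor_pure A s a k :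
  @gal_tensor A s (pure iota a k) = pure iota a (s k).
Proof. by apply/rowP=> i; rewrite !mxE rmorphM gal_fix. Qed.

(** When k is a fundamental matrix and K has the same constants as F, the
    entries of k^-1 s(k) are constants, so that the polynomial p, with
    coefficients in the constants, may be evaluated at them inside K. *)
Definition gal_mx m (k : 'M[K]_m) s : 'M[K]_m := invmx k *m map_mx s k.

Definition gal_regular m (k : 'M[K]_m) (f : deltaGal -> constants F) : Prop :=
  exists (p : {mpoly (constants F)[m * m]}) (d : nat), forall s,
    const_ext iota (f s) =
      mmap (const_ext iota) (mxvec (gal_mx k s) 0) p / \det (gal_mx k s) ^+ d.

End Galois.

Section PGL.
Variables (n : nat) (C : fieldType).

Definition GL : Type := {g : 'M[C]_n.+1 | g \is a GRing.unit}.
HB.instance Definition _ := SubChoice.on GL.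

Implicit Types g h : GL.

Definition GL_mul g h : GL := Sub (val g * val h) (rpredM (valP g) (valP h)).
Definition GL_inv g : GL := Sub (val g)^-1 (rpredVr (valP g)).
Definition GL_one : GL := Sub 1 (unitr1 _).

Definition PGL_rel g h : bool :=
  `[< exists2 c : C, c != 0 & val g = c *: val h >].

Fact PGL_rel_equiv : equiv_class_of PGL_rel.
Proof.
split=> [g|g h|h g l].
- by apply/asboolP; exists 1; rewrite ?oner_neq0 // scale1r.
- apply/asboolP/asboolP=> -[c c0 E]; exists c^-1; rewrite ?invr_eq0 //.
    by rewrite E scalerA mulVf // scale1r.
  by rewrite E scalerA mulVf // scale1r.
- move=> /asboolP[c c0 E] /asboolP[c' c0' E']; apply/asboolP.
  by exists (c * c'); rewrite ?mulf_neq0 // E E' scalerA.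
Qed.

Canonical PGL_equiv := EquivRelPack PGL_rel_equiv.

Definition PGL : Type := {eq_quot PGL_equiv}.
HB.instance Definition _ := Choice.on PGL.

Definition PGL_class g : PGL := \pi_({eq_quot PGL_equiv}) g.
Definition PGL_repr (x : PGL) : GL := repr (x : {eq_quot PGL_equiv}).

Lemma PGL_reprK x : PGL_class (PGL_repr x) = x.
Proof. exact: reprK. Qed.

Lemma PGL_classP g h :
  PGL_class g = PGL_class h <-> exists2 c : C, c != 0 & val g = c *: val h.
Proof.
rewrite /PGL_class; split=> [/eqmodP/asboolP//|E].
by apply/eqmodP/asboolP.
Qed.

Lemma PGL_repr_class g :
  exists2 c : C, c != 0 & val (PGL_repr (PGL_class g)) = c *: val g.
Proof. by apply/PGL_classP; rewrite PGL_reprK. Qed.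

Definition PGL_mul x y : PGL := PGL_class (GL_mul (PGL_repr x) (PGL_repr y)).
Definition PGL_inv x : PGL := PGL_class (GL_inv (PGL_repr x)).
Definition PGL_one : PGL := PGL_class GL_one.

Lemma PGL_classM g h :
  PGL_mul (PGL_class g) (PGL_class h) = PGL_class (GL_mul g h).
Proof.
apply/PGL_classP=> /=.
have [c c0 ->] := PGL_repr_class g; have [d d0 ->] := PGL_repr_class h.
by exists (c * d); rewrite ?mulf_neq0 // -scalerAl -scalerAr scalerA.
Qed.

Lemma PGL_classV g : PGL_inv (PGL_class g) = PGL_class (GL_inv g).
Proof.
apply/PGL_classP=> /=; have [c c0 ->] := PGL_repr_class g.
by exists c^-1; rewrite ?invr_eq0 // invrZ ?unitfE // (valP g).
Qed.

Fact PGL_mulA : associative PGL_mul.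
Proof.
move=> x y z; rewrite -[x]PGL_reprK -[y]PGL_reprK -[z]PGL_reprK !PGL_classM.
by congr PGL_class; apply: val_inj; rewrite /= mulrA.
Qed.
Fact PGL_mul1 : left_id PGL_one PGL_mul.
Proof.
move=> x; rewrite -[x]PGL_reprK PGL_classM.
by congr PGL_class; apply: val_inj; rewrite /= mul1r.
Qed.
Fact PGL_mulr1 : right_id PGL_one PGL_mul.
Proof.
move=> x; rewrite -[x]PGL_reprK PGL_classM.
by congr PGL_class; apply: val_inj; rewrite /= mulr1.
Qed.
Fact PGL_mulV : left_inverse PGL_one PGL_inv PGL_mul.
Proof.
move=> x; rewrite -[x]PGL_reprK PGL_classV PGL_classM.
by congr PGL_class; apply: val_inj; rewrite /= mulVr // (valP (PGL_repr x)).
Qed.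
Fact PGL_mulrV : right_inverse PGL_one PGL_inv PGL_mul.
Proof.
move=> x; rewrite -[x]PGL_reprK PGL_classV PGL_classM.
by congr PGL_class; apply: val_inj; rewrite /= mulrV // (valP (PGL_repr x)).
Qed.

HB.instance Definition _ :=
  isGroup.Build PGL PGL_mulA PGL_mul1 PGL_mulr1 PGL_mulV PGL_mulrV.

(** The automorphism X |-> g X g^-1 given by the class of g. *)
Definition PGL_conj (x : PGL) (X : 'M[C]_n.+1) : 'M[C]_n.+1 :=
  val (PGL_repr x) * X / val (PGL_repr x).

Lemma PGL_conjE g X : PGL_conj (PGL_class g) X = val g * X / val g.
Proof.
rewrite /PGL_conj; have [c c0 ->] := PGL_repr_class g.
rewrite invrZ ?unitfE ?(valP g) // -!scalerAl -scalerAr scalerA mulfV //.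
by rewrite scale1r.
Qed.

Lemma PGL_conj_inj x y : PGL_conj x =1 PGL_conj y -> x = y.
Proof.
rewrite -[x]PGL_reprK -[y]PGL_reprK => E; apply/PGL_classP.
set g := PGL_repr x in E *; set h := PGL_repr y in E *.
have gU := valP g; have hU := valP h.
pose z : 'M[C]_n.+1 := (val h)^-1 * val g.
have zC X : z * X = X * z.
  have := E X; rewrite !PGL_conjE /z => {}E.
  rewrite -mulrA -[val g * X](mulrVK gU) E !mulrA mulVr // mul1r.
  by rewrite -!mulrA.
have zE i j l : z l i = z j j *+ (l == i).
  move: (z) zC => w /(_ (delta_mx i j))/matrixP/(_ l j).
  rewrite -[_ * delta_mx _ _]/(_ *m _) -[delta_mx _ _ * _]/(_ *m _) !mxE.
  rewrite (bigD1 i) //= big1 => [|t /negPf ti]; last first.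
    by rewrite mxE ti mulr0.
  rewrite (bigD1 j) //= big1 => [|t /negPf tj]; last first.
    by rewrite mxE tj andbF mul0r.
  rewrite !mxE !eqxx mulr1 !addr0 andbT => ->.
  by case: (l == i); rewrite ?mul1r ?mul0r.
have zs : z = (z 0 0)%:M by apply/matrixP=> i j; rewrite (zE j 0 i) [RHS]mxE.
have gE : val g = z 0 0 *: val h.
  rewrite -(mulVKr hU (val g)) -/z {1}zs -mul_mx_scalar.
  by rewrite -[_ *m _]/(_ * _).
exists (z 0 0) => //; apply/eqP=> z0.
by move: gU; rewrite gE z0 scale0r unitr0.
Qed.

(** The coordinate ring of PGL: the degree 0 part of C[x_ij][1/det]. *)
Definition PGL_regular (f : PGL -> C) : Prop :=
  exists (p : {mpoly C[n.+1 * n.+1]}) (d : nat),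
    p \is (n.+1 * d).-homog /\
    forall g, f (PGL_class g) = p.@[mxvec (val g) 0] / \det (val g) ^+ d.

End PGL.

Section PicardVessiot.
Variables (F K : deltaFieldType) (iota : deltaExt F K) (M : deltaModType F).

(** delta(e_i) = - sum_j a_ji e_j *)
Definition connection_mx m (e : m.-tuple M) : 'M[F]_m :=
  \matrix_(j, i) - coord e j (mdelta e`_i).

Definition fundamental_mx m (e : m.-tuple M) (k : 'M[K]_m) : Prop :=
  k \in unitmx /\ map_mx delta k = map_mx iota (connection_mx e) *m k.

Definition field_generated m (k : 'M[K]_m) : Prop :=
  forall S : {pred K}, divring_closed S ->
    (forall a, iota a \in S) -> (forall i j, k i j \in S) ->
    forall x, x \in S.

Definition same_constants : Prop :=
  forall x : K, delta x = 0 <-> exists2 c : F, delta c = 0 & x = iota c.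

Definition picard_vessiot : Prop :=
  same_constants /\
  forall m (e : m.-tuple M), basis_of fullv e ->
    exists2 k : 'M[K]_m, fundamental_mx e k & field_generated k.

End PicardVessiot.

Section Representations.
Variables (F K : deltaFieldType) (iota : deltaExt F K).
Variables (m : nat) (k : 'M[K]_m) (n : nat).

Record projRep := ProjRep {
  rep_map :> deltaGal iota -> PGL n (constants F);
  rep_mul : {morph rep_map : s t / (s * t)%g};
  rep_regular : forall f, PGL_regular f -> gal_regular k (f \o rep_map)
}.

Definition rep_equiv (r r' : projRep) : Prop :=
  exists x : PGL n (constants F), forall s, r' s = (x * r s * x^-1)%g.

Lemma rep_equiv_refl r : rep_equiv r r.
Proof. by exists 1%g => s; rewrite mul1g invg1 mulg1. Qed.

Lemma rep_equiv_sym r r' : rep_equiv r r' -> rep_equiv r' r.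
Proof.
move=> [x E]; exists (x^-1)%g => s.
by rewrite E invgK !mulgA mulVg mul1g -mulgA mulVg mulg1.
Qed.

Lemma rep_equiv_trans r1 r2 r3 :
  rep_equiv r1 r2 -> rep_equiv r2 r3 -> rep_equiv r1 r3.
Proof.
move=> [x E] [y E']; exists (y * x)%g => s.
by rewrite E' E invgM !mulgA.
Qed.

End Representations.

(** Matrix sizes are n.+1, so that n ranges over all nat. *)
Section CSA.
Variables (F K : deltaFieldType) (iota : deltaExt F K) (n : nat).

Definition central_alg (A : falgType F) : Prop := 'Z({:A})%VS = 1%VS.

Definition simple_alg (A : falgType F) : Prop :=
  forall I : {vspace A}, ({:A} * I <= I)%VS -> (I * {:A} <= I)%VS ->
    I = 0%VS \/ I = {:A}%VS.

Record deltaCSA := DeltaCSA {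
  csa_alg :> deltaAlgType F;
  csa_central : central_alg csa_alg;
  csa_simple : simple_alg csa_alg;
  csa_dim : \dim {:csa_alg} = (n.+1 ^ 2)%N;
  csa_split : isomorphic (tensor iota csa_alg) 'M[K]_n.+1
}.

Definition csa_iso (A B : deltaCSA) : Prop := isomorphic A B.

(** r is psi^-1 o (1 ⊗ s) o psi on the matrices over the constants. *)
Definition phi_spec (A : deltaAlgType F)
    (psi : deltaIso 'M[K]_n.+1 (tensor iota A))
    (r : deltaGal iota -> PGL n (constants F)) : Prop :=
  forall s (X : 'M[constants F]_n.+1),
    gal_tensor s (psi (map_mx (const_ext iota) X)) =
    psi (map_mx (const_ext iota) (PGL_conj (r s) X)).

Lemma phi_spec_uniq A psi r r' :
  @phi_spec A psi r -> phi_spec psi r' -> r = r'.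
Proof.
move=> rP r'P; apply/funext=> s; apply: PGL_conj_inj => X.
have /(bij_inj (iso_bij psi))/matrixP E := etrans (esym (rP s X)) (r'P s X).
by apply/matrixP=> i j; have := E i j; rewrite !mxE => /fmorph_inj.
Qed.

Lemma solutionsP (A : deltaAlgType F)
    (psi : deltaIso 'M[K]_n.+1 (tensor iota A)) (x : tensor iota A) :
  same_constants iota ->
  x \in solutions iota A <->
  exists X : 'M[constants F]_n.+1, x = psi (map_mx (const_ext iota) X).
Proof.
move=> constE; rewrite inE; split=> [/eqP x0|[X ->]]; last first.
  rewrite -iso_delta; apply/eqP.
  rewrite (_ : delta _ = 0) ?rmorph0 //; apply/matrixP=> i j.
  rewrite [delta _]/(map_mx delta _) !mxE /= -ext_delta.
  by have /eqP-> := valP (X i j); rewrite rmorph0.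
have [phi psiK phiK] := iso_bij psi.
have d0 i j : delta (phi x i j) = 0.
  have /matrixP/(_ i j) : delta (phi x) = 0.
    by apply: (can_inj psiK); rewrite iso_delta phiK x0 rmorph0.
  by rewrite [delta _]/(map_mx delta _) !mxE.
have cP i j : exists c : constants F, phi x i j = const_ext iota c.
  have [c c0 E] := (constE _).1 (d0 i j).
  have cc : is_const c by apply/eqP.
  by exists (exist _ c cc).
exists (\matrix_(i, j) sval (cid (cP i j))); rewrite -[x in LHS]phiK.
by congr (psi _); apply/matrixP=> i j; rewrite !mxE; case: cid.
Qed.

End CSA.

Section Classes.
Variables (T : Type) (R : T -> T -> Prop).

Definition classes : Type := {X : T -> Prop | exists x, X = R x}.

Definition eqv_class (x : T) : classes :=
  exist _ (R x) (ex_intro _ x (erefl (R x))).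

Lemma eqv_classP : (forall x, R x x) -> (forall x y, R x y -> R y x) ->
  (forall x y z, R x y -> R y z -> R x z) ->
  forall x y, eqv_class x = eqv_class y <-> R x y.
Proof.
move=> Rr Rs Rt x y; split=> [[E]|xy]; first by rewrite E.
have E : R x = R y.
  apply/funext=> z; apply/propext; split; first exact: Rt (Rs _ _ xy).
  exact: Rt xy.
by apply: eq_exist.
Qed.

End Classes.

(* Main.v *)
From HB Require Import structures.
Require Import Defs.
From mathcomp Require Import all_boot all_order all_algebra all_field.
From mathcomp Require Import perm boolp mpoly ring.
From mathcomp Require classical_sets.

Set Implicit Arguments.
Unset Strict Implicit.
Unset Printing Implicit Defensive.

Import GRing.Theory.
Local Open Scope ring_scope.

(** A δ-F-central simple algebra split by K is a form of M_n with its
    coordinate-wise derivation, and such forms are classified by Galois descent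
    along K/F, the only difficulty being that the δ-Galois group is infinite.
    Everything rests on one source of automorphisms. In coordinates X = kY, the
    δ-ideals of K[X] that come from F[X] are generated by polynomials in Y with
    constant coefficients, so the Nullstellensatz over the algebraically closed
    field of constants yields constant matrices ξ for which k |-> kξ extends to
    a δ-automorphism of K. This gives that F is the fixed field of the Galois
    group, and that F[k, 1/det k] is δ-simple.

    A regular function on the Galois group is a finite sum of functions
    s |-> b_i s(y_i). If the matrix coefficients of a representation have this
    form with the y_i independent over F, then the coefficients b_i are
    themselves invariant vectors of the twisted action and span everything: this
    replaces Hilbert 90 and gives surjectivity. Conversely, δ-simplicity shows
    that the entries of the matrix of a splitting isomorphism lie in
    F[k, 1/det k], so that the projective representation attached to an algebra
    is regular. *)

(** * Prime ideals *)

(** An automorphism of K is determined by the constant matrix k^-1 s(k), so finding automorphisms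
    means finding constant points of an ideal of K[Y]. A prime ideal of K[Y] need not have any; the
    Nullstellensatz is therefore applied over the constants, to its contraction, and generation by
    constant polynomials ensures that nothing is lost.

    The tensor product of K with itself over F is never formed. Linear forms from K to F, obtained
    from Zorn's lemma, are applied to coefficients instead; they separate the elements of K.
    Characteristic zero enters as separability: it turns nilpotency of 1 ⊗ x - x ⊗ 1 into membership
    of x in F.

    A projective representation need not lift to GL, so it does not twist K^n. It does twist
    matrices, since conjugation is an honest linear representation with regular coefficients, and
    the fixed matrices of the twisted action form the algebra sought. For the same reason,
    regularity of the representation of an algebra is proved first for the coefficients of
    conjugation, and from there for all regular functions on PGL. *)

Lemma mpoly_ring_ind n (R : nzRingType) (P : {mpoly R[n]} -> Prop) :
  (forall c, P c%:MP) -> (forall i, P 'X_i) ->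
  (forall p q, P p -> P q -> P (p + q)) ->
  (forall p q, P p -> P q -> P (p * q)) -> forall p, P p.
Proof.
move=> PC PX PD PM; elim/mpolyind => [|c m p _ _ Pp]; first by rewrite -mpolyC0.
apply: PD => //; rewrite -mul_mpolyC; apply: (PM) => //.
rewrite mpolyXE_id; apply: (big_ind P) => // [|i _]; first by rewrite -mpolyC1.
by elim: (m i) => [|j IH]; rewrite ?expr0 -?mpolyC1 // exprS; apply: PM.
Qed.

Lemma mpoly_morph_eq n (R S : nzRingType)
    (f g : {rmorphism {mpoly R[n]} -> S}) :
  (forall c, f c%:MP = g c%:MP) -> (forall i, f 'X_i = g 'X_i) -> f =1 g.
Proof.
move=> fC fX; elim/mpoly_ring_ind => // p q.
  by rewrite !rmorphD => -> ->.
by rewrite !rmorphM => -> ->.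
Qed.

Record ideal_pred (A : nzRingType) (P : A -> Prop) : Prop := IdealPred {
  ideal_pred0 : P 0;
  ideal_predD : forall x y, P x -> P y -> P (x + y);
  ideal_predM : forall x y, P y -> P (x * y)
}.

(** The whole ring is allowed; each use comes with an element outside [P], which makes [P]
    proper. *)
Record prime_pred (A : nzRingType) (P : A -> Prop) : Prop := PrimePred {
  prime_ideal : ideal_pred P;
  prime_mul : forall x y, P (x * y) -> P x \/ P y
}.

Section IdealPred.
Variables (A : nzRingType) (P : A -> Prop) (idP : ideal_pred P).

Lemma ideal_predN x : P x -> P (- x).
Proof. by move=> Px; rewrite -mulN1r; apply: ideal_predM. Qed.

Lemma ideal_predB x y : P x -> P y -> P (x - y).
Proof. by move=> Px Py; apply: ideal_predD => //; apply: ideal_predN. Qed.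

Lemma ideal_pred_sum I (r : seq I) (Q : pred I) (G : I -> A) :
  (forall i, Q i -> P (G i)) -> P (\sum_(i <- r | Q i) G i).
Proof.
move=> PG; apply: (big_ind P) => //; first exact: ideal_pred0.
by move=> x y; apply: ideal_predD.
Qed.

Lemma ideal_pred_eqv x y : P (x - y) -> P x <-> P y.
Proof.
move=> Pxy; split=> [Px|Py]; last by rewrite -(subrK y x); apply: ideal_predD.
by rewrite -(subKr x y); apply: ideal_predB.
Qed.

End IdealPred.

Lemma prime_pred_preim (A B : nzRingType) (f : {rmorphism A -> B})
    (P : B -> Prop) : prime_pred P -> prime_pred (fun x => P (f x)).
Proof.
move=> [[P0 PD PM] Pp]; split; first split=> [|x y|x y].
- by rewrite rmorph0.
- by rewrite rmorphD; apply: PD.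
- by rewrite rmorphM; apply: PM.
- by move=> x y; rewrite rmorphM; apply: Pp.
Qed.

(** An ideal maximal among those that contain [J] and miss all powers of [h] is prime: if [x] and
    [y] lie outside it, adjoining either one captures a power of [h], and the product of these
    powers lies in the ideal enlarged by [x * y]. *)
Lemma prime_avoiding (A : comNzRingType) (J : A -> Prop) (h : A) :
  ideal_pred J -> (forall d, ~ J (h ^+ d)) ->
  exists P : A -> Prop, [/\ prime_pred P, forall x, J x -> P x & ~ P h].
Proof.
move=> idJ Jh.
pose T X := [/\ ideal_pred X, forall x, J x -> X x & forall d, ~ X (h ^+ d)].
(* Zorn's lemma also asks for the union of the empty chain, which is empty and no ideal; adjoining
   [J] repairs this. *)
pose U (X : A -> Prop) := fun x => J x \/ X x.
have [F FT Ftot|P [[idP JP hP] Pmax]] :=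
    @classical_sets.Zorn_bigcup A (fun X => T (U X)).
  have idF X : F X -> ideal_pred (U X) by move=> /FT[].
  split=> [|x Jx|d]; [split=> [|x y|x y]| by left |].
  - by left; apply: ideal_pred0.
  - have lift X z : F X -> U X z -> U (classical_sets.bigcup F id) z.
      by move=> FX [Jz|Xz]; [left | right; exists X].
    case=> [Jx|[X FX Xx]] [Jy|[Y FY Yy]].
    + by left; apply: ideal_predD.
    + by apply: (lift Y) => //; apply: (ideal_predD (idF _ FY)); [left|right].
    + by apply: (lift X) => //; apply: (ideal_predD (idF _ FX)); [right|left].
    + have [XY|YX] := Ftot _ _ FX FY.
        apply: (lift Y) => //; apply: (ideal_predD (idF _ FY)); right=> //.
        exact: XY.
      apply: (lift X) => //; apply: (ideal_predD (idF _ FX)); right=> //.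
      exact: YX.
  - case=> [Jy|[X FX Xy]]; first by left; apply: ideal_predM.
    have [] : U X (x * y) by apply: (ideal_predM (idF _ FX)); right.
      by left.
    by right; exists X.
  - by case=> [/Jh//|[X /FT[_ _ Xh] ?]]; apply: (Xh d); right.
have Umax Y : T Y -> (forall x, U P x -> Y x) -> forall x, Y x -> U P x.
  move=> TY PY x Yx; apply: contrapT => nPx.
  have UY : U Y = Y.
    apply/funext=> y; apply/propext; split=> [[Jy|//]|]; last by right.
    by case: TY => _ JY _; apply: JY.
  apply: (Pmax Y); last by rewrite UY.
  split=> [y Py|YP]; first by apply: PY; right.
  by apply: nPx; right; apply: YP.
exists (U P); split=> //; last by move/(hP 1%N).
split=> // x y Pxy.
pose Y a := fun b => exists u v, b = u + v * a /\ U P u.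
have YT a : ~ U P a -> ~ T (Y a).
  move=> nPa TY; apply: nPa; apply: (Umax (Y a)) => // [b Pb|].
    by exists b, 0; rewrite mul0r addr0.
  by exists 0, 1; rewrite mul1r add0r; split=> //; apply: ideal_pred0.
have Yid a : ideal_pred (Y a).
  split=> [|b c [u [v [-> Pu]]] [u' [v' [-> Pu']]]|b c [u [v [-> Pu]]]].
  - by exists 0, 0; rewrite mul0r addr0; split=> //; apply: ideal_pred0.
  - exists (u + u'), (v + v'); rewrite mulrDl addrACA; split=> //.
    exact: ideal_predD.
  - by exists (b * u), (b * v); rewrite mulrDr mulrA; split=> //;
    apply: ideal_predM.
have Yh a : ~ U P a -> exists d, Y a (h ^+ d).
  move=> nPa; apply: contrapT => nYh; apply: (YT _ nPa); split=> // [b Jb|d Yd].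
    by exists b, 0; rewrite mul0r addr0; split=> //; apply: JP.
  by apply: nYh; exists d.
apply: contrapT => /not_orP[/Yh[d [u [v [E Pu]]]] /Yh[d' [u' [v' [E' Pu']]]]].
apply: (hP (d + d')%N); rewrite exprD E E' mulrDl; apply: ideal_predD => //.
  by rewrite mulrC; apply: ideal_predM.
rewrite mulrDr; apply: ideal_predD => //; first exact: ideal_predM.
by rewrite mulrACA; apply: ideal_predM.
Qed.

(** * The Nullstellensatz *)

Lemma closed_root (C : fieldType) (closed : GRing.closed_field_axiom C)
  (p : {poly C}) : (1 < size p)%N -> exists x, root p x.
Proof.
move=> p1; have p0 : lead_coef p != 0.
  by rewrite lead_coef_eq0 -size_poly_gt0 ltnW.
have [|x xE] := closed (size p).-1 (fun i => - (lead_coef p)^-1 * p`_i).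
  by rewrite -ltnS prednK // ltnW.
exists x; apply/rootP; rewrite horner_coef -(prednK (ltnW p1)) big_ord_recr /=.
rewrite xE big_distrr -big_split big1 //= => i _.
by rewrite -/(lead_coef p) !mulrA mulrN mulfV // mulN1r mulNr addrN.
Qed.

(** At a root of [p * 'X + 1] the value of [p] divides -1, so it is nonzero; no count of the
    elements of [C] is involved. *)
Lemma closed_nonroot (C : fieldType) (closed : GRing.closed_field_axiom C)
  (p : {poly C}) : p != 0 -> exists x, p.[x] != 0.
Proof.
move=> p0; have [|x /rootP xE] := closed_root closed (p := p * 'X + 1%:P).
  by rewrite size_MXaddC (negPf p0) /= ltnS size_poly_gt0.
exists x; apply/eqP=> px; move/eqP: xE.
by rewrite !hornerE px mul0r add0r oner_eq0.
Qed.

Section Specialization.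
Variables (C : fieldType) (closed : GRing.closed_field_axiom C).

(** The Nullstellensatz as a property of a [C]-algebra: every nonempty basic open part of an
    irreducible closed set has a [C]-point. In this form it passes from [A] to [{poly A}]. *)
Definition has_points (A : idomainType) (c : {rmorphism C -> A}) : Prop :=
  forall (P : A -> Prop) b, prime_pred P -> ~ P b ->
  exists phi : {rmorphism A -> C},
    [/\ forall x, phi (c x) = x, forall x, P x -> phi x = 0 & phi b != 0].

Section Step.
Variables (A : idomainType) (c : {rmorphism C -> A}) (hA : has_points c).
Variables (P : {poly A} -> Prop) (primP : prime_pred P).
Let idP := prime_ideal primP.
Let P0 (a : A) : Prop := P a%:P.
Let coefs0 (g : {poly A}) : Prop := forall i, P0 g`_i.

Let coefs0P g : coefs0 g -> P g.
Proof.
move=> g0; rewrite -[g]coefK poly_def; apply: (ideal_pred_sum idP) => // i _.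
by rewrite -mul_polyC mulrC; apply: (ideal_predM idP); apply: g0.
Qed.

(** Leading terms with coefficient in [P0] are dropped until the degree is that of the image in
    (A/P0)[X]. *)
Let trunc g : ~ coefs0 g ->
  exists g', [/\ ~ P0 (lead_coef g'), (size g' <= size g)%N & coefs0 (g - g')].
Proof.
have [s] := ubnP (size g); elim: s g => // s IH g gs ng.
have [lg|lg] := pselect (P0 (lead_coef g)); last first.
  by exists g; rewrite subrr; split=> // i; rewrite coef0; exact: ideal_pred0 idP.
have g0 : g != 0.
  apply/eqP=> g0; apply: ng => i; rewrite g0 coef0; exact: ideal_pred0 idP.
pose h := g - (lead_coef g) *: 'X^((size g).-1).
have hE i : h`_i = if i == (size g).-1 then 0 else g`_i.
  rewrite coefB coefZ coefXn; case: eqP => [->|_].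
    by rewrite mulr1 subrr.
  by rewrite mulr0 subr0.
have hs : (size h < size g)%N.
  rewrite -(prednK (_ : 0 < size g)%N) ?size_poly_gt0 // ltnS.
  apply/leq_sizeP => j jg; rewrite hE; case: eqP => // /eqP nj.
  apply: nth_default; rewrite -(prednK (_ : 0 < size g)%N) ?size_poly_gt0 //.
  by rewrite ltn_neqAle eq_sym nj.
have hg i : P0 (g - h)`_i.
  rewrite coefB hE; case: eqP => [->|_]; first by rewrite subr0.
  by rewrite subrr; exact: ideal_pred0 idP.
have nh : ~ coefs0 h.
  move=> h0; apply: ng => i; rewrite -(subrK h g) coefD.
  by rewrite /P0 polyCD; apply: (ideal_predD idP (hg i) (h0 i)).
have [|g' [lg' sg' g'0]] := IH h _ nh; first exact: leq_trans hs _.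
exists g'; split=> // [|i]; first exact: leq_trans sg' (ltnW hs).
have -> : g - g' = (g - h) + (h - g') by rewrite addrA subrK.
by rewrite coefD /P0 polyCD; apply: (ideal_predD idP (hg i) (g'0 i)).
Qed.

Let P0mul a b : P0 (a * b) -> P0 a \/ P0 b.
Proof. by rewrite /P0 polyCM => /(prime_mul primP). Qed.

Let P0X a d : ~ P0 a -> ~ P0 (a ^+ d).
Proof.
move=> na; elim: d => [|d IH]; last by rewrite exprS => /P0mul[].
rewrite expr0 => P1; apply: na; rewrite -[a]mulr1 /P0 polyCM.
exact: (ideal_predM idP _ P1).
Qed.

(** Here [P] is P0[X]: a point of [A] at which one coefficient of [b] survives leaves a nonzero
    polynomial over [C], and ['X] is sent to a nonroot of it. *)
Lemma coefs0_has_points b : (forall f, P f -> coefs0 f) -> ~ P b ->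
  exists phi : {rmorphism {poly A} -> C},
    [/\ forall x, phi (c x)%:P = x, forall x, P x -> phi x = 0 & phi b != 0].
Proof.
move=> Pc nb; have [i nbi] : exists i, ~ P0 b`_i.
  apply: contrapT => H; apply/nb/coefs0P => i; apply: contrapT => ?.
  by apply: H; exists i.
have [phi [phic phiP phib]] := hA (prime_pred_preim polyC primP) nbi.
have [|x xE] := closed_nonroot closed (p := map_poly phi b).
  by apply/eqP=> /polyP/(_ i); rewrite coef_map coef0; apply/eqP.
exists (horner_eval x \o map_poly phi); split=> [y|y Py|] //=.
  by rewrite map_polyC horner_evalE hornerC; apply: phic.
rewrite horner_evalE (_ : map_poly _ _ = 0) ?horner0 //.
by apply/polyP=> j; rewrite coef_map coef0; apply: phiP; apply: Pc.
Qed.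

Section Algebraic.
Variable f : {poly A}.
Hypotheses (Pf : P f) (lf : ~ P0 (lead_coef f)).
Hypothesis fmin : forall g, P g -> (size g < size f)%N -> coefs0 g.

Let f0 : f != 0.
Proof. by apply/eqP=> f0; apply: lf; rewrite f0 lead_coef0;
  exact: ideal_pred0 idP. Qed.

(** Euclid's algorithm over the fraction field of A/P0, with denominators cleared by
    pseudo-division: [f] is divided by [b] and the remainder replaces [b]. The remainder stays
    outside [P], because a quotient in [P], being shorter than [f], would have all coefficients in
    [P0], against the leading coefficient of [f]. *)
Let bezout_small b : ~ P b -> ~ P0 (lead_coef b) -> (size b < size f)%N ->
  exists v a, ~ P0 a /\ P (v * b - a%:P).
Proof.
have [s] := ubnP (size b); elim: s b => // s IH b bs nb lb bf.
have [b1|b1] := leqP (size b) 1.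
  exists 1, b`_0; rewrite mul1r -size1_polyC // subrr; split.
    by rewrite /P0 -size1_polyC.
  exact: ideal_pred0 idP.
have b0 : b != 0 by rewrite -size_poly_gt0 ltnW.
pose q := (f %/ b)%R; pose r := (f %% b)%R.
have E : lead_coef b ^+ scalp f b *: f = q * b + r.
  exact: Pdiv.Idomain.divp_eq.
have rb : (size r < size b)%N by rewrite Pdiv.Idomain.ltn_modp.
have nq : ~ P q.
  move=> Pq; have q0 : coefs0 q.
    apply: fmin => //; rewrite Pdiv.Idomain.size_divp //.
    rewrite -subn1 subnBA ?(ltnW b1) // addn1 ltn_subLR; last exact/ltnW/leqW.
    by rewrite -[X in (X < _)%N]add1n ltn_add2r.
  have : P0 (lead_coef b ^+ scalp f b * lead_coef f).
    rewrite /lead_coef -/(lead_coef b) -coefZ E coefD.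
    rewrite [r`__]nth_default ?addr0; last first.
      by rewrite -ltnS prednK ?size_poly_gt0 //; apply: leq_trans rb _; apply: ltnW.
    rewrite coefM /P0 rmorph_sum; apply: (ideal_pred_sum idP) => // i _.
    by rewrite rmorphM mulrC; apply: (ideal_predM idP) => //; apply: q0.
  by move/P0mul=> [/P0X|]; [apply | ].
have Pr : P (q * b + r) by rewrite -E -mul_polyC; apply: (ideal_predM idP).
have nr : ~ P r.
  move=> /(ideal_predB idP Pr); rewrite addrK.
  by case/(prime_mul primP).
have [r' [lr' sr' rr']] := trunc (fun r0 => nr (coefs0P r0)).
have Prr' := coefs0P rr'.
have r'b := leq_ltn_trans sr' rb.
have [||||v [a [na Pva]]] := IH r' => //.
- exact: leq_trans r'b _.
- by move/(ideal_pred_eqv idP Prr').2.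
- exact: ltn_trans r'b _.
exists (- v * q), a; split=> //.
have -> : - v * q * b - a%:P =
    (v * r' - a%:P) - v * (q * b + r) + v * (r - r') by ring.
apply: (ideal_predD idP) => //; last exact: (ideal_predM idP).
by apply: (ideal_predB idP) => //; apply: (ideal_predM idP).
Qed.

Let reduce b :
  exists N (r : {poly A}), [/\ (size r < size f)%N & P (lead_coef f ^+ N *: b - r)].
Proof.
exists (scalp b f), (b %% f); split; first by rewrite Pdiv.Idomain.ltn_modp.
by rewrite Pdiv.Idomain.divp_eq addrK; apply: (ideal_predM idP).
Qed.

Let scaleP a g : P g -> P (a *: g).
Proof. by rewrite -mul_polyC; apply: (ideal_predM idP). Qed.

Let scaleK a g : P (a *: g) -> P0 a \/ P g.
Proof. by rewrite -mul_polyC => /(prime_mul primP). Qed.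

Let bezout b : ~ P b -> exists v a, ~ P0 a /\ P (v * b - a%:P).
Proof.
move=> nb; have [N [r [rf Pr]]] := reduce b.
have nr : ~ P r.
  by move/(ideal_pred_eqv idP Pr).2/scaleK=> [/P0X|]; [apply|].
have [r' [lr' sr' rr']] := trunc (fun r0 => nr (coefs0P r0)).
have Prr' := coefs0P rr'.
have [|||v [a [na Pva]]] := bezout_small (b := r') => //.
- by move/(ideal_pred_eqv idP Prr').2.
- exact: leq_ltn_trans sr' rf.
exists (v * (lead_coef f ^+ N)%:P), a; split=> //.
have -> : v * (lead_coef f ^+ N)%:P * b - a%:P = (v * r' - a%:P) + v * (r - r')
    + v * (lead_coef f ^+ N *: b - r) by rewrite -mul_polyC; ring.
by do 2?[apply: (ideal_predD idP)] => //; apply: (ideal_predM idP).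
Qed.

(** The point of [A] is chosen so that neither the leading coefficient of [f] nor the constant [a]
    of the Bezout relation vanishes there, and ['X] is sent to a root of [f]. Pseudo-division by [f]
    shows that [P] goes to 0, and the Bezout relation that [b] does not. *)
Lemma algebraic_has_points b : ~ P b ->
  exists phi : {rmorphism {poly A} -> C},
    [/\ forall x, phi (c x)%:P = x, forall x, P x -> phi x = 0 & phi b != 0].
Proof.
move=> nb; have [v [a [na Pva]]] := bezout nb.
have nac : ~ P0 (a * lead_coef f) by move/P0mul=> [].
have [phi [phic phiP]] := hA (prime_pred_preim polyC primP) nac.
rewrite rmorphM mulf_eq0 negb_or => /andP[phia phif].
have sf : size (map_poly phi f) = size f by rewrite size_map_poly_id0.
have f1 : (1 < size f)%N.
  rewrite ltnNge; apply/negP=> f1; apply: lf.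
  by move: Pf; rewrite /P0 {1}(size1_polyC f1) /lead_coef;
    case: (size f) f1 => [|[]].
have [|x /rootP xE] := closed_root closed (p := map_poly phi f);
  first by rewrite sf.
pose psi : {rmorphism {poly A} -> C} := horner_eval x \o map_poly phi.
have psiE g : psi g = (map_poly phi g).[x] by [].
have psiC y : psi y%:P = phi y by rewrite psiE map_polyC hornerC.
have psi0 g : P g -> psi g = 0.
  move=> Pg; pose q := (g %/ f)%R.
  have E : lead_coef f ^+ scalp g f *: g = q * f + g %% f.
    exact: Pdiv.Idomain.divp_eq.
  have Pm : P (g %% f).
    have -> : g %% f = lead_coef f ^+ scalp g f *: g - q * f.
      by rewrite E addrC addKr.
    by apply: (ideal_predB idP); [apply: scaleP|apply: (ideal_predM idP)].
  have m0 : map_poly phi (g %% f) = 0.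
    apply/polyP=> i; rewrite coef_map coef0; apply: phiP.
    by apply: (fmin Pm); rewrite Pdiv.Idomain.ltn_modp.
  have /eqP := congr1 psi E.
  rewrite -mul_polyC rmorphM rmorphD rmorphM psiC !psiE m0 xE mulr0 horner0 addr0.
  rewrite mulf_eq0 rmorphXn expf_eq0 (negPf phif) andbF => /eqP; apply.
exists psi; split=> // [y|]; first by rewrite psiC; apply: phic.
apply/eqP=> b0; have := psi0 _ Pva; rewrite rmorphB rmorphM b0 mulr0 sub0r psiC.
by move/eqP; rewrite oppr_eq0; apply/negP.
Qed.

End Algebraic.

Lemma has_points_step b : ~ P b ->
  exists phi : {rmorphism {poly A} -> C},
    [/\ forall x, phi (c x)%:P = x, forall x, P x -> phi x = 0 & phi b != 0].
Proof.
have [H|] := pselect (forall f, P f -> coefs0 f); first exact: coefs0_has_points.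
move=> /existsNP[f /not_implyP[Pf nf]].
pose good s := `[< exists f, [/\ P f, ~ P0 (lead_coef f) & size f = s] >].
have [f' [lf' _ ff']] := trunc nf.
have Pf' : P f' by apply: (ideal_pred_eqv idP (coefs0P ff')).1.
have ex : exists s, good s by exists (size f'); apply/asboolP; exists f'.
case: (ex_minnP ex) => s /asboolP[f1 [Pf1 lf1 sf1]] smin.
apply: (algebraic_has_points Pf1 lf1) => g Pg gf; apply: contrapT => ng.
have [g' [lg' sg' gg']] := trunc ng.
have Pg' : P g' by apply: (ideal_pred_eqv idP (coefs0P gg')).1.
have /smin : good (size g') by apply/asboolP; exists g'.
by rewrite -sf1 leqNgt (leq_ltn_trans sg' gf).
Qed.

End Step.

Theorem nullstellensatz n (P : {mpoly C[n]} -> Prop) (h : {mpoly C[n]}) :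
  prime_pred P -> ~ P h ->
  exists xi : 'I_n -> C, (forall p, P p -> p.@[xi] = 0) /\ h.@[xi] != 0.
Proof.
suff H : has_points (@mpolyC n C).
  move=> primP /(H P h primP)[phi [phiC phiP phih]].
  have E : phi =1 meval (fun i => phi 'X_i).
    apply: mpoly_morph_eq => [x|i] /=; last by rewrite mevalXU.
    by rewrite mevalC; apply: phiC.
  exists (fun i => phi 'X_i); rewrite -E; split=> // p; rewrite -E; apply: phiP.
elim: n {P h} => [|n IH] P b primP nb.
  have E (p : {mpoly C[0]}) : p = (p@_0%MM)%:MP := nvar0_mpolyC p.
  pose phi := @mcoeff 0 C 0%MM.
  have phiC x : phi x%:MP = x by rewrite /phi mcoeffC eqxx mulr1.
  pose Phi : {rmorphism {mpoly C[0]} -> C} := mcoeff 0%MM.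
  have ux (u : C) : u != 0 -> ~ P u%:MP.
    move=> u0 Pu; apply: nb; rewrite -[b]mulr1 -mpolyC1 -(mulVf u0) mpolyCM mulrA.
    exact: ideal_predM (prime_ideal primP) _ _ Pu.
  exists Phi; split=> [//|x Px|]; rewrite /= -/(phi _).
    by apply/eqP; apply: contrapT => /negP/ux; apply; rewrite -E.
  apply/eqP=> b0; apply: nb; rewrite (E b) -/(phi b) b0;
    exact: ideal_pred0 (prime_ideal primP).
pose rho : {rmorphism {poly {mpoly C[n]}} -> {mpoly C[n.+1]}} :=
  horner_eval 'X_ord_max \o map_poly (@mwiden n C).
have rhoC x : rho x%:P = mwiden x by rewrite /rho /= map_polyC horner_evalE hornerC.
have rhoX : rho 'X = 'X_ord_max by rewrite /rho /= map_polyX horner_evalE hornerX.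
have rhoS b' : exists a, rho a = b'.
  elim/mpoly_ring_ind: b' => [x|i|p q [a <-] [a' <-]|p q [a <-] [a' <-]].
  - by exists x%:MP%:P; rewrite rhoC mwidenC.
  - have [->|[j ->]] : i = ord_max \/ exists j, i = widen_ord (leqnSn n) j.
      have := ltn_ord i; rewrite ltnS leq_eqVlt => /predU1P[E|lt]; [left|right].
        exact: val_inj.
      by exists (Ordinal lt); apply: val_inj.
    + by exists 'X.
    + by exists ('X_j)%:P; rewrite rhoC mwidenX mnmwiden1.
  - by exists (a + a'); rewrite rmorphD.
  - by exists (a * a'); rewrite rmorphM.
have [b' b'E] := rhoS b.
have [|phi [phiC phiP phib]] :=
  has_points_step IH (prime_pred_preim rho primP) (b := b').
  by rewrite b'E.
(* [rho] is only shown to be onto; [phi] still descends, since it kills the preimage of [P], which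
   contains the kernel of [rho]. *)
have phiE a a' : rho a = rho a' -> phi a = phi a'.
  move=> E; apply/eqP; rewrite -subr_eq0 -rmorphB phiP // rmorphB E subrr.
  exact: ideal_pred0 (prime_ideal primP).
pose lift p := sval (cid (rhoS p)).
have liftK p : rho (lift p) = p by rewrite /lift; case: cid.
pose xi i := phi (lift 'X_i).
have E p : phi (lift p) = p.@[xi].
  elim/mpoly_ring_ind: p => [x|i|p q Ep Eq|p q Ep Eq].
  - rewrite mevalC -[RHS]phiC; apply: phiE.
    by rewrite liftK rhoC mwidenC.
  - by rewrite mevalXU.
  - by rewrite mevalD -Ep -Eq -rmorphD; apply: phiE; rewrite rmorphD !liftK.
  - by rewrite mevalM -Ep -Eq -rmorphM; apply: phiE; rewrite rmorphM !liftK.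
exists (meval xi); split=> [x|p Pp|]; first by rewrite /= mevalC.
  by rewrite /= -E phiP ?liftK.
by rewrite /= -E (phiE _ b') // liftK b'E.
Qed.

End Specialization.

(** * Linear forms, independence, and automorphisms of matrix algebras *)

Section Independence.
Variables (E K : fieldType) (g : {rmorphism E -> K}).

(** An [E]-linear form on [K], seen as an [E]-space through [g]; such forms replace computations in
    tensor products over [E]. *)
Definition semilinear_form (l : K -> E) : Prop :=
  (forall x y, l (x + y) = l x + l y) /\ (forall c x, l (g c * x) = c * l x).

Lemma semilinear_form_sum l I (r : seq I) (P : pred I) (G : I -> K) :
  semilinear_form l -> l (\sum_(i <- r | P i) G i) = \sum_(i <- r | P i) l (G i).
Proof.
move=> [lD lZ]; apply: (big_morph _ lD).
by have := lZ 0 0; rewrite rmorph0 !mul0r.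
Qed.

Lemma semilinear_form_mul l x :
  semilinear_form l -> semilinear_form (fun y => l (x * y)).
Proof. by move=> [lD lZ]; split=> [y z|c y]; rewrite ?mulrDr ?lD // mulrCA lZ. Qed.

(** A subspace maximal among those missing 1 is a complement of the line of 1, and [l] is the
    projection onto that line. *)
Lemma semilinear_form_exists : exists2 l, semilinear_form l & l 1 = 1.
Proof.
pose sub (X : K -> Prop) := [/\ X 0, forall x y, X x -> X y -> X (x + y)
  & forall c x, X x -> X (g c * x)].
pose T X := sub X /\ ~ X 1.
pose U (X : K -> Prop) x := x = 0 \/ X x.
have T0 X x : U X x -> T X -> X x by case=> // -> [[]].
have [F FT Ftot|S [[[S0 SD SZ] S1] Smax]] :=
    @classical_sets.Zorn_bigcup K (fun X => T (U X)).
  have sF X : F X -> sub (U X) by move=> /FT[].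
  have lift X z : F X -> U X z -> U (classical_sets.bigcup F id) z.
    by move=> FX [z0|Xz]; [left | right; exists X].
  split; first split=> [|x y|c x].
  - by left.
  - case=> [->|[X FX Xx]]; first by rewrite add0r.
    case=> [->|[Y FY Yy]]; first by rewrite addr0; right; exists X.
    have [XY|YX] := Ftot _ _ FX FY.
      have [_ D _] := sF _ FY; apply: (lift Y) => //; apply: D; right=> //.
      exact: XY.
    have [_ D _] := sF _ FX; apply: (lift X) => //; apply: D; right=> //.
    exact: YX.
  - case=> [->|[X FX Xx]]; first by rewrite mulr0; left.
    by have [_ _ Z] := sF _ FX; apply: (lift X) => //; apply: Z; right.
  - case=> [/eqP|[X FX X1]]; first by rewrite oner_eq0.
    by have [_] := FT _ FX; apply; right.
pose V := U S.
have Vmax x : exists c, V (x - g c).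
  have [Vx|nVx] := pselect (V x); first by exists 0; rewrite rmorph0 subr0.
  pose Y y := exists2 c, True & V (y - g c * x).
  have sY : sub Y.
    split=> [|y z [c _ Vy] [d _ Vz]|c y [d _ Vy]].
    - by exists 0 => //; rewrite rmorph0 mul0r subr0.
    - exists (c + d) => //; rewrite rmorphD mulrDl opprD addrACA.
      exact: SD.
    - exists (c * d) => //; rewrite rmorphM -mulrA -mulrBr; exact: SZ.
  have [Y1|nY1] := pselect (Y 1).
    case: Y1 => c _ V1; have c0 : c != 0.
      by apply/eqP=> c0; apply: S1; move: V1; rewrite c0 rmorph0 mul0r subr0.
    exists c^-1; have -> : x - g c^-1 = g (- c^-1) * (1 - g c * x).
      by rewrite rmorphN fmorphV; field; rewrite fmorph_eq0.
    exact: SZ.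
  case: (Smax Y).
    split=> [y Sy|YS]; first by exists 0 => //; rewrite rmorph0 mul0r subr0; right.
    apply: nVx; right; apply: YS; exists 1 => //.
    by rewrite rmorph1 mul1r subrr; left.
  have -> : U Y = Y; last by split.
  by apply/funext=> y; apply/propext; split=> [[->|//]|]; [case: sY | right].
have VE c d : V (g c - g d) -> c = d.
  move=> Vcd; apply/eqP; rewrite -subr_eq0; apply/eqP; apply: contrapT => /eqP cd.
  apply: S1; have := SZ (c - d)^-1 _ Vcd.
  by rewrite -rmorphB -rmorphM mulVf // rmorph1.
pose l x := sval (cid (Vmax x)).
have lP x : V (x - g (l x)) by rewrite /l; case: cid.
have lE x c : V (x - g c) -> l x = c.
  move=> Vc; apply: VE;
    have -> : g (l x) - g c = (x - g c) + g (-1) * (x - g (l x)).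
    by rewrite rmorphN1; ring.
  exact: SD Vc (SZ _ _ (lP x)).
exists l; last by apply: lE; rewrite rmorph1 subrr; left.
split=> [x y|c x]; apply: lE.
  by rewrite rmorphD opprD addrACA; apply: SD (lP x) (lP y).
by rewrite rmorphM -mulrBr; apply: SZ (lP x).
Qed.

Lemma semilinear_form_sep x :
  (forall l, semilinear_form l -> l x = 0) -> x = 0.
Proof.
move=> H; have [l lin l1] := semilinear_form_exists; apply/eqP;
  apply: contraT => x0.
have := H _ (semilinear_form_mul x^-1 lin); rewrite mulVf // l1 => /eqP.
by rewrite oner_eq0.
Qed.

Definition indep S (c : 'I_S -> K) : Prop :=
  forall x : 'I_S -> E, \sum_i g (x i) * c i = 0 -> forall i, x i = 0.

Lemma indep_span N (c : 'I_N -> K) :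
  exists S (d : 'I_S -> K) (y : 'I_N -> 'I_S -> E),
    indep d /\ forall i, c i = \sum_t g (y i t) * d t.
Proof.
elim: N c => [|N IH] c.
  by exists 0%N, (fun=> 0), (fun _ _ => 0); split=> [x _ []|[]].
have [S [d [y [dI cE]]]] := IH (fun i => c (lift ord0 i)).
have [[z zE]|nd] := pselect (exists z, c ord0 = \sum_t g (z t) * d t).
  exists S, d, (fun i => oapp y z (unlift ord0 i)); split=> // i.
  by case: (unliftP ord0 i) => [j|] ->.
pose d' (i : 'I_S.+1) := oapp d (c ord0) (unlift ord0 i).
have d'0 : d' ord0 = c ord0 by rewrite /d' unlift_none.
have d'S i : d' (lift ord0 i) = d i by rewrite /d' liftK.
have sumE x : \sum_i g (x i) * d' i =
    g (x ord0) * c ord0 + \sum_i g (x (lift ord0 i)) * d i.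
  by rewrite big_ord_recl d'0; congr (_ + _); apply: eq_bigr => i _; rewrite d'S.
exists S.+1, d', (fun i t => oapp (fun j => oapp (y j) 0 (unlift ord0 t))
  (t == ord0)%:R (unlift ord0 i)); split=> [x|i].
  rewrite sumE => xE; have x0 : x ord0 = 0.
    apply/eqP; apply: contraT => x0; case: nd.
    exists (fun i => - (x ord0)^-1 * x (lift ord0 i)).
    have /eqP := xE; rewrite addrC addr_eq0 => /eqP sE.
    under eq_bigr do rewrite rmorphM -mulrA.
    rewrite -mulr_sumr sE rmorphN mulrN mulNr opprK mulrA -rmorphM mulVf //.
    by rewrite rmorph1 mul1r.
  move=> i; case: (unliftP ord0 i) => [j|] -> //.
  apply: (dI (fun i => x (lift ord0 i))).
  by move: xE; rewrite x0 rmorph0 mul0r add0r.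
case: (unliftP ord0 i) => [j|] -> /=; rewrite sumE /= ?unlift_none /=.
  rewrite rmorph0 mul0r add0r cE; apply: eq_bigr => t _.
  by rewrite liftK.
by rewrite rmorph1 mul1r big1 ?addr0 // => t _; rewrite rmorph0 mul0r.
Qed.

End Independence.

Section InnerAutomorphism.
Variables (C : fieldType) (n : nat).
Local Notation M := 'M[C]_n.+1.

(** The images [e i j] multiply like matrix units. For a nonzero row [w] fixed by [e 0 0], the rows
    [w *m e 0 i] are independent, because [e j 0] takes the [j]-th one back to [w] and kills the
    others; in the basis they form, [theta X] acts as [X]. *)
Lemma matrix_aut_inner (theta : M -> M) :
  (forall X Y, theta (X + Y) = theta X + theta Y) ->
  (forall a X, theta (a *: X) = a *: theta X) ->
  (forall X Y, theta (X * Y) = theta X * theta Y) -> injective theta ->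
  exists2 h : M, h \is a GRing.unit & forall X, theta X = h * X / h.
Proof.
move=> tD tZ tM tI.
have t0 : theta 0 = 0 by have := tZ 0 0; rewrite !scale0r.
pose e i j : M := theta (delta_mx i j).
have eM i j k l : e i j *m e k l = if j == k then e i l else 0.
  rewrite /e -[_ *m _]/(_ * _) -tM -[_ * _ in LHS]/(_ *m _) mul_delta_mx_cond.
  by case: (j == k); rewrite ?mulr1n ?mulr0n.
have e00 : e ord0 ord0 != 0.
  rewrite -t0 (inj_eq tI); apply/eqP=> /matrixP/(_ ord0 ord0).
  by rewrite !mxE eqxx => /eqP; rewrite oner_eq0.
have [r w0] : exists r, row r (e ord0 ord0) != 0.
  apply: contrapT => H; move/eqP: e00; apply; apply/row_matrixP=> i.
  by rewrite row0; apply/eqP; apply: contraT => Hi; case: H; exists i.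
set w := row r _ in w0.
have wE : w *m e ord0 ord0 = w by rewrite /w -row_mul eM eqxx.
pose h : M := \matrix_i (w *m e ord0 i).
have hrow i : row i h = w *m e ord0 i by rewrite rowK.
have hU : h \in unitmx.
  rewrite -row_free_unit -kermx_eq0; apply/eqP/row_matrixP=> i; rewrite row0.
  set c := row i _; have : c *m h = 0 by rewrite /c -row_mul mulmx_ker row0.
  rewrite mulmx_sum_row => cE; apply/rowP=> j; rewrite [RHS]mxE.
  have := congr1 (mulmx^~ (e j ord0)) cE; rewrite mul0mx mulmx_suml (bigD1 j) //=.
  rewrite big1 ?addr0 => [|k kj]; last first.
    by rewrite hrow -scalemxAl -mulmxA eM (negPf kj) mulmx0 scaler0.
  rewrite hrow -scalemxAl -mulmxA eM eqxx wE => /eqP.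
  by rewrite scaler_eq0 (negPf w0) orbF => /eqP.
have hE X : h *m theta X = X *m h.
  rewrite [X]matrix_sum_delta.
  rewrite (big_morph theta tD t0) mulmx_sumr mulmx_suml; apply: eq_bigr => i _.
  rewrite (big_morph theta tD t0) mulmx_sumr mulmx_suml; apply: eq_bigr => j _.
  rewrite tZ -scalemxAr -scalemxAl -/(e i j); congr (_ *: _); apply/row_matrixP=> k.
  rewrite !row_mul hrow -mulmxA eM; case: eqVneq => [<-|ki].
    by rewrite rowE mul_delta_mx -rowE hrow.
  by rewrite mulmx0 rowE mul_delta_mx_0 // mul0mx.
exists h^-1; first by rewrite unitrV.
by move=> X; rewrite invrK -mulrA -[X * h]hE mulrA mulVr // mul1r.
Qed.

End InnerAutomorphism.

(** * Automorphisms of a Picard-Vessiot extension *)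

Lemma rmorph_mmap n (R S T : comNzRingType) (f : {rmorphism R -> S})
    (h : 'I_n -> S) (phi : {rmorphism S -> T}) (p : {mpoly R[n]}) :
  phi (mmap f h p) = mmap (phi \o f) (phi \o h) p.
Proof.
rewrite /mmap rmorph_sum; apply: eq_bigr => i _; rewrite rmorphM; congr (_ * _).
by rewrite /mmap1 rmorph_prod; apply: eq_bigr => j _; rewrite rmorphXn.
Qed.

HB.instance Definition _ (R : deltaRingType) :=
  GRing.isZmodMorphism.Build R R (@delta R) (@deltaB R).

Lemma map_mx_deltaM (R : deltaRingType) m n p (X : 'M[R]_(m, n))
  (Y : 'M[R]_(n, p)) :
  map_mx delta (X *m Y) = map_mx delta X *m Y + X *m map_mx delta Y.
Proof.
apply/matrixP=> i j; rewrite !mxE delta_sum -big_split /=.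
by apply: eq_bigr => l _; rewrite deltaM !mxE.
Qed.

Section CoefDelta.
Variables (K : deltaFieldType) (n : nat).
Implicit Types p q : {mpoly K[n]}.

Definition coef_delta p : {mpoly K[n]} := map_mpoly delta p.

Lemma coef_deltaE p i : (coef_delta p)@_i = delta p@_i.
Proof. exact: mcoeff_map_mpoly. Qed.

Lemma coef_deltaD : {morph coef_delta : p q / p + q}.
Proof. exact: raddfD. Qed.

Lemma coef_delta_sum I (r : seq I) (P : pred I) (G : I -> {mpoly K[n]}) :
  coef_delta (\sum_(i <- r | P i) G i) = \sum_(i <- r | P i) coef_delta (G i).
Proof. exact: raddf_sum. Qed.

Lemma coef_deltaM p q : coef_delta (p * q) = coef_delta p * q + p * coef_delta q.
Proof.
apply/mpolyP=> i; rewrite mcoeffD coef_deltaE !mcoeffM delta_sum -big_split /=.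
by apply: eq_bigr => j _; rewrite deltaM !coef_deltaE.
Qed.

Lemma coef_deltaC c : coef_delta c%:MP = (delta c)%:MP.
Proof. exact: map_mpolyC. Qed.

Lemma coef_deltaZ c p : coef_delta (c *: p) = delta c *: p + c *: coef_delta p.
Proof. by rewrite -!mul_mpolyC coef_deltaM coef_deltaC. Qed.

End CoefDelta.

Section ConstExt.
Variables (F K : deltaFieldType) (iota : deltaExt F K).

HB.instance Definition _ :=
  GRing.RMorphism.copy (const_ext iota) (iota \o val).

Lemma delta_const_ext c : delta (const_ext iota c) = 0.
Proof. by rewrite /= -ext_delta; have /eqP-> := valP c; rewrite rmorph0. Qed.

Lemma const_extP x : same_constants iota ->
  delta x = 0 -> exists c, x = const_ext iota c.
Proof.
move=> constE /(constE _).1[c c0 ->].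
have cc : is_const c by apply/eqP.
by exists (exist _ c cc).
Qed.

Lemma const_ext_mxP m n (X : 'M[K]_(m, n)) : same_constants iota ->
  map_mx delta X = 0 -> exists Y, X = map_mx (const_ext iota) Y.
Proof.
move=> constE X0.
have H i j : exists c, X i j = const_ext iota c.
  by apply: const_extP => //; have /matrixP/(_ i j) := X0; rewrite !mxE.
exists (\matrix_(i, j) sval (cid (H i j))).
by apply/matrixP=> i j; rewrite !mxE; case: cid.
Qed.

Lemma gal_const s c : (s : deltaGal iota) (const_ext iota c) = const_ext iota c.
Proof. exact: gal_fix. Qed.

End ConstExt.

(** At a point with coordinates in [E], independence makes [p] vanish only if every [q t] does;
    conditions over [K] thus become conditions over [E]. *)
Lemma mpoly_indep_expand (E K : fieldType) (g : {rmorphism E -> K}) n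
    (p : {mpoly K[n]}) :
  exists S (d : 'I_S -> K) (q : 'I_S -> {mpoly E[n]}),
    indep g d /\ p = \sum_t d t *: map_mpoly g (q t).
Proof.
pose r := msupp p.
have [S [d [y [dI cE]]]] :=
  indep_span g (fun i : 'I_(size r) => p@_(tnth (in_tuple r) i)).
exists S, d, (fun t => \sum_i y i t *: 'X_[tnth (in_tuple r) i]); split=> //.
rewrite {1}[p]mpolyE big_tnth.
under eq_bigr do rewrite cE scaler_suml.
rewrite exchange_big; apply: eq_bigr => t _.
rewrite (raddf_sum (map_mpoly g)) scaler_sumr; apply: eq_bigr => i _.
by rewrite -[GRing.Additive.sort _ _]/(map_mpoly g _) map_mpolyZ map_mpolyX
  scalerA [d t * _]mulrC.
Qed.

(** * Extended delta-ideals and their constant points *)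

Section PV.
Variables (F K : deltaFieldType) (iota : deltaExt F K) (m : nat).
Variables (a : 'M[F]_m) (k : 'M[K]_m).
Local Notation C := (constants F).
Local Notation gam := (const_ext iota).
Local Notation FX := {mpoly F[m * m]}.
Local Notation KY := {mpoly K[m * m]}.
Hypothesis constE : same_constants iota.
Hypothesis closed : GRing.closed_field_axiom C.
Hypothesis kU : k \in unitmx.
Hypothesis dk : map_mx delta k = map_mx iota a *m k.

Definition ev (q : FX) (X : 'M[K]_m) : K := mmap iota (mxvec X 0) q.

Definition generic_mx (R : nzRingType) : 'M[{mpoly R[m * m]}]_m :=
  \matrix_(i, j) 'X_(mxvec_index i j).

(** q(X) |-> q(kY) *)
Definition subst : FX -> KY :=
  mmap (@mpolyC _ K \o iota)
       (mxvec (map_mx (@mpolyC _ K) k *m generic_mx K) 0).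

HB.instance Definition _ := GRing.RMorphism.copy subst
  (mmap (@mpolyC _ K \o iota) (mxvec (map_mx (@mpolyC _ K) k *m generic_mx K) 0)).

Lemma evX X i j : ev 'X_(mxvec_index i j) X = X i j.
Proof. by rewrite /ev mmapX mmap1U mxvecE. Qed.

Lemma evC X c : ev c%:MP X = iota c.
Proof. exact: mmapC. Qed.

Lemma evD X p q : ev (p + q) X = ev p X + ev q X.
Proof. exact: rmorphD. Qed.

Lemma evB X p q : ev (p - q) X = ev p X - ev q X.
Proof. exact: rmorphB. Qed.

Lemma evM X p q : ev (p * q) X = ev p X * ev q X.
Proof. exact: rmorphM. Qed.

Lemma ev_gal (s : deltaGal iota) q X : s (ev q X) = ev q (map_mx s X).
Proof.
rewrite /ev rmorph_mmap;
  apply: (@mpoly_morph_eq _ _ _ (mmap _ _) (mmap _ _)) => [c|i] /=.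
  by rewrite !mmapC /= gal_fix.
by rewrite !mmapX !mmap1U -map_mxvec mxE.
Qed.

Lemma substC c : subst c%:MP = (iota c)%:MP.
Proof. exact: mmapC. Qed.

Lemma substZ c q : subst (c *: q) = iota c *: subst q.
Proof. by rewrite -!mul_mpolyC rmorphM /= substC. Qed.

Lemma subst_sum T (r : seq T) (P : pred T) (G : T -> FX) :
  subst (\sum_(i <- r | P i) G i) = \sum_(i <- r | P i) subst (G i).
Proof. exact: rmorph_sum. Qed.

Lemma ev_sum X T (r : seq T) (P : pred T) (G : T -> FX) :
  ev (\sum_(i <- r | P i) G i) X = \sum_(i <- r | P i) ev (G i) X.
Proof. exact: rmorph_sum. Qed.

Lemma evZ X c q : ev (c *: q) X = iota c * ev q X.
Proof. exact: mmapZ. Qed.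

Lemma substX i j : subst 'X_(mxvec_index i j) =
  \sum_l k i l *: 'X_(mxvec_index l j).
Proof.
rewrite /subst mmapX mmap1U mxvecE mxE; apply: eq_bigr => l _.
by rewrite !mxE mul_mpolyC.
Qed.

Lemma subst_meval q (X : 'M[K]_m) : (subst q).@[mxvec X 0] = ev q (k *m X).
Proof.
rewrite /subst /ev rmorph_mmap.
apply: (@mpoly_morph_eq _ _ _ (mmap _ _) (mmap _ _)) => [c|i] /=.
  by rewrite !mmapC /= mevalC.
case/mxvec_indexP: i => i j; rewrite !mmapX !mmap1U /= !mxvecE !mxE raddf_sum.
by apply: eq_bigr => l _; rewrite !mxE /= mevalM mevalC mevalXU mxvecE.
Qed.

Definition mdet : FX := \det (generic_mx F).

Lemma ev_mdet X : ev mdet X = \det X.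
Proof.
rewrite -[LHS](det_map_mx (mmap iota (mxvec X 0))); congr (\det _).
by apply/matrixP=> i j; rewrite !mxE; apply: evX.
Qed.

Lemma mpoly_mx_ind (R : nzRingType) (P : {mpoly R[m * m]} -> Prop) :
  (forall c, P c%:MP) -> (forall i j, P 'X_(mxvec_index i j)) ->
  (forall p q, P p -> P q -> P (p + q)) ->
  (forall p q, P p -> P q -> P (p * q)) -> forall p, P p.
Proof.
by move=> PC PX PD PM; apply: mpoly_ring_ind => // i; case/mxvec_indexP: i.
Qed.

(** [q'] is the derivative of [q] for the derivation of F[X] with X' = aX. Both [k] and kY, with Y
    constant, satisfy this equation, so evaluation and substitution commute with the derivations. *)
Lemma delta_subst q : exists q', coef_delta (subst q) = subst q' /\
  delta (ev q k) = ev q' k.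
Proof.
elim/mpoly_mx_ind: q => [c|i j|p q [p' [E1 E2]] [q' [E3 E4]]|
                         p q [p' [E1 E2]] [q' [E3 E4]]].
- exists (delta c)%:MP; rewrite !substC coef_deltaC !evC -ext_delta.
  by split.
- exists (\sum_l a i l *: 'X_(mxvec_index l j)); split.
    rewrite substX coef_delta_sum subst_sum.
    under eq_bigr do rewrite coef_deltaZ.
    under [RHS]eq_bigr do rewrite substZ substX scaler_sumr.
    rewrite [RHS]exchange_big; apply: eq_bigr => l _ /=.
    have -> : coef_delta ('X_(mxvec_index l j) : KY) = 0.
      apply/mpolyP=> u; rewrite coef_deltaE mcoeffX mcoeff0.
      by case: (_ == _); rewrite ?delta1 ?delta0.
    rewrite scaler0 addr0; have /matrixP/(_ i l) := dk; rewrite !mxE => ->.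
    rewrite scaler_suml; apply: eq_bigr => t _.
    by rewrite mxE scalerA.
  rewrite evX; have /matrixP/(_ i j) := dk; rewrite !mxE => ->.
  rewrite ev_sum; apply: eq_bigr => l _.
  by rewrite evZ mxE evX.
- by exists (p' + q'); rewrite !rmorphD !evD coef_deltaD deltaD E1 E2 E3 E4.
- exists (p' * q + p * q'); rewrite rmorphM evM coef_deltaM deltaM E1 E3 E2 E4.
  by rewrite rmorphD !rmorphM evD !evM.
Qed.

Section Ideal.
Variable I : K -> Prop.
Hypothesis IM : forall q x, I x -> I (ev q k * x).
Hypothesis Idelta : forall x, I x -> I (delta x).

(** The extension to K[Y] of the ideal of those [q] whose value at [k] lies in [I]. Linear
    combinations over [K] already form an ideal, as the entries of Y are combinations over [K] of
    those of kY. *)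
Inductive ext_ideal : KY -> Prop :=
| ext_ideal0 : ext_ideal 0
| ext_idealD g h : ext_ideal g -> ext_ideal h -> ext_ideal (g + h)
| ext_ideal_gen c q : I (ev q k) -> ext_ideal (c *: subst q).

Lemma ext_idealZ c g : ext_ideal g -> ext_ideal (c *: g).
Proof.
elim=> [|g1 g2 _ IH1 _ IH2|d q Iq]; first by rewrite scaler0; apply: ext_ideal0.
  by rewrite scalerDr; apply: ext_idealD.
by rewrite scalerA; apply: ext_ideal_gen.
Qed.

Lemma ext_ideal_sum T (r : seq T) (P : pred T) (G : T -> KY) :
  (forall i, P i -> ext_ideal (G i)) -> ext_ideal (\sum_(i <- r | P i) G i).
Proof.
by move=> H; apply: (big_ind ext_ideal) => //;
  [apply: ext_ideal0 | apply: ext_idealD].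
Qed.

Lemma ext_ideal_subst p g : ext_ideal g -> ext_ideal (subst p * g).
Proof.
elim=> [|g1 g2 _ IH1 _ IH2|d q Iq]; first by rewrite mulr0; apply: ext_ideal0.
  by rewrite mulrDr; apply: ext_idealD.
by rewrite -scalerAr -rmorphM; apply: ext_ideal_gen; rewrite evM; apply: IM.
Qed.

Lemma genX_subst i j :
  'X_(mxvec_index i j) = \sum_l invmx k i l *: subst 'X_(mxvec_index l j).
Proof.
under eq_bigr do rewrite substX scaler_sumr.
rewrite exchange_big /=;
  transitivity (\sum_t (1%:M : 'M[K]_m) i t *: 'X_(mxvec_index t j) : KY).
  rewrite (bigD1 i) //= big1 => [|t ti]; first by rewrite mxE eqxx scale1r addr0.
  by rewrite mxE eq_sym (negPf ti) scale0r.
apply: eq_bigr => t _; rewrite -(mulVmx kU) mxE scaler_suml.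
by apply: eq_bigr => l _; rewrite scalerA.
Qed.

Lemma ext_ideal_ideal : ideal_pred ext_ideal.
Proof.
split=> [||x]; [exact: ext_ideal0 | exact: ext_idealD|].
elim/mpoly_mx_ind: x => [c|i j|p q Hp Hq|p q Hp Hq] g Jg.
- by rewrite mul_mpolyC; apply: ext_idealZ.
- rewrite genX_subst mulr_suml; apply: ext_ideal_sum => l _.
  by rewrite -scalerAl; apply/ext_idealZ/ext_ideal_subst.
- by rewrite mulrDl; apply: ext_idealD; [apply: Hp | apply: Hq].
- by rewrite -mulrA; apply/Hp/Hq.
Qed.

Lemma ext_ideal_delta g : ext_ideal g -> ext_ideal (coef_delta g).
Proof.
elim=> [|g1 g2 _ IH1 _ IH2|c q Iq]; first by rewrite /coef_delta raddf0;
  apply: ext_ideal0.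
  by rewrite coef_deltaD; apply: ext_idealD.
have [q' [E1 E2]] := delta_subst q.
rewrite coef_deltaZ E1; apply: ext_idealD; apply: ext_ideal_gen => //.
by rewrite -E2; apply: Idelta.
Qed.

(* Dividing a relation by its first coefficient and differentiating shortens
   it, and preserves the independence of the other coefficients. *)
Lemma ext_ideal_indep S (c : 'I_S -> K) (d : 'I_S -> KY) :
  indep gam c -> (forall s, coef_delta (d s) = 0) ->
  ext_ideal (\sum_s c s *: d s) -> forall s, ext_ideal (d s).
Proof.
elim: S c d => [|S IH] c d cI d0 Jd s; first by case: s.
have c0 : c ord0 != 0.
  apply/eqP=> c0; have := oner_eq0 C;
    rewrite -(cI (fun i => (i == ord0)%:R) _ ord0).
    by rewrite !eqxx.
  rewrite (bigD1 ord0) //= c0 mulr0 big1 ?addr0 // => i /negPf->.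
  by rewrite rmorph0 mul0r.
pose b i := c (lift ord0 i) / c ord0.
have JD : ext_ideal (\sum_i delta (b i) *: d (lift ord0 i)).
  have := ext_ideal_delta (ext_idealZ (c ord0)^-1 Jd).
  rewrite scaler_sumr coef_delta_sum big_ord_recl scalerA mulVf // scale1r d0 add0r.
  congr ext_ideal; apply: eq_bigr => i _.
  by rewrite scalerA coef_deltaZ d0 scaler0 addr0 mulrC.
have bI : indep gam (fun i => delta (b i)).
  (* A relation among the derivatives makes the sum of the [x i * b i] a constant, hence an element
     of [C]; multiplied by [c ord0], this is a relation among the [c i]. *)
  move=> x xE; have [z zE] : exists z, \sum_i gam (x i) * b i = gam z.
    apply: const_extP => //; rewrite delta_sum -[RHS]xE; apply: eq_bigr => i _.
    by rewrite deltaM delta_const_ext mul0r add0r.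
  have := cI (fun i => oapp x (- z) (unlift ord0 i));
    rewrite big_ord_recl unlift_none /=.
  move=> H i; have := H _ (lift ord0 i); rewrite liftK; apply.
  have -> : gam (- z) = - gam z by apply: rmorphN.
  rewrite -zE mulNr mulr_suml addrC; apply/eqP; rewrite subr_eq0; apply/eqP.
  by apply: eq_bigr => j _; rewrite liftK /= /b -mulrA mulfVK.
have JS : forall i, ext_ideal (d (lift ord0 i)) by apply: IH bI _ JD => i;
  apply: d0.
case: (unliftP ord0 s) => [j|] -> //.
have {}Jd : ext_ideal (c ord0 *: d ord0).
  have -> : c ord0 *: d ord0 =
    (\sum_s c s *: d s) - \sum_i c (lift ord0 i) *: d (lift ord0 i).
    by rewrite [in RHS]big_ord_recl addrK.
  apply: (ideal_predB ext_ideal_ideal Jd); apply: ext_ideal_sum => i _.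
  exact: ext_idealZ.
by have := ext_idealZ (c ord0)^-1 Jd; rewrite scalerA mulVf // scale1r.
Qed.

(** A prime [P] containing the extended ideal and missing [f * subst mdet] is contracted to constant
    polynomials. Each [subst q] in the ideal has constant components that lie in it too, so all of
    them vanish at [xi]; and some constant component of [f * subst mdet] lies outside [P], so it can
    be kept nonzero at [xi]. The factor [mdet] makes [xi] invertible. *)
Lemma point_of_ext_ideal (f : KY) :
  (forall r, ~ ext_ideal ((f * subst mdet) ^+ r)) ->
  exists xi : 'M[C]_m, [/\ forall q, I (ev q k) -> ev q (k *m map_mx gam xi) = 0,
    f.@[mxvec (map_mx gam xi) 0] != 0 & xi \in unitmx].
Proof.
move=> /(prime_avoiding ext_ideal_ideal)[P [primP JP Ph]].
have evg (p : {mpoly C[m * m]}) (xi : 'I_(m * m) -> C) :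
    (map_mpoly gam p).@[gam \o xi] = gam p.@[xi].
  apply: (@mpoly_morph_eq _ _ _ (meval _ \o map_mpoly gam) (gam \o meval xi)).
    by move=> c /=; rewrite map_mpolyC !mevalC.
  by move=> i /=; rewrite map_mpolyX !mevalXU.
have [S [c [h [cI hE]]]] := mpoly_indep_expand gam (f * subst mdet).
have [s Phs] : exists s, ~ P (map_mpoly gam (h s)).
  apply: contrapT => H; apply: Ph; rewrite hE;
    apply: (ideal_pred_sum (prime_ideal primP)) => t _.
  rewrite -mul_mpolyC; apply: (ideal_predM (prime_ideal primP)).
  by apply: contrapT => ?; apply: H; exists t.
have [xi [xiP xih]] :=
  nullstellensatz closed (prime_pred_preim (map_mpoly gam) primP) Phs.
have expand_eval p S' (c' : 'I_S' -> K) (h' : 'I_S' -> {mpoly C[m * m]}) :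
    p = \sum_t c' t *: map_mpoly gam (h' t) ->
    p.@[gam \o xi] = \sum_t gam (h' t).@[xi] * c' t.
  move=> ->; rewrite raddf_sum; apply: eq_bigr => t _ /=.
  by rewrite mevalZ evg mulrC.
pose X : 'M[C]_m := vec_mx (\row_i xi i).
have XE : mxvec (map_mx gam X) 0 =1 gam \o xi.
  by move=> i; rewrite -map_mxvec vec_mxK !mxE.
have XE' p : p.@[mxvec (map_mx gam X) 0] = p.@[gam \o xi] by apply: meval_eq.
have : (f * subst mdet).@[gam \o xi] != 0.
  by apply/eqP; rewrite (expand_eval _ _ _ _ hE) => /cI/(_ s)/eqP; exact/negP.
rewrite mevalM mulf_eq0 negb_or -!XE' => /andP[fX dX].
exists X; split=> // [q Iq|].
  rewrite -subst_meval XE';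
    have [S' [c' [h' [cI' hE']]]] := mpoly_indep_expand gam (subst q).
  rewrite (expand_eval _ _ _ _ hE') big1 // => t _; rewrite xiP ?rmorph0 ?mul0r //.
  apply: JP; move: t; apply: (ext_ideal_indep cI') => [u|].
    apply/mpolyP=> w; rewrite coef_deltaE mcoeff_map_mpoly mcoeff0;
      exact: delta_const_ext.
  by rewrite -hE' -[subst q]scale1r; apply: ext_ideal_gen.
move: dX; rewrite subst_meval ev_mdet det_mulmx mulf_eq0 negb_or => /andP[_].
by rewrite det_map_mx fmorph_eq0 -unitfE -unitmxE.
Qed.

End Ideal.

End PV.

Lemma semilinear_additive (E K : fieldType) (g : {rmorphism E -> K})
    (l : K -> E) (lin : semilinear_form g l) : zmod_morphism l.
Proof.
move=> x y; have [lD lZ] := lin; rewrite lD; congr (_ + _).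
by rewrite -mulN1r -(rmorph1 g) -rmorphN lZ mulN1r.
Qed.

(** * Contracting extended ideals by linear forms *)

Section Pairing.
Variables (F K : deltaFieldType) (iota : deltaExt F K) (m : nat).
Variables (k : 'M[K]_m) (kU : k \in unitmx).
Variables (l : K -> F) (lin : semilinear_form iota l).
Local Notation KY := {mpoly K[m * m]}.
Local Notation FX := {mpoly F[m * m]}.

Let lA := GRing.isZmodMorphism.Build K F l (semilinear_additive lin).
Let L : {additive K -> F} := HB.pack l lA.

Let unsubst : {rmorphism KY -> KY} :=
  mmap (@mpolyC _ K) (mxvec (map_mx (@mpolyC _ K) (invmx k) *m generic_mx m K) 0).

Let unsubstK q : unsubst (subst iota k q) = map_mpoly iota q.
Proof.
apply: (@mpoly_morph_eq _ _ _ (unsubst \o subst iota k) (map_mpoly iota)) =>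
  [c|i] /=.
  by rewrite substC mmapC map_mpolyC.
case/mxvec_indexP: i => i j; rewrite substX map_mpolyX raddf_sum /=.
transitivity (\sum_t (1%:M : 'M[K]_m) i t *: 'X_(mxvec_index t j) : KY); last first.
  rewrite (bigD1 i) //= big1 => [|t ti]; first by rewrite mxE eqxx scale1r addr0.
  by rewrite mxE eq_sym (negPf ti) scale0r.
under eq_bigr do rewrite mmapZ mmapX mmap1U mxvecE mxE mulr_sumr.
rewrite exchange_big; apply: eq_bigr => t _;
  rewrite -(mulmxV kU) [in RHS]mxE scaler_suml.
by apply: eq_bigr => u _; rewrite !mxE mulrA -mpolyCM mul_mpolyC.
Qed.

(** With K[Y] seen as K ⊗_F F[X], this is [l] tensored with evaluation at [k]. It carries the
    extension of [I] back into [I]. *)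
Definition pairing (g : KY) : K := ev iota (map_mpoly L (unsubst g)) k.

Lemma pairingD g h : pairing (g + h) = pairing g + pairing h.
Proof. by rewrite /pairing rmorphD (raddfD (map_mpoly L)) evD. Qed.

Lemma pairing0 : pairing 0 = 0.
Proof. by rewrite /pairing rmorph0 (raddf0 (map_mpoly L)) /ev mmap0. Qed.

Lemma pairingE c q : pairing (c *: subst iota k q) = iota (l c) * ev iota q k.
Proof.
rewrite /pairing -mul_mpolyC rmorphM unsubstK [unsubst _]mmapC -evZ;
  congr (ev _ _ _).
apply/mpolyP=> u; rewrite mcoeff_map_mpoly mul_mpolyC !mcoeffZ mcoeff_map_mpoly.
by have [_ lZ] := lin; rewrite mulrC [LHS]lZ mulrC.
Qed.

Lemma ext_ideal_pairing (I : K -> Prop) g :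
  I 0 -> (forall x y, I x -> I y -> I (x + y)) ->
  (forall q x, I x -> I (ev iota q k * x)) ->
  ext_ideal iota k I g -> I (pairing g).
Proof.
move=> I0 ID IM; elim=> [|g1 g2 _ IH1 _ IH2|c q Iq]; first by rewrite pairing0.
  by rewrite pairingD; apply: ID.
by rewrite pairingE -[iota _](evC _ k); apply: IM.
Qed.

End Pairing.

(** * Right translations by constant matrices *)

Section Translate.
Variables (F : deltaFieldType) (m : nat).
Local Notation C := (constants F).
Local Notation FX := {mpoly F[m * m]}.
Implicit Types (z w : 'M[C]_m) (q : FX).

(** q(X) |-> q(X z) *)
Definition translate z : FX -> FX :=
  mmap (@mpolyC _ F) (mxvec (generic_mx m F *m map_mx (@mpolyC _ F \o val) z) 0).

HB.instance Definition _ z := GRing.RMorphism.copy (translate z)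
  (mmap (@mpolyC _ F) (mxvec (generic_mx m F *m map_mx (@mpolyC _ F \o val) z) 0)).

Lemma translateC z c : translate z c%:MP = c%:MP.
Proof. exact: mmapC. Qed.

Lemma translateD z p q : translate z (p + q) = translate z p + translate z q.
Proof. exact: rmorphD. Qed.

Lemma translateM z p q : translate z (p * q) = translate z p * translate z q.
Proof. exact: rmorphM. Qed.

Lemma translateZ z c q : translate z (c *: q) = c *: translate z q.
Proof. by rewrite -!mul_mpolyC translateM translateC. Qed.

Lemma translate_sum z T (r : seq T) (P : pred T) (G : T -> FX) :
  translate z (\sum_(i <- r | P i) G i) = \sum_(i <- r | P i) translate z (G i).
Proof. exact: rmorph_sum. Qed.

Lemma translateX z i j : translate z 'X_(mxvec_index i j) =
  \sum_l val (z l j) *: 'X_(mxvec_index i l).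
Proof.
rewrite /translate mmapX mmap1U mxvecE mxE; apply: eq_bigr => l _.
by rewrite !mxE mulrC mul_mpolyC.
Qed.

Lemma translate1 q : translate 1%:M q = q.
Proof.
elim/mpoly_mx_ind: q => [c|i j|p q Ep Eq|p q Ep Eq].
- exact: translateC.
- rewrite translateX (bigD1 j) //= big1 => [|l lj].
    by rewrite mxE eqxx scale1r addr0.
  by rewrite mxE (negPf lj) scale0r.
- by rewrite translateD Ep Eq.
- by rewrite translateM Ep Eq.
Qed.

Lemma translate_mul z w q : translate z (translate w q) = translate (z *m w) q.
Proof.
elim/mpoly_mx_ind: q => [c|i j|p q Ep Eq|p q Ep Eq].
- by rewrite !translateC.
- rewrite !translateX translate_sum.
  under eq_bigr do rewrite translateZ translateX scaler_sumr.
  rewrite exchange_big; apply: eq_bigr => l _.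
  rewrite mxE raddf_sum scaler_suml; apply: eq_bigr => u _.
  by rewrite scalerA mulrC.
- by rewrite !translateD Ep Eq.
- by rewrite !translateM Ep Eq.
Qed.

Lemma translateI z : z \in unitmx -> injective (translate z).
Proof.
move=> zU; apply: (@can_inj _ _ _ (translate (invmx z))) => q.
by rewrite translate_mul mulVmx // translate1.
Qed.

Lemma msize_translate z q : (msize (translate z q) <= msize q)%N.
Proof.
have sM (p p' : FX) e e' : (msize p <= e.+1)%N -> (msize p' <= e'.+1)%N ->
    (msize (p * p') <= (e + e').+1)%N.
  move=> pe pe'; have [->|p0] := eqVneq p 0; first by rewrite mul0r msize0.
  have [->|p0'] := eqVneq p' 0; first by rewrite mulr0 msize0.
  by rewrite msizeM // -subn1 leq_subLR add1n -addSn -addnS leq_add.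
have sX (p : FX) e : (msize p <= 2)%N -> (msize (p ^+ e) <= e.+1)%N.
  move=> p2; elim: e => [|e IH]; first by rewrite expr0 msize1.
  by rewrite exprS; apply: (sM _ _ 1%N e).
rewrite /translate /mmap; apply: leq_trans (msize_sum _ _ _) _.
rewrite msizeE; elim/big_ind2: _ => // [x x' y y' xy xy'|u _].
  by rewrite geq_max !leq_max xy xy' orbT.
rewrite mul_mpolyC; apply: leq_trans (msizeZ_le _ _) _.
rewrite /mmap1 mdegE; elim/big_ind2: _ => [|p e p' e' pe pe'|i _].
- by rewrite msize1.
- exact: sM.
- apply: sX; case/mxvec_indexP: i => i j; rewrite mxvecE mxE.
  apply: leq_trans (msize_sum _ _ _) _; apply/bigmax_leqP => l _.
  by rewrite !mxE mulrC mul_mpolyC; apply: leq_trans (msizeZ_le _ _) _;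
    rewrite msizeX mdeg1.
Qed.

End Translate.

(** * Automorphisms from constant points *)

Section Galois.
Variables (F K : deltaFieldType) (iota : deltaExt F K) (m : nat).
Variables (a : 'M[F]_m) (k : 'M[K]_m).
Local Notation C := (constants F).
Local Notation gam := (const_ext iota).
Local Notation FX := {mpoly F[m * m]}.
Local Notation KY := {mpoly K[m * m]}.
Local Notation ev := (ev iota).
Hypothesis constE : same_constants iota.
Hypothesis closed : GRing.closed_field_axiom C.
Hypothesis kU : k \in unitmx.
Hypothesis dk : map_mx delta k = map_mx iota a *m k.
Hypothesis gen_k : field_generated iota k.

Lemma fractionP x : exists p q, ev q k != 0 /\ x = ev p k / ev q k.
Proof.
pose S := [pred x : K | `[< exists p q, ev q k != 0 /\ x = ev p k / ev q k >]].
suff /asboolP : x \in S by [].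
apply: gen_k => [|c|i j]; first split.
- by apply/asboolP; exists 1%:MP, 1%:MP; rewrite evC rmorph1 oner_eq0 divr1.
- move=> y z /asboolP[p [q [q0 ->]]] /asboolP[p' [q' [q0' ->]]]; apply/asboolP.
  exists (p * q' - q * p'), (q * q'); rewrite !evM mulf_neq0 //; split=> //.
  by rewrite evB !evM; field; rewrite q0 q0'.
- move=> y z /asboolP[p [q [q0 ->]]] /asboolP[p' [q' [q0' ->]]]; apply/asboolP.
  have [p0|p0] := eqVneq (ev p' k) 0.
    by exists 0%:MP, 1%:MP;
      rewrite !evC rmorph1 oner_eq0 p0 rmorph0 !mul0r invr0 mulr0.
  exists (p * q'), (q * p'); rewrite !evM mulf_neq0 //; split=> //.
  by field; rewrite q0 p0 q0'.
- by apply/asboolP; exists c%:MP, 1%:MP; rewrite !evC rmorph1 oner_eq0 divr1.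
- by apply/asboolP; exists 'X_(mxvec_index i j), 1%:MP;
  rewrite evX evC rmorph1 oner_eq0 divr1.
Qed.

Section Point.
Variable xi : 'M[C]_m.
Hypothesis xiU : xi \in unitmx.
Hypothesis rel : forall q, ev q k = 0 -> ev q (k *m map_mx gam xi) = 0.

Let ev_translate (z : 'M[C]_m) q (X : 'M[K]_m) :
  ev (translate z q) X = ev q (X *m map_mx gam z).
Proof.
elim/mpoly_mx_ind: q => [c|i j|p q Ep Eq|p q Ep Eq].
- by rewrite translateC !evC.
- rewrite translateX evX mxE ev_sum; apply: eq_bigr => l _.
  by rewrite evZ evX mxE mulrC.
- by rewrite translateD !evD Ep Eq.
- by rewrite translateM !evM Ep Eq.
Qed.

(* By rel, if q vanishes at k xi then so do all iterates of q under X |-> X xi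
   at k, except perhaps q itself; but q is a combination of these iterates,
   since they have bounded degree. *)
Let ev_point_inj q : ev q (k *m map_mx gam xi) = 0 -> ev q k = 0.
Proof.
move=> q0; apply/eqP; apply: contraT => qk.
pose it i := iter i (translate xi) q.
have it0 i : ev (it i.+1) k = 0.
  by elim: i => [|i IH]; rewrite /it /= ev_translate //; apply: rel.
have itI N (x : nat -> F) : \sum_(i < N) x i *: it i = 0 ->
    forall i, (i < N)%N -> x i = 0.
  elim: N x => // N IH x; rewrite big_ord_recl => xE.
  have x0 : x 0%N = 0.
    have := congr1 (fun p => ev p k) xE;
      rewrite /= evD evZ ev_sum big1 => [|i _]; last first.
      by rewrite evZ it0 mulr0.
    rewrite addr0 -mpolyC0 evC rmorph0 => /eqP.
    by rewrite mulf_eq0 (negPf qk) orbF fmorph_eq0 => /eqP.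
  case=> // i iN; apply: (IH (fun i => x i.+1)) => //.
  apply: (translateI xiU); rewrite rmorph0 translate_sum -[RHS]xE x0 scale0r add0r.
  by apply: eq_bigr => j _; rewrite translateZ.
(* [N] counts the monomials of degree below [d], so [N.+1] iterates are linearly dependent. *)
pose d := msize q; pose N := #|{: 'X_{1..(m * m) < d}}|.
have itd i : (msize (it i) <= d)%N.
  by elim: i => [|i IH] //=; apply: leq_trans (msize_translate _ _) IH.
pose A : 'M[F]_(N.+1, N) :=
  \matrix_(i, j) (it i)@_(enum_val j : 'X_{1..(m * m) < d}).
have [x x0 xA] : exists2 x : 'rV_(N.+1), x != 0 & x *m A = 0.
  have : kermx A != 0.
    by rewrite -mxrank_eq0 mxrank_ker -lt0n subn_gt0 ltnS rank_leq_col.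
  move=> /rowV0Pn[x /sub_kermxP xA x0]; by exists x.
case/eqP: x0; apply/rowP=> i; rewrite mxE.
rewrite -[i]inord_val; apply: (itI N.+1 (fun i => x 0 (inord i))) => //.
apply/mpolyP=> u; rewrite mcoeff0 raddf_sum /=.
under eq_bigr do rewrite mcoeffZ inord_val.
have [du|du] := leqP d (mdeg u).
  apply: big1 => j _; rewrite memN_msupp_eq0 ?mulr0 //; apply: msize_mdeg_ge.
  exact: leq_trans (itd j) du.
have /rowP/(_ (enum_rank (BMultinom du))) := xA; rewrite !mxE => uE.
by rewrite -[RHS]uE; apply: eq_bigr => j _; rewrite mxE enum_rankK.
Qed.

Let image_of x : exists y, forall p q, ev q k != 0 -> x = ev p k / ev q k ->
  y = ev p (k *m map_mx gam xi) / ev q (k *m map_mx gam xi).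
Proof.
have [p [q [q0 xE]]] := fractionP x.
exists (ev p (k *m map_mx gam xi) / ev q (k *m map_mx gam xi)) => p' q' q0' xE'.
have nz r : ev r k != 0 -> ev r (k *m map_mx gam xi) != 0.
  by apply: contraNneq => /ev_point_inj->.
apply/eqP; rewrite eqr_div ?nz // -subr_eq0 -!evM -evB; apply/eqP/rel.
apply/eqP; rewrite evB !evM subr_eq0 -eqr_div //; apply/eqP; by rewrite -xE -xE'.
Qed.

(** The matrices [k] and k xi satisfy the same polynomial relations over [F], so fractions in [k]
    may be evaluated at k xi. The derivation is respected because [xi] is constant, so that k xi
    solves the same system; the map is onto because [xi] is invertible. *)
Lemma gal_of_point : exists s : deltaGal iota, map_mx s k = k *m map_mx gam xi.
Proof.
set k' := k *m map_mx gam xi.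
have nz r : ev r k != 0 -> ev r k' != 0 by apply: contraNneq => /ev_point_inj->.
pose t x := sval (cid (image_of x)).
have tE p q : ev q k != 0 -> t (ev p k / ev q k) = ev p k' / ev q k'.
  by move=> q0; rewrite /t; case: cid => y /= yE; apply: yE.
have t1E p : t (ev p k) = ev p k'.
  by have := tE p 1%:MP; rewrite !evC rmorph1 !divr1; apply; apply: oner_neq0.
have tB : zmod_morphism t.
  move=> x y; have [p [q [q0 ->]]] := fractionP x;
    have [p' [q' [q0' ->]]] := fractionP y.
  have -> : ev p k / ev q k - ev p' k / ev q' k =
    ev (p * q' - p' * q) k / ev (q * q') k.
    by rewrite evB !evM; field; rewrite q0 q0'.
  rewrite !tE //; last by rewrite evM mulf_neq0.
  by rewrite evB !evM; field; rewrite !nz.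
have tM : monoid_morphism t.
  split=> [|x y]; first by have := t1E 1%:MP; rewrite !evC rmorph1.
  have [p [q [q0 ->]]] := fractionP x; have [p' [q' [q0' ->]]] := fractionP y.
  have -> : ev p k / ev q k * (ev p' k / ev q' k) = ev (p * p') k / ev (q * q') k.
    by rewrite !evM; field; rewrite q0 q0'.
  rewrite !tE //; last by rewrite evM mulf_neq0.
  by rewrite !evM; field; rewrite !nz.
pose tb := GRing.isZmodMorphism.Build K K t tB.
pose tm := GRing.isMonoidMorphism.Build K K t tM.
pose T : {rmorphism K -> K} := HB.pack t tb tm.
have Tfix c : T (iota c) = iota c.
  by rewrite -(evC iota k c) /= t1E !evC.
have Tk : map_mx T k = k'.
  by apply/matrixP=> i j; rewrite mxE /= -(evX iota k i j) t1E evX.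
have TD x : T (delta x) = delta (T x).
  pose S := [pred x : K | T (delta x) == delta (T x)].
  suff /eqP : x \in S by [].
  have SM y z : T (delta y) = delta (T y) -> T (delta z) = delta (T z) ->
      T (delta (y * z)) = delta (T (y * z)).
    by move=> yE zE; rewrite rmorphM !deltaM rmorphD !rmorphM yE zE.
  apply: gen_k => [|c|i j]; first split.
  - by rewrite inE rmorph1 !delta1 rmorph0.
  - move=> y z; rewrite !inE => /eqP yE /eqP zE.
    by rewrite rmorphB !deltaB rmorphB yE zE.
  - move=> y z; rewrite !inE => /eqP yE /eqP zE; apply/eqP; apply: SM => //.
    have [->|z0] := eqVneq z 0; first by rewrite invr0 !(rmorph0, delta0).
    have Tz0 : T z != 0 by rewrite fmorph_eq0.
    apply: (mulfI Tz0).
    have E : T (delta (z * z^-1)) = delta (T (z * z^-1)).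
      by rewrite mulfV // rmorph1 !delta1 rmorph0.
    move: E; rewrite rmorphM !deltaM rmorphD !rmorphM zE => /addrI; exact.
  - by rewrite inE -ext_delta !Tfix ext_delta.
  - rewrite inE; have /matrixP/(_ i j) := dk; rewrite !mxE => ->.
    have /matrixP E := Tk; have := E i j; rewrite mxE => ->.
    apply/eqP; rewrite rmorph_sum.
    have /matrixP/(_ i j) : map_mx delta k' = map_mx iota a *m k'.
      rewrite /k' map_mx_deltaM dk mulmxA -[RHS]addr0; congr (_ + _).
      rewrite (_ : map_mx delta _ = 0) ?mulmx0 //.
      by apply/matrixP=> u v; rewrite !mxE delta_const_ext.
    rewrite [LHS]mxE => ->; rewrite mxE; apply: eq_bigr => l _.
    by rewrite rmorphM mxE Tfix -E mxE.
have Tsurj y : exists x, T x = y.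
  pose S := [pred x : K | `[< exists z, T z = x >]].
  suff /asboolP : y \in S by [].
  have SM u v : u \in S -> v \in S -> u * v \in S.
    by move=> /asboolP[u' <-] /asboolP[v' <-]; apply/asboolP; exists (u' * v');
      rewrite rmorphM.
  have SI c : iota c \in S by apply/asboolP; exists (iota c); apply: Tfix.
  apply: gen_k => [|c|i j]; first split=> [|u v|u v uS].
  - by apply/asboolP; exists 1; rewrite rmorph1.
  - by move=> /asboolP[u' <-] /asboolP[v' <-]; apply/asboolP; exists (u' - v');
    rewrite rmorphB.
  - by move=> /asboolP[v' <-]; apply: SM => //; apply/asboolP; exists v'^-1;
    rewrite fmorphV.
  - exact: SI.
  - have -> : k = k' *m map_mx gam (invmx xi).
      by rewrite /k' -mulmxA -map_mxM mulmxV // map_mx1 mulmx1.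
    rewrite mxE; apply/asboolP.
    exists (\sum_l k i l * iota (val (invmx xi l j))); rewrite rmorph_sum.
    apply: eq_bigr => l _; rewrite rmorphM Tfix [map_mx gam _ _ _]mxE.
    by have /matrixP/(_ i l) := Tk; rewrite mxE => ->.
have Tbij : bijective T.
  pose u y := sval (cid (Tsurj y)).
  have uK y : T (u y) = y by rewrite /u; case: cid.
  by exists u => // x; apply: (fmorph_inj T); rewrite uK.
by exists (DeltaGal Tbij TD Tfix).
Qed.

End Point.

(** Used in two ways: for [I] zero, it finds an automorphism off the zeros of [f]; for [I] with a
    nonzero element of F[k], its conclusion is absurd, [s] being injective, and so a power of [f]
    times the determinant lies in the extended ideal. *)
Lemma gal_of_ext_ideal (I : K -> Prop) (f : {mpoly K[m * m]}) :
  I 0 -> (forall q x, I x -> I (ev q k * x)) -> (forall x, I x -> I (delta x)) ->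
  (forall r, ~ ext_ideal iota k I ((f * subst iota k (mdet F m)) ^+ r)) ->
  exists s : deltaGal iota, (forall q, I (ev q k) -> s (ev q k) = 0) /\
    f.@[mxvec (gal_mx k s) 0] != 0.
Proof.
move=> I0 IM Idelta /(point_of_ext_ideal constE closed kU dk IM Idelta).
move=> [xi [xiI fxi xiU]].
have [q q0|s sE] := gal_of_point xiU; first by apply: xiI; rewrite q0.
exists s; split=> [q Iq|]; first by rewrite ev_gal sE xiI.
by rewrite /gal_mx sE mulKmx.
Qed.

End Galois.

(** * The fixed field and denominators of fundamental matrices *)

(* The hypothesis says that 1 ⊗ x - x ⊗ 1 is nilpotent in K ⊗_E K. *)
Lemma nilpotent_descent (E K : fieldType) (g : {rmorphism E -> K}) (x : K) r :
  [pchar E] =i pred0 ->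
  (forall l, semilinear_form g l ->
    \sum_(i < r.+1) (g (l ((- x) ^+ i)) * x ^+ (r - i)) *+ 'C(r, i) = 0) ->
  exists c, x = g c.
Proof.
move=> char0 H.
pose G : {poly K} := ('X - x%:P) ^+ r.
pose lp (l : K -> E) (h : {poly K}) : {poly E} := map_poly l h.
have l0 l : semilinear_form g l -> l 0 = 0.
  by move=> [_ lZ]; have := lZ 0 0; rewrite rmorph0 !mul0r.
have lpE l h i : semilinear_form g l -> (lp l h)`_i = l h`_i.
  by move=> /l0 l00; rewrite coef_map_id0.
have lpD l h h' : semilinear_form g l -> lp l (h + h') = lp l h + lp l h'.
  move=> lin; apply/polyP=> i; rewrite coefD !lpE // coefD; by case: lin.
have lpM l h (p : {poly E}) : semilinear_form g l ->
  lp l (h * map_poly g p) = lp l h * p.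
  move=> lin; apply/polyP=> i;
    rewrite lpE // !coefM (semilinear_form_sum _ _ _ lin).
  apply: eq_bigr => j _; rewrite coef_map lpE // mulrC; have [_ ->] := lin.
  by rewrite mulrC.
(* After expansion of the power, the hypothesis says that every form sends [G] to a polynomial over
   [E] with root [x]. *)
have lpG l : semilinear_form g l -> (map_poly g (lp l G)).[x] = 0.
  move=> lin; rewrite -[RHS](H _ lin) /G exprDn.
  have -> : lp l (\sum_(i < r.+1) ('X^(r - i) * (- x%:P) ^+ i) *+ 'C(r, i)) =
     \sum_(i < r.+1) (l ((- x) ^+ i) *: 'X^(r - i)) *+ 'C(r, i).
    apply/polyP=> j; rewrite lpE // !coef_sum (semilinear_form_sum _ _ _ lin).
    apply: eq_bigr => i _; rewrite !coefMn coefZ -polyCN -polyC_exp coefMC !coefXn.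
    have lMn y t : l (y *+ t) = l y *+ t.
      elim: t => [|t IH]; first by rewrite !mulr0n; apply: l0.
      by rewrite !mulrS -IH; case: lin.
    by rewrite lMn; case: (_ == _); rewrite ?mul1r ?mulr1 // mul0r mulr0 l0.
  rewrite rmorph_sum horner_sum; apply: eq_bigr => i _.
  by rewrite rmorphMn hornerMn /= map_polyZ hornerZ map_polyXn hornerXn.
have [l lin l1] := semilinear_form_exists g.
pose annih s :=
  `[< exists mu : {poly E}, [/\ mu != 0, root (map_poly g mu) x & size mu = s] >].
have ex : exists s, annih s.
  exists (size (lp l G)); apply/asboolP; exists (lp l G); split=> //;
    last by apply/rootP/lpG.
  apply/eqP=> /polyP/(_ r); rewrite lpE // coef0 => /eqP.
  have -> : G`_r = 1.
    have /monicP := monic_exp r (monicXsubC x); rewrite lead_coefE.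
    by rewrite size_exp_XsubC.
  by rewrite l1 oner_eq0.
case: (ex_minnP ex) => s /asboolP[mu [mu0 mux smu]] smin.
have small (nu : {poly E}) : (size nu < s)%N -> root (map_poly g nu) x -> nu = 0.
  move=> nus nux; apply/eqP; apply: contraLR nus => nu0; rewrite -leqNgt.
  by apply: smin; apply/asboolP; exists nu.
(* The remainder of [G] is sent by every form to a polynomial over [E] that vanishes at [x] and is
   shorter than [mu], hence to 0 by minimality; as forms separate elements, the remainder is 0. *)
have mug : map_poly g mu %| G.
  rewrite /dvdp; set rho := G %% _;
    have rhoE : G = G %/ map_poly g mu * map_poly g mu + rho.
    exact: divp_eq.
  have rs : (size rho < s)%N.
    by rewrite -smu -(size_map_poly g) ltn_modp map_poly_eq0.
  apply/eqP/polyP=> i; rewrite coef0;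
    apply: (semilinear_form_sep (g := g)) => l' lin'.
  rewrite -lpE // (_ : lp l' rho = 0) ?coef0 //; apply: small.
    by apply: leq_ltn_trans rs; apply: size_poly.
  apply/rootP; have := lpG _ lin'; rewrite {1}rhoE lpD // lpM // rmorphD rmorphM.
  by rewrite hornerD hornerM (rootP mux) mulr0 add0r.
have /dvdp_exp_XsubCP[j jr /eqpP[[c1 c2] /= /andP[c10 c20] muE]] := mug.
have sj : s = j.+1.
  rewrite -smu -(size_map_poly g) -(size_scale _ c10) muE size_scale //.
  exact: size_exp_XsubC.
(* [mu] is a multiple of a power of ['X - x%:P]. An exponent above 1 would make the derivative of
   [mu] vanish at [x], hence be zero, which characteristic 0 forbids; with exponent 1, [x] is a
   quotient of coefficients. *)
have mux' := rootP mux; have [j0|j1|j2] := ltngtP j 1.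
- move: j0; rewrite ltnS leqn0 => /eqP j0; have := congr1 (horner^~ x) muE.
  rewrite !hornerZ mux' mulr0 j0 expr0 hornerC mulr1 => /esym/eqP.
  by rewrite (negPf c20).
- have mu'0 : mu^`() = 0.
    apply: small; first by rewrite -smu lt_size_deriv.
    have := congr1 (fun p => p^`().[x]) muE;
      rewrite /= !derivZ !hornerZ deriv_exp derivXsubC mul1r.
    rewrite hornerMn horner_exp hornerXsubC subrr -deriv_map.
    case: j j1 {jr muE sj} => [|[|j]] // _; rewrite expr0n /= mul0rn mulr0 => /eqP.
    by rewrite mulf_eq0 (negPf c10).
  have /eqP := coef_deriv mu j.-1; rewrite mu'0 coef0 prednK; last exact: ltnW.
  have lc : mu`_j != 0 by rewrite -[j]/(j.+1.-1) -sj -smu -lead_coefE lead_coef_eq0.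
  have /(pcharf0P E) char0' := char0.
  by rewrite eq_sym -mulr_natr mulf_eq0 (negPf lc) char0' -leqn0 leqNgt (ltnW j1).
- exists (- mu`_0 / mu`_1); have s2 : size mu = 2 by rewrite smu sj j2.
  have m1 : mu`_1 != 0 by have := mu0; rewrite -lead_coef_eq0 lead_coefE s2.
  move: mux';
    rewrite horner_coef (size_map_poly g) s2 !big_ord_recl big_ord0 !coef_map /=.
  rewrite expr0 expr1 mulr1 addr0 => /eqP; rewrite addrC addr_eq0 => /eqP E1.
  by rewrite fmorph_div rmorphN -E1 mulrAC mulfV ?mul1r // fmorph_eq0.
Qed.

Lemma map_mx_gal (F K : deltaFieldType) (iota : deltaExt F K) m (k : 'M[K]_m) s :
  k \in unitmx -> map_mx (s : deltaGal iota) k = k *m gal_mx k s.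
Proof. by move=> kU; rewrite /gal_mx mulKVmx. Qed.

Section FixedField.
Variables (F K : deltaFieldType) (iota : deltaExt F K) (m : nat).
Variables (a : 'M[F]_m) (k : 'M[K]_m).
Local Notation C := (constants F).
Local Notation gam := (const_ext iota).
Local Notation FX := {mpoly F[m * m]}.
Local Notation KY := {mpoly K[m * m]}.
Local Notation ev := (ev iota).
Local Notation subst := (subst iota k).
Local Notation mdet := (mdet F m).
Hypothesis char0 : [pchar F] =i pred0.
Hypothesis constE : same_constants iota.
Hypothesis closed : GRing.closed_field_axiom C.
Hypothesis kU : k \in unitmx.
Hypothesis dk : map_mx delta k = map_mx iota a *m k.
Hypothesis gen_k : field_generated iota k.

Lemma det_neq0 : \det k != 0.
Proof. by rewrite -unitfE -unitmxE. Qed.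

Lemma subst_gal s q :
  (subst q).@[mxvec (gal_mx k s) 0] = (s : deltaGal iota) (ev q k).
Proof. by rewrite subst_meval -map_mx_gal // ev_gal. Qed.

(** In K ⊗_F K, the polynomial [f] below stands for [A] ⊗ [A] times 1 ⊗ x - x ⊗ 1. It vanishes at
    every [gal_mx k s] because [s] fixes [x]; no automorphism avoids it, so a power of [f] times the
    determinant lies in the extension of the zero ideal. *)
Lemma fixed_field x : (forall s : deltaGal iota, s x = x) -> exists c, x = iota c.
Proof.
move=> xfix; have [p [q [A0 xE]]] := fractionP gen_k x.
set A := ev q k in A0 xE; set B := ev p k in xE.
pose f : KY := A *: subst p + (- B) *: subst q.
have I0M (q' : FX) (y : K) : 0 = y -> 0 = ev q' k * y by move=> <-; rewrite mulr0.
have I0D (y z : K) : 0 = y -> 0 = z -> 0 = y + z by move=> <- <-; rewrite addr0.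
have I0d (y : K) : 0 = y -> 0 = delta y by move=> <-; rewrite delta0.
have [r Jr] : exists r, ext_ideal iota k (eq 0) ((f * subst mdet) ^+ r).
  apply/not_existsP => nJ.
  have [s [_ /eqP[]]] :=
    gal_of_ext_ideal constE closed kU dk gen_k (erefl 0) I0M I0d nJ.
  rewrite mevalD !mevalZ !subst_gal -/A -/B.
  have := xfix s; rewrite xE fmorph_div => /eqP.
  rewrite eqr_div ?fmorph_eq0 // => /eqP E.
  by rewrite mulrC E mulNr addrN.
apply: (nilpotent_descent (g := iota) (r := r)) => // l lin.
(* Dividing by [A ^+ r] inside the form turns the coefficients of the binomial expansion into powers
   of [- x]. *)
have lin' := semilinear_form_mul (A ^- r) lin.
have := ext_ideal_pairing kU lin' (erefl 0) I0D I0M Jr.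
pose c (i : 'I_r.+1) := (A ^+ (r - i) * (- B) ^+ i) *+ 'C(r, i).
have -> : (f * subst mdet) ^+ r =
    \sum_(i < r.+1) c i *: subst (p ^+ (r - i) * q ^+ i * mdet ^+ r).
  rewrite exprMn /f exprDn mulr_suml; apply: eq_bigr => i _.
  rewrite !rmorphM !rmorphXn !exprZn -scalerAl -scalerAr scalerA.
  by rewrite scalerMnl -scalerAl.
rewrite (big_morph _ (pairingD k lin') (pairing0 k lin')).
move=> H; have {H} : 0 = A ^+ r * \det k ^+ r *
    \sum_(i < r.+1) (iota (l ((- x) ^+ i)) * x ^+ (r - i)) *+ 'C(r, i).
  rewrite [LHS]H.
  rewrite mulr_sumr; apply: eq_bigr => i _; rewrite pairingE //.
  have -> : A ^- r * c i = (- x) ^+ i *+ 'C(r, i).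
    rewrite /c mulrnAr; congr (_ *+ _); rewrite xE -mulNr expr_div_n.
    have ir : (i <= r)%N by rewrite -ltnS.
    rewrite -{1}(subnK ir) exprD; field; rewrite ?expf_neq0 //.
  have lMn y t : l (y *+ t) = l y *+ t.
    elim: t => [|t IH]; last by rewrite !mulrS -IH; case: lin.
    by have [_ lZ] := lin; have := lZ 0 0; rewrite rmorph0 !mul0r !mulr0n.
  rewrite lMn rmorphMn !evM /= mulrnAl mulrnAr; congr (_ *+ _).
  have evX' t j : ev (t ^+ j) k = ev t k ^+ j by apply: rmorphXn.
  rewrite !evX' ev_mdet -/A -/B xE expr_div_n.
  have ir : (i <= r)%N by rewrite -ltnS.
  have -> : A ^+ r = A ^+ (r - i) * A ^+ i by rewrite -exprD subnK.
  by field; rewrite ?expf_neq0.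
by move/esym/eqP;
  rewrite !mulf_eq0 !expf_eq0 (negPf A0) (negPf det_neq0) !andbF => /eqP.
Qed.

(** A power of the determinant is first found in the extended ideal; pairing with a form of value 1
    at 1 brings it back to [I]. *)
Lemma delta_simple (I : K -> Prop) q :
  I 0 -> (forall x y, I x -> I y -> I (x + y)) ->
  (forall q x, I x -> I (ev q k * x)) -> (forall x, I x -> I (delta x)) ->
  I (ev q k) -> ev q k != 0 -> exists r, I (\det k ^+ r).
Proof.
move=> I0 ID IM Idelta Iq q0.
have [r Jr] : exists r, ext_ideal iota k I ((1 * subst mdet) ^+ r).
  apply/not_existsP => nJ.
  have [s [sI _]] := gal_of_ext_ideal constE closed kU dk gen_k I0 IM Idelta nJ.
  by move/eqP: q0; apply; apply: (fmorph_inj s); rewrite sI // rmorph0.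
have [l lin l1] := semilinear_form_exists iota.
exists r; have := ext_ideal_pairing kU lin I0 ID IM Jr.
rewrite mul1r -rmorphXn -[X in pairing _ _ X]scale1r pairingE // l1 rmorph1 mul1r.
by rewrite [ev _ _]rmorphXn /= -[mmap _ _ _]/(ev _ _) ev_mdet.
Qed.

(* The denominators of a fundamental matrix form a delta-ideal. *)
Lemma fundamental_mx_regular M N (u : 'M[K]_(M, N)) (b : 'M[F]_N) :
  map_mx delta u = u *m map_mx iota b ->
  exists r, forall i j, exists p, \det k ^+ r * u i j = ev p k.
Proof.
move=> du;
  pose I x := (exists p, x = ev p k) /\ forall i j, exists p, x * u i j = ev p k.
have [q [q0 Iq]] : exists q, ev q k != 0 /\ I (ev q k).
  suff [q [q0 Hq]] : exists q, ev q k != 0 /\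
      forall ij, ij \in enum {: 'I_M * 'I_N} ->
        exists p, ev q k * u ij.1 ij.2 = ev p k.
    exists q; split=> //; split; first by exists q.
    by move=> i j; apply: (Hq (i, j)); rewrite mem_enum.
  elim: (enum _) => [|ij s [q [q0 Hq]]].
    by exists 1%:MP; rewrite evC rmorph1 oner_eq0.
  have [p' [q' [q0' uE]]] := fractionP gen_k (u ij.1 ij.2).
  exists (q * q'); rewrite evM mulf_neq0 //; split=> // ij'.
  rewrite inE => /predU1P[->|/Hq[p E]].
    by exists (q * p'); rewrite uE evM mulrA mulrAC mulfK // mulrC mulrA mulfVK // .
  by exists (q' * p); rewrite evM -E mulrAC mulrC mulrA.
suff [r [_ Hr]] : exists r, I (\det k ^+ r) by exists r.
apply: (delta_simple _ _ _ _ Iq q0).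
- split; first by exists 0%:MP; rewrite evC rmorph0.
  by move=> i j; exists 0%:MP; rewrite evC rmorph0 mul0r.
- move=> x y [[p ->] Hx] [[p' ->] Hy]; split; first by exists (p + p'); rewrite evD.
  move=> i j; have [s E] := Hx i j; have [s' E'] := Hy i j.
  by exists (s + s'); rewrite mulrDl E E' evD.
- move=> p x [[p' ->] Hx]; split; first by exists (p * p'); rewrite evM.
  by move=> i j; have [s E] := Hx i j; exists (p * s); rewrite -mulrA E evM.
(* By the product rule, [delta x * u] is [delta (x * u)] minus [x * u * b], and both have entries in
   F[k]. *)
- move=> x [[p xE] Hx]; have [p' [_ pE]] := delta_subst dk p.
  split; first by exists p'; rewrite xE pE.
  move=> i j; have [s E] := Hx i j; have [s' [_ sE]] := delta_subst dk s.
  pose t l := sval (cid (Hx i l));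
    have tE l : x * u i l = ev (t l) k by rewrite /t; case: cid.
  exists (s' - \sum_l b l j *: t l).
  rewrite evB ev_sum -sE -E deltaM.
  have /matrixP/(_ i j) := du; rewrite !mxE => ->.
  rewrite mulr_sumr -addrA -[LHS]addr0; congr (_ + _); apply/esym/eqP.
  rewrite subr_eq0; apply/eqP; apply: eq_bigr => l _.
  by rewrite evZ -tE mxE; ring.
Qed.

End FixedField.

(** * Regular functions on the Galois group and Galois descent *)

Section Regular.
Variables (F K : deltaFieldType) (iota : deltaExt F K) (m : nat).
Variables (a : 'M[F]_m) (k : 'M[K]_m).
Local Notation C := (constants F).
Local Notation gam := (const_ext iota).
Local Notation G := (deltaGal iota).
Local Notation ev := (ev iota).
Hypothesis constE : same_constants iota.
Hypothesis kU : k \in unitmx.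
Hypothesis dk : map_mx delta k = map_mx iota a *m k.

(** Both [k] and its image under [s] solve the system of [a], so their quotient has derivative 0. *)
Lemma gal_mx_const (s : G) : exists2 z : 'M[C]_m,
  gal_mx k s = map_mx gam z & z \in unitmx.
Proof.
have [z zE] : exists z, gal_mx k s = map_mx gam z.
  apply: const_ext_mxP => //; apply: (can_inj (mulKmx kU)).
  have E := map_mx_gal s kU;
    have /matrixP dE : map_mx delta (map_mx s k) = map_mx iota a *m map_mx s k.
    have -> : map_mx delta (map_mx s k) = map_mx s (map_mx delta k).
      by apply/matrixP=> i j; rewrite !mxE gal_delta.
    rewrite dk map_mxM; congr (_ *m _); apply/matrixP=> i j; rewrite !mxE;
      exact: gal_fix.
  move/matrixP: dE; rewrite E map_mx_deltaM dk mulmxA -[RHS]addr0 => /addrI ->.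
  by rewrite mulmx0.
exists z => //; have : map_mx gam z \in unitmx.
  by rewrite -zE unitmx_mul unitmx_inv kU map_unitmx.
by rewrite map_unitmx.
Qed.

(** Up to a power of the determinant, [s (y t)] is a polynomial in the entries of [gal_mx k s] with
    coefficients in [K]. A form from [K] to [C] with value 1 at 1 brings the coefficients down to
    [C] and does not change the values, which are constant already. *)
Lemma regular_of_sum N (b y : 'I_N -> K) r (f : G -> C) :
  (forall t, exists p, \det k ^+ r * y t = ev p k) ->
  (forall s, gam (f s) = \sum_t b t * s (y t)) -> gal_regular k f.
Proof.
move=> yE fE; pose p t := sval (cid (yE t)).
have pE t : \det k ^+ r * y t = ev (p t) k by rewrite /p; case: cid.
have [l lin l1] := semilinear_form_exists gam.
pose lA := GRing.isZmodMorphism.Build K C l (semilinear_additive lin).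
pose L : {additive K -> C} := HB.pack l lA.
pose H := \sum_t (\det k ^- r * b t) *: subst iota k (p t).
have d0 := det_neq0 kU.
exists (map_mpoly L H), r => s.
have [z zE zU] := gal_mx_const s.
have z0 : \det z != 0 by rewrite -unitfE -unitmxE.
have fH : gam (f s) = H.@[mxvec (gal_mx k s) 0] / gam (\det z ^+ r).
  rewrite fE raddf_sum mulr_suml; apply: eq_bigr => t _ /=.
  rewrite mevalZ subst_gal // -pE rmorphM rmorphXn.
  have -> : s (\det k) = \det k * gam (\det z).
    by rewrite -det_map_mx map_mx_gal // det_mulmx zE det_map_mx.
  rewrite rmorphXn exprMn; field; rewrite !expf_neq0 //= fmorph_eq0 //.
have LD h h' :
  map_mpoly L (h + h') = map_mpoly L h + map_mpoly L h' :> {mpoly C[m * m]}.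
  exact: raddfD.
have ezE (h : {mpoly K[m * m]}) :
  l h.@[mxvec (gal_mx k s) 0] = (map_mpoly L h).@[mxvec z 0].
  elim/mpolyind: h => [|c u h _ _ IH].
    by rewrite (raddf0 (map_mpoly L)) /meval !mmap0; have [_ lZ] := lin;
      have := lZ 0 0; rewrite rmorph0 !mul0r.
  rewrite mevalD LD mevalD; have [-> lZ] := lin; rewrite IH; congr (_ + _).
  have -> : map_mpoly L (c *: 'X_[u]) = l c *: 'X_[u].
    apply/mpolyP=> w; rewrite mcoeff_map_mpoly !mcoeffZ !mcoeffX.
    case: (u == w); rewrite ?mulr1 // !mulr0.
    by have := lZ 0 0; rewrite rmorph0 !mul0r.
  rewrite !mevalZ mulrC.
  have -> : 'X_[u].@[mxvec (gal_mx k s) 0] = gam 'X_[u].@[mxvec z 0].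
    rewrite zE !mevalX rmorph_prod; apply: eq_bigr => i _.
    by rewrite rmorphXn -map_mxvec mxE.
  by rewrite lZ mulrC.
have lgam c : l (gam c) = c by have [_ lZ] := lin;
  rewrite -[gam c]mulr1 lZ l1 mulr1.
have -> : f s = (map_mpoly L H).@[mxvec z 0] / \det z ^+ r.
  rewrite -ezE -[LHS]lgam fH mulrC -fmorphV; have [_ ->] := lin; exact: mulrC.
rewrite [LHS]rmorphM [X in _ * X]fmorphV zE det_map_mx -rmorphXn; congr (_ / _).
rewrite /meval [LHS]rmorph_mmap.
apply: (@mpoly_morph_eq _ _ _ (mmap _ _) (mmap _ _)) => [c|i] /=.
  by rewrite !mmapC.
by rewrite !mmapX !mmap1U -map_mxvec mxE.
Qed.

(** Values in any [K]-space are allowed, so that a matrix of regular functions is a single such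
    function, with matrices as coefficients. *)
Definition finite_fun (V : lmodType K) (f : G -> V) : Prop :=
  exists N (b : 'I_N -> V) (y : 'I_N -> K), forall s, f s = \sum_i s (y i) *: b i.

Lemma finite_fun_scale (V : lmodType K) c (v : V) : finite_fun (fun s => s c *: v).
Proof. by exists 1%N, (fun=> v), (fun=> c) => s; rewrite big_ord1. Qed.

Lemma finite_fun_cst (V : lmodType K) (v : V) : finite_fun (fun=> v).
Proof.
have := finite_fun_scale 1 v.
by congr finite_fun; apply/funext=> s; rewrite rmorph1 scale1r.
Qed.

Lemma finite_funD (V : lmodType K) (f g : G -> V) :
  finite_fun f -> finite_fun g -> finite_fun (fun s => f s + g s).
Proof.
move=> [N [b [y fE]]] [N' [b' [y' gE]]];
  pose cat T (u : 'I_N -> T) v (i : 'I_(N + N')) :=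
  match split i with inl j => u j | inr j => v j end.
exists (N + N')%N, (cat _ b b'), (cat _ y y') => s; rewrite fE gE big_split_ord /=.
congr (_ + _); apply: eq_bigr => i _; rewrite /cat.
  by have := unsplitK (inl i : 'I_N + 'I_N'); rewrite /unsplit => ->.
by have := unsplitK (inr i : 'I_N + 'I_N'); rewrite /unsplit => ->.
Qed.

Lemma finite_fun_sum (V : lmodType K) I (r : seq I) (f : I -> G -> V) :
  (forall i, finite_fun (f i)) -> finite_fun (fun s => \sum_(i <- r) f i s).
Proof.
move=> H; elim: r => [|i r IH].
  by have := finite_fun_cst (0 : V); congr finite_fun; apply/funext=> s;
    rewrite big_nil.
have := finite_funD (H i) IH.
by congr finite_fun; apply/funext=> s; rewrite big_cons.
Qed.

Lemma finite_funM (V : lmodType K) (f : G -> K^o) (g : G -> V) :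
  finite_fun f -> finite_fun g -> finite_fun (fun s => f s *: g s).
Proof.
move=> [N [b [y fE]]] [N' [b' [y' gE]]].
have : finite_fun (fun s => \sum_i \sum_j s (y i * y' j) *: (b i *: b' j)).
  by do 2!apply: finite_fun_sum => ?; apply: finite_fun_scale.
congr finite_fun; apply/funext=> s; rewrite fE gE scaler_suml;
  apply: eq_bigr => i _.
rewrite scaler_sumr; apply: eq_bigr => j _; rewrite !scalerA rmorphM;
  congr (_ *: _).
by rewrite -[s (y i) *: b i]/(s (y i) * b i) mulrAC.
Qed.

Lemma finite_fun_prod I (r : seq I) (f : I -> G -> K^o) :
  (forall i, finite_fun (f i)) -> finite_fun (fun s => \prod_(i <- r) f i s : K^o).
Proof.
move=> H; elim: r => [|i r IH].
  by have := finite_fun_cst (1 : K^o); congr finite_fun; apply/funext=> s;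
    rewrite big_nil.
have := finite_funM (H i) IH.
by congr finite_fun; apply/funext=> s; rewrite big_cons.
Qed.

Lemma finite_funX (f : G -> K^o) d : finite_fun f ->
  finite_fun (fun s => f s ^+ d : K^o).
Proof.
move=> H; have := finite_fun_prod (index_enum 'I_d) (fun=> H).
by congr finite_fun; apply/funext=> s; rewrite prodr_const card_ord.
Qed.

Lemma regular_finite f : gal_regular k f -> finite_fun (fun s => gam (f s) : K^o).
Proof.
move=> [p [d fE]].
have zF i j : finite_fun (fun s => gal_mx k s i j : K^o).
  have : finite_fun (fun s => \sum_l s (k l j) *: (invmx k i l : K^o)).
    by apply: finite_fun_sum => l; apply: finite_fun_scale.
  congr finite_fun; apply/funext=> s; rewrite mxE; apply: eq_bigr => l _.
  by rewrite mxE mulrC.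
(* This is the inverse of the determinant of [gal_mx k s], so denominators stay within the class. *)
have dF : finite_fun (fun s => s (\det k)^-1 * \det k : K^o) by
  apply: finite_fun_scale.
have : finite_fun (fun s => (s (\det k)^-1 * \det k) ^+ d * \sum_(u <- msupp p)
    (gam p@_u * \prod_i mxvec (gal_mx k s) 0 i ^+ u i) : K^o).
  apply: (finite_funM (V := K^o)); first exact: finite_funX.
  apply: finite_fun_sum => u; apply: (finite_funM (V := K^o));
    first exact: finite_fun_cst.
  apply: finite_fun_prod => i; apply: finite_funX; case/mxvec_indexP: i => i j.
  by have := zF i j; congr finite_fun; apply/funext=> s; rewrite mxvecE.
congr finite_fun; apply/funext=> s; rewrite fE /mmap /mmap1 mulrC; congr (_ * _).
have d0 := det_neq0 kU; rewrite -exprVn; congr (_ ^+ _).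
by rewrite /gal_mx det_mulmx det_inv det_map_mx fmorphV invfM invrK mulrC.
Qed.

Hypothesis fixK : forall x, (forall s : G, s x = x) -> exists c, x = iota c.

(* Dedekind's argument: a shortest relation, normalized at one coefficient, is
   fixed by the Galois group. *)
Lemma artin_indep S (b x : 'I_S -> K) : indep iota b ->
  (forall s : G, \sum_i x i * s (b i) = 0) -> forall i, x i = 0.
Proof.
elim: S b x => [|S IH] b x bI xE; first by case.
have bI' : indep iota (fun i => b (lift ord0 i)).
  move=> y yE i; have := bI (fun i => oapp y 0 (unlift ord0 i)).
  rewrite big_ord_recl unlift_none rmorph0 mul0r add0r => H.
  have := H _ (lift ord0 i); rewrite liftK; apply; rewrite -[RHS]yE.
  by apply: eq_bigr => j _; rewrite liftK.
have x0 : x ord0 = 0.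
  apply/eqP; apply: contraT => x0; pose y i := x i / x ord0.
  have yE (s : G) : \sum_i y i * s (b i) = 0.
    rewrite -[RHS](mul0r (x ord0)^-1) -[X in _ = X * _](xE s) mulr_suml;
      apply: eq_bigr => i _.
    by rewrite mulrAC.
  have y0 : y ord0 = 1 by rewrite /y mulfV.
  have yfix i (t : G) : t (y i) = y i.
    case: (unliftP ord0 i) => [j|] ->; last by rewrite y0 rmorph1.
    apply/eqP; rewrite -subr_eq0; apply/eqP; move: j.
    apply: (IH _ (fun j => t (y (lift ord0 j)) - y (lift ord0 j)) bI') => s.
    have := congr1 t (yE (t^-1 * s)%g); rewrite rmorph0 rmorph_sum => tE.
    have {tE} : \sum_i (t (y i) - y i) * s (b i) = 0.
      rewrite -[RHS]subr0 -[X in _ = X - _]tE -[X in _ = _ - X](yE s) -sumrB;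
        apply: eq_bigr => j _.
      rewrite mulrBl rmorphM; congr (_ * _ - _).
      by rewrite -[t (_ (b j))]/((t * (t^-1 * s))%g (b j)) mulgA mulgV mul1g.
    by rewrite big_ord_recl y0 rmorph1 subrr mul0r add0r.
  pose c i := sval (cid (fixK (yfix i))).
  have cE i : y i = iota (c i) by rewrite /c; case: cid.
  have c0 : c ord0 = 0.
    apply: bI; rewrite -[RHS](yE 1%g); apply: eq_bigr => i _.
    by rewrite cE.
  by move: y0; rewrite cE c0 rmorph0 => /esym/eqP; rewrite oner_eq0.
move=> i; case: (unliftP ord0 i) => [j|] -> //.
apply: (IH _ (fun j => x (lift ord0 j)) bI') => s.
by have := xE s; rewrite big_ord_recl x0 mul0r add0r.
Qed.

(* Writing L s as a sum of s (d t) *: b t with the d t independent over F, each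
   b t is invariant; their rows span everything since L 1 = 1. *)
Lemma regular_cocycle_trivial N (L : G -> 'M[C]_N) :
  L 1%g = 1%:M -> (forall s t, L (s * t)%g = L t *m L s) ->
  (forall i j, gal_regular k (fun s => L s i j)) ->
  exists2 u : 'M[K]_N, u \in unitmx & forall s : G, map_mx s u *m map_mx gam
    (L s) = u.
Proof.
move=> L1 LM Lreg.
have [S [b [y LE]]] : finite_fun (fun s => map_mx gam (L s)).
  have : finite_fun
    (fun s => \sum_i \sum_j (gam (L s i j) : K^o) *: (delta_mx i j : 'M[K]_N)).
    do 2!apply: finite_fun_sum => ?; apply: finite_funM; last exact: finite_fun_cst.
    exact: regular_finite (Lreg _ _).
  congr finite_fun; apply/funext=> s; rewrite [RHS]matrix_sum_delta.
  by do 2!apply: eq_bigr => ? _; rewrite mxE.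
have [S' [d [e [dI yE]]]] := indep_span iota y.
pose b' u := \sum_t iota (e t u) *: b t.
have {}LE s : map_mx gam (L s) = \sum_u s (d u) *: b' u.
  rewrite LE; under [RHS]eq_bigr do rewrite scaler_sumr.
  rewrite exchange_big; apply: eq_bigr => t _; rewrite yE rmorph_sum scaler_suml.
  by apply: eq_bigr => u _; rewrite scalerA rmorphM gal_fix mulrC.
have bfix (t : G) u : map_mx t (b' u) *m map_mx gam (L t) = b' u.
  apply/eqP; rewrite -subr_eq0; apply/eqP/matrixP=> i j; rewrite [RHS]mxE.
  move: u; apply: (artin_indep dI) => s.
  (* Applying [t] to the expansion of [L (t^-1 * s)], whose entries are constant, and multiplying by
     [L t] gives a second expansion of [L s]; independence of the [d u] compares the
     coefficients. *)
  have E : \sum_u s (d u) *: map_mx t (b' u) = map_mx gam (L (t^-1 * s)%g).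
    have <- : map_mx t (map_mx gam (L (t^-1 * s)%g)) = map_mx gam (L (t^-1 * s)%g).
      by apply/matrixP=> ? ?; rewrite !mxE gal_const.
    rewrite LE raddf_sum; apply: eq_bigr => u _ /=.
    rewrite map_mxZ; congr (_ *: _).
    by rewrite -[RHS]/((t * (t^-1 * s))%g (d u)) mulgA mulgV mul1g.
  have /matrixP/(_ i j) : (\sum_u s (d u) *: map_mx t (b' u)) *m map_mx gam (L t) =
      \sum_u s (d u) *: b' u.
    by rewrite E -LE -map_mxM -LM mulgA mulgV mul1g.
  rewrite mulmx_suml !summxE => /eqP; rewrite -subr_eq0 -sumrB => /eqP E'.
  rewrite -[RHS]E'; apply: eq_bigr => u _.
  by rewrite -scalemxAl !mxE -mulrBr mulrC.
(* [A] stacks the rows of all the [b' t]. They span the rows of [L 1], the identity, so [A] has full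
   rank and [N] of its rows make up [u]. *)
pose A := \matrix_(j, l) mxvec (\matrix_(t, i) b' t i l) 0 j : 'M[K]_(S' * N, N).
have rowA t i : row (mxvec_index t i) A = row i (b' t).
  by apply/rowP=> l; rewrite !mxE mxvecE mxE.
have fA : row_full A.
  rewrite -sub1mx -[1%:M](map_mx1 gam) -L1 LE summx_sub // => t _.
  apply: scalemx_sub; apply/row_subP=> i; rewrite -rowA; exact: row_sub.
have Afix (t : G) : map_mx t A *m map_mx gam (L t) = A.
  apply/row_matrixP=> j; case/mxvec_indexP: j => u i.
  by rewrite row_mul -map_row rowA map_row -row_mul (bfix t u).
exists (rowsub (fullrankfun fA) A).
  exact: fullrowsub_unit.
by move=> t; rewrite map_mxsub mul_rowsub_mx Afix.
Qed.

End Regular.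

(** * The projective representation of a split algebra *)

Lemma deltaIso_inv (F : deltaFieldType) (A B : deltaAlgType F) (f : deltaIso A B) :
  exists2 g : deltaIso B A, cancel f g & cancel g f.
Proof.
have [g fK gK] := iso_bij f.
have gl : linear g := can2_linear fK gK.
have gm : monoid_morphism g := can2_monoid_morphism fK gK.
pose gL := GRing.isLinear.Build F B A *:%R g gl.
pose gM := GRing.isMonoidMorphism.Build B A g gm.
pose G : {lrmorphism B -> A} := HB.pack g gL gM.
have Gb : bijective G by exists f.
have Gd x : G (delta x) = delta (G x).
  by apply: (can_inj fK); rewrite iso_delta !gK.
by exists (DeltaIso Gb Gd).
Qed.

(** * Galois action and functoriality of A ⊗ K *)

Section TensorMap.
Variables (F K : deltaFieldType) (iota : deltaExt F K).
Local Notation G := (deltaGal iota).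

Section Basic.
Variable A : falgType F.
Implicit Types (x y : tensor iota A) (s : G).

Lemma gal_tensorD s x y : gal_tensor s (x + y) = gal_tensor s x + gal_tensor s y.
Proof. exact: map_mxD. Qed.

Lemma gal_tensorZ s c x : gal_tensor s (c *: x) = s c *: gal_tensor s x.
Proof. exact: map_mxZ. Qed.

Lemma gal_tensorM s x y : gal_tensor s (x * y) = gal_tensor s x * gal_tensor s y.
Proof.
elim/tensor_ind: x => [x1 x2|a l].
  by rewrite mulrDl !gal_tensorD mulrDl => -> ->.
elim/tensor_ind: y => [y1 y2|b t].
  by rewrite mulrDr !gal_tensorD mulrDr => -> ->.
by rewrite pureM !gal_tensor_pure pureM rmorphM.
Qed.

Lemma gal_tensor_comp s t x :
  gal_tensor (s * t)%g x = gal_tensor s (gal_tensor t x).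
Proof. by apply/rowP=> i; rewrite !mxE. Qed.

Lemma gal_tensor1 x : gal_tensor (1%g : G) x = x.
Proof. by apply/rowP=> i; rewrite !mxE. Qed.

Lemma gal_tensor_inj s : injective (@gal_tensor _ _ _ A s).
Proof.
by apply: (@can_inj _ _ _ (gal_tensor (s^-1)%g)) => x;
   rewrite -gal_tensor_comp mulVg gal_tensor1.
Qed.

Lemma pure0r (a : A) : pure iota a 0 = 0.
Proof. by rewrite pureE scale0r. Qed.

Lemma pure1_inj : injective (fun a : A => pure iota a 1).
Proof.
move=> a b /rowP E; rewrite (coord_vbasis (memvf a)) (coord_vbasis (memvf b)).
apply: eq_bigr => i _; have := E i; rewrite !mxE !mul1r => /fmorph_inj->.
by [].
Qed.

Lemma gal_tensor_fixed x :
  (forall y : K, (forall s, s y = y) -> exists c, y = iota c) ->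
  (forall s, gal_tensor s x = x) -> exists a, x = pure iota a 1.
Proof.
move=> fixK xE; have H i : exists c, x 0 i = iota c.
  by apply: fixK => s; have /rowP/(_ i) := xE s; rewrite mxE.
exists (\sum_i sval (cid (H i)) *: (vbasis {:A})`_i).
apply/rowP=> j; rewrite mxE mul1r.
rewrite coord_sum_free ?(basis_free (vbasisP _)) //.
by case: cid.
Qed.

End Basic.

Lemma gal_tensor_delta (A : deltaAlgType F) (s : G) (x : tensor iota A) :
  gal_tensor s (delta x) = delta (gal_tensor s x).
Proof.
elim/tensor_ind: x => [x y|a l].
  by rewrite gal_tensorD !deltaD gal_tensorD => -> ->.
by rewrite delta_pure gal_tensorD !gal_tensor_pure delta_pure gal_delta.
Qed.

Lemma delta_pure1 (A : deltaAlgType F) (a : A) :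
  delta (pure iota a 1) = pure iota (delta a) 1.
Proof. by rewrite delta_pure delta1 pure0r addr0. Qed.

Definition structure_mx (A : deltaAlgType F) : 'M[F]_(\dim {:A}) :=
  \matrix_(i, j) coord (vbasis {:A}) j (delta (vbasis {:A})`_i).

(** In coordinates, the elements of A ⊗ K with derivative 0 are the solutions of a linear system
    over [F], to which the results on fundamental matrices apply. *)
Lemma delta_tensorE (A : deltaAlgType F) (x : tensor iota A) :
  delta x = map_mx delta x + x *m map_mx iota (structure_mx A) :> 'rV__.
Proof.
apply/rowP=> j; rewrite [delta x]/(tdelta x) /tdelta summxE.
under eq_bigr do rewrite mxE.
rewrite big_split /= addrC [RHS]mxE; congr (_ + _).
  have /rowP/(_ j) := tensor_expand (map_mx delta x : tensor iota A).
  rewrite summxE => ->; apply: eq_bigr => i _; congr (pure _ _ _ _ _).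
  by rewrite mxE.
by rewrite mxE; apply: eq_bigr => i _; rewrite !mxE.
Qed.

Section Map.
Variables (A B : deltaAlgType F) (f : deltaIso A B).

Definition tensor_map (x : tensor iota A) : tensor iota B :=
  \sum_(i < \dim {:A}) pure iota (f (vbasis {:A})`_i) (x 0 i).

Lemma tensor_mapD x y : tensor_map (x + y) = tensor_map x + tensor_map y.
Proof.
by rewrite -big_split; apply: eq_bigr => i _; rewrite mxE pureDr.
Qed.

Lemma tensor_map_pure a l : tensor_map (pure iota a l) = pure iota (f a) l.
Proof.
rewrite {2}(coord_vbasis (memvf a)) linear_sum.
have pure_sum I (r : seq I) (H : I -> B) :
    pure iota (\sum_(i <- r) H i) l = \sum_(i <- r) pure iota (H i) l.
  apply: (big_morph (fun a => pure iota a l)) => [b c|]; first exact: pureDl.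
  by rewrite -(scale0r 0) pureZl rmorph0 mul0r pure0r.
rewrite pure_sum; apply: eq_bigr => i _; rewrite linearZ pureZl mxE.
by rewrite mulrC.
Qed.

Lemma tensor_mapM x y : tensor_map (x * y) = tensor_map x * tensor_map y.
Proof.
elim/tensor_ind: x => [x1 x2|a l].
  by rewrite mulrDl !tensor_mapD mulrDl => -> ->.
elim/tensor_ind: y => [y1 y2|b t].
  by rewrite mulrDr !tensor_mapD mulrDr => -> ->.
by rewrite pureM !tensor_map_pure pureM rmorphM.
Qed.

Lemma tensor_mapZ c x : tensor_map (c *: x) = c *: tensor_map x.
Proof.
elim/tensor_ind: x => [x1 x2|a l].
  by rewrite scalerDr !tensor_mapD scalerDr => -> ->.
by rewrite pureZ !tensor_map_pure pureZ.
Qed.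

Lemma tensor_map_delta x : tensor_map (delta x) = delta (tensor_map x).
Proof.
elim/tensor_ind: x => [x1 x2|a l].
  by rewrite deltaD !tensor_mapD deltaD => -> ->.
by rewrite delta_pure tensor_mapD !tensor_map_pure delta_pure iso_delta.
Qed.

Lemma tensor_map_gal (s : G) x :
  tensor_map (gal_tensor s x) = gal_tensor s (tensor_map x).
Proof.
elim/tensor_ind: x => [x1 x2|a l].
  by rewrite gal_tensorD !tensor_mapD gal_tensorD => -> ->.
by rewrite gal_tensor_pure !tensor_map_pure gal_tensor_pure.
Qed.

End Map.

Lemma tensor_map_inj (A B : deltaAlgType F) (f : deltaIso A B) :
  injective (tensor_map f).
Proof.
have [g fK gK] := deltaIso_inv f; apply: (@can_inj _ _ _ (tensor_map g)).
elim/tensor_ind=> [x y|a l]; first by rewrite !tensor_mapD => -> ->.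
by rewrite !tensor_map_pure fK.
Qed.

End TensorMap.

Section PGLConj.
Variables (n : nat) (C : fieldType).
Implicit Types (x y : PGL n C) (X : 'M[C]_n.+1).

Lemma PGL_conjM x y X : PGL_conj (x * y)%g X = PGL_conj x (PGL_conj y X).
Proof.
rewrite -[x]PGL_reprK -[y]PGL_reprK.
rewrite -[(_ * _)%g]/(PGL_mul _ _) PGL_classM !PGL_conjE /=.
by rewrite invrM ?(valP (PGL_repr _)) // !mulrA.
Qed.

Lemma PGL_conj1 X : PGL_conj 1%g X = X.
Proof. by rewrite -[1%g]/(PGL_one _ _) /PGL_one PGL_conjE /= mul1r invr1 mulr1. Qed.

End PGLConj.

Section Solutions.
Variables (F K : deltaFieldType) (iota : deltaExt F K) (n : nat).
Local Notation C := (constants F).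
Local Notation gam := (const_ext iota).
Local Notation M := 'M[K]_n.+1.
Hypothesis constE : same_constants iota.

Lemma map_const_inj : injective (map_mx gam : 'M[C]_n.+1 -> M).
Proof. exact: map_mx_inj. Qed.

(** [T] preserves the kernels of the derivations, which [psi] and [psi'] identify with the constant
    matrices. Linearity is asked over the constants alone so that 1 ⊗ s, which is not [K]-linear,
    qualifies along with [tensor_map f]. *)
Lemma solutions_map_inner (A B : deltaAlgType F) (psi : deltaIso M (tensor iota A))
    (psi' : deltaIso M (tensor iota B)) (T : tensor iota A -> tensor iota B) :
  (forall x y, T (x + y) = T x + T y) ->
  (forall c x, T (gam c *: x) = gam c *: T x) ->
  (forall x y, T (x * y) = T x * T y) -> injective T ->
  (forall x, T (delta x) = delta (T x)) ->
  exists h : PGL n C, forall X : 'M[C]_n.+1,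
    T (psi (map_mx gam X)) = psi' (map_mx gam (PGL_conj h X)).
Proof.
move=> TD TZ TM TI Td.
have T0 : T 0 = 0 by have := TZ 0 0; rewrite !scaler0 rmorph0 scale0r.
have H X : exists Y : 'M[C]_n.+1, T (psi (map_mx gam X)) = psi' (map_mx gam Y).
  apply/(solutionsP psi' _ constE); rewrite inE -Td.
  have /(solutionsP psi _ constE) :
    exists Y : 'M[C]_n.+1, psi (map_mx gam X) = psi (map_mx gam Y) by exists X.
  by rewrite inE => /eqP->; rewrite T0.
pose theta X := sval (cid (H X)).
have thetaE X : T (psi (map_mx gam X)) = psi' (map_mx gam (theta X)).
  by rewrite /theta; case: cid.
have psi'I : injective psi' := bij_inj (iso_bij psi').
have psiI : injective psi := bij_inj (iso_bij psi).
have thetaU X Y : T (psi (map_mx gam X)) = psi' (map_mx gam Y) -> theta X = Y.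
  by rewrite thetaE => /psi'I/map_const_inj.
have [||||h hU hE] := matrix_aut_inner (theta := theta).
- move=> X Y; apply: thetaU; rewrite map_mxD rmorphD TD !thetaE.
  by rewrite -rmorphD -map_mxD.
- move=> c X; apply: thetaU; rewrite map_mxZ linearZ /= TZ thetaE map_mxZ.
  by rewrite linearZ.
- move=> X Y; apply: thetaU.
  rewrite -[X * Y]/(X *m Y) map_mxM -[_ *m _]/(_ * _ : M) rmorphM TM !thetaE.
  by rewrite -rmorphM -[theta X * _]/(theta X *m _) map_mxM.
- move=> X Y E; apply/map_const_inj/psiI/TI; by rewrite !thetaE E.
exists (PGL_class (Sub h hU : GL n C)) => X.
by rewrite thetaE hE PGL_conjE.
Qed.

Section Phi.
Variables (A : deltaAlgType F) (psi : deltaIso M (tensor iota A)).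

Lemma phi_exists : exists r : deltaGal iota -> PGL n C, phi_spec psi r.
Proof.
have H (s : deltaGal iota) : exists h : PGL n C, forall X : 'M[C]_n.+1,
    gal_tensor s (psi (map_mx gam X)) = psi (map_mx gam (PGL_conj h X)).
  apply: solutions_map_inner.
  - exact: gal_tensorD.
  - by move=> c x; rewrite gal_tensorZ gal_const.
  - exact: gal_tensorM.
  - exact: gal_tensor_inj.
  - exact: gal_tensor_delta.
by exists (fun s => sval (cid (H s))) => s; case: cid.
Qed.

Lemma phi_mul r : phi_spec psi r -> {morph r : s t / (s * t)%g}.
Proof.
move=> rE s t; apply: PGL_conj_inj => X; apply/map_const_inj.
apply: (bij_inj (iso_bij psi)).
apply: etrans (esym (rE (s * t)%g X)) _.
by rewrite PGL_conjM gal_tensor_comp (rE t X); apply: rE.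
Qed.

End Phi.

(** f ⊗ 1 commutes with the Galois action, so the conjugation it induces on constant matrices
    intertwines the two representations. With the identity for [f], this is independence of the
    splitting isomorphism. *)
Lemma phi_equiv (A B : deltaAlgType F) (psi : deltaIso M (tensor iota A))
    (psi' : deltaIso M (tensor iota B)) r r' (f : deltaIso A B) :
  phi_spec psi r -> phi_spec psi' r' ->
  exists x : PGL n C, forall s, r' s = (x * r s * x^-1)%g.
Proof.
move=> rE rE';
  have [|c x||||h hE] := solutions_map_inner psi psi' (T := tensor_map f).
- exact: tensor_mapD.
- by rewrite tensor_mapZ.
- exact: tensor_mapM.
- exact: tensor_map_inj.
- exact: tensor_map_delta.
exists h => s; suff E : (r' s * h = h * r s)%g by rewrite -E mulgK.
apply: PGL_conj_inj => X; apply/map_const_inj; apply: (bij_inj (iso_bij psi')).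
transitivity (gal_tensor s (tensor_map f (psi (map_mx gam X)))).
  by rewrite (hE X) (rE' s); congr (psi' (map_mx _ _)); apply: PGL_conjM.
rewrite -tensor_map_gal (rE s X) (hE (PGL_conj (r s) X)).
by congr (psi' (map_mx _ _)); apply/esym/PGL_conjM.
Qed.

End Solutions.

(** * Regular functions on PGL pulled back to the Galois group *)

Lemma det_generic_mx (R S : comNzRingType) m (f : {rmorphism R -> S})
  (X : 'M[S]_m) :
  mmap f (mxvec X 0) (\det (generic_mx m R)) = \det X.
Proof.
rewrite -[LHS](det_map_mx (mmap f (mxvec X 0))); congr (\det _).
by apply/matrixP=> i j; rewrite !mxE /= mmapX mmap1U mxvecE.
Qed.

Lemma mnm_mdegS n (u : 'X_{1..n}) d : mdeg u = d.+1 ->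
  exists i v, mdeg v = d /\ u = (v + U_(i))%MM.
Proof.
move=> ud; have [i ui] : exists i, (0 < u i)%N.
  apply/not_existsP => H; have /eqP := ud.
  suff -> : u = 0%MM by rewrite mdeg0.
  by apply/mnmP=> i; rewrite mnm0E; case: (posnP (u i)) => // /H.
have iu : (U_(i) <= u)%MM.
  by apply/mnm_lepP=> j; rewrite mnm1E; case: eqP => // <-.
exists i, (u - U_(i))%MM; rewrite submK //; split=> //.
by apply/eqP; rewrite -eqSS -ud -{2}(submK iu) mdegD mdeg1 addn1.
Qed.

Section Regularity.
Variables (F K : deltaFieldType) (iota : deltaExt F K) (m : nat) (k : 'M[K]_m).
Local Notation C := (constants F).
Local Notation gam := (const_ext iota).
Local Notation reg := (@gal_regular F K iota m k).
Hypothesis kU : k \in unitmx.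

Lemma det_gal_mx_neq0 s : \det (@gal_mx F K iota m k s) != 0.
Proof.
by rewrite -unitfE -unitmxE unitmx_mul unitmx_inv kU map_unitmx.
Qed.

Lemma gal_regular_cst c : reg (fun=> c).
Proof. by exists c%:MP, 0%N => s; rewrite mmapC expr0 divr1. Qed.

Lemma gal_regularD f g : reg f -> reg g -> reg (fun s => f s + g s).
Proof.
move=> [p [d fE]] [q [e gE]]; pose D := \det (generic_mx m C).
exists (p * D ^+ e + q * D ^+ d), (d + e)%N => s.
transitivity (gam (f s) + gam (g s)); first exact: rmorphD.
rewrite fE gE mmapD !rmorphM !rmorphXn /= !det_generic_mx.
by rewrite exprD; field; rewrite !expf_neq0 ?det_gal_mx_neq0.
Qed.

Lemma gal_regularM f g : reg f -> reg g -> reg (fun s => f s * g s).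
Proof.
move=> [p [d fE]] [q [e gE]]; exists (p * q), (d + e)%N => s.
transitivity (gam (f s) * gam (g s)); first exact: rmorphM.
rewrite fE gE rmorphM /=.
by rewrite exprD; field; rewrite !expf_neq0 ?det_gal_mx_neq0.
Qed.

Lemma gal_regular_sum I (r : seq I) (f : I -> deltaGal iota -> C) :
  {in predT, forall i, reg (f i)} -> reg (fun s => \sum_(i <- r) f i s).
Proof.
move=> H; elim: r => [|i r IH].
  by have := gal_regular_cst 0; congr gal_regular; apply/funext=> s;
    rewrite big_nil.
have := gal_regularD (H i isT) IH.
by congr gal_regular; apply/funext=> s; rewrite big_cons.
Qed.

Variable n : nat.
Variable g : deltaGal iota -> 'M[C]_n.+1.
Hypothesis gU : forall s, g s \in unitmx.
Hypothesis gconj : forall i j i' j', reg (fun s => g s i j * invmx (g s) i' j').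

(* The entries of g alone need not be regular: as a lift of a class in PGL, g
   is only defined up to a scalar depending on s. *)
Let dual d (f : deltaGal iota -> C) :=
  forall u : 'X_{1..(n.+1 * n.+1)}, mdeg u = d ->
    reg (fun s => mmap1 (mxvec (g s) 0) u * f s).

Let dual1 : dual 0 (fun=> 1).
Proof.
move=> u /eqP; rewrite mdeg_eq0 => /eqP->; have := gal_regular_cst 1.
by congr gal_regular; apply/funext=> s; rewrite mmap11 mulr1.
Qed.

Let dualM d f i j : dual d f -> dual d.+1 (fun s => invmx (g s) i j * f s).
Proof.
move=> fd u /mnm_mdegS[l [v [vd ->]]]; case/mxvec_indexP: l => i' j'.
have := gal_regularM (fd v vd) (gconj i' j' i j); congr gal_regular;
  apply/funext=> s.
rewrite commr_mmap1_M => [|? ?]; last exact: mulrC.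
by rewrite mmap1U mxvecE; ring.
Qed.

Let dualZ d f c : dual d f -> dual d (fun s => c * f s).
Proof.
move=> fd u ud; have := gal_regularM (gal_regular_cst c) (fd u ud).
by congr gal_regular; apply/funext=> s; rewrite mulrCA.
Qed.

Let dual_sum d I (r : seq I) (f : I -> deltaGal iota -> C) :
  (forall i, dual d (f i)) -> dual d (fun s => \sum_(i <- r) f i s).
Proof.
move=> fd u ud; have := @gal_regular_sum _ r _ (fun i _ => fd i u ud).
by congr gal_regular; apply/funext=> s; rewrite mulr_sumr.
Qed.

(* 1 / det g is a polynomial of degree n.+1 in the entries of g^-1. *)
Let dual_det d f : dual d f -> dual (n.+1 + d) (fun s => \det (invmx (g s)) * f s).
Proof.
move=> fd; have : dual (n.+1 + d) (fun s => \sum_(p : 'S_n.+1)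
    (-1) ^+ p * (\prod_i invmx (g s) i (p i) * f s)).
  apply: dual_sum => p; apply: dualZ;
    rewrite -[X in dual (X + d)](card_ord n.+1) cardE.
  rewrite /enum_mem -enumT.
  have -> : (fun s => \prod_i invmx (g s) i (p i) * f s) =
     (fun s => \prod_(i <- enum 'I_n.+1) invmx (g s) i (p i) * f s).
    by apply/funext=> s; rewrite big_enum.
  elim: (enum _) => [|i r IH] /=.
    by rewrite add0n; move: fd; congr dual; apply/funext=> s; rewrite big_nil mul1r.
  have := dualM i (p i) IH.
  by congr dual; apply/funext=> s; rewrite big_cons mulrA.
congr dual; apply/funext=> s; rewrite /determinant mulr_suml.
by apply: eq_bigr => p _; rewrite mulrA.
Qed.

(** Each of the [n.+1 * d] factors of a monomial in [g s] is paired with one entry of the inverse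
    matrix coming from the power of the inverse determinant. *)
Lemma gal_regular_homog p d : p \is (n.+1 * d).-homog ->
  reg (fun s => p.@[mxvec (g s) 0] / \det (g s) ^+ d).
Proof.
move=> hp; have dd : dual (n.+1 * d) (fun s => \det (invmx (g s)) ^+ d).
  elim: d {hp} => [|d IH]; first by rewrite muln0; apply: dual1.
  have := dual_det IH; rewrite mulnS; congr dual; apply/funext=> s.
  by rewrite exprS.
have : reg (fun s => \sum_(u <- msupp p | mdeg u == (n.+1 * d)%N)
    p@_u * (mmap1 (mxvec (g s) 0) u * \det (invmx (g s)) ^+ d)).
  under [X in reg X]funext do rewrite -big_filter.
  have : {in [seq u <- msupp p | mdeg u == (n.+1 * d)%N], forall u, mdeg u =
    (n.+1 * d)%N}.
    by move=> u; rewrite mem_filter => /andP[/eqP].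
  elim: [seq _ <- _ | _] => [|u r IH] ur.
    by have := gal_regular_cst 0; congr gal_regular; apply/funext=> s;
      rewrite big_nil.
  have ud := ur u (mem_head _ _).
  have := gal_regularD (gal_regularM (gal_regular_cst p@_u) (dd u ud)) (IH _).
  rewrite (_ : (fun s => _ + _) =
    (fun s => \sum_(j <- u :: r) p@_j *
      (mmap1 (mxvec (g s) 0) j * \det (invmx (g s)) ^+ d))).
    by apply=> v vr; apply: ur; rewrite inE vr orbT.
  by apply/funext=> s; rewrite big_cons.
congr gal_regular; apply/funext=> s; rewrite det_inv exprVn /meval /mmap mulr_suml.
have /dhomogP hd := hp; rewrite big_seq_cond [RHS]big_seq; apply: eq_big => [u|u _].
  by apply/andP/idP => [[]|up] //; rewrite up (hd u up) eqxx.
by rewrite mulrA.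
Qed.

End Regularity.

Section PGLCoefficients.
Variables (n : nat) (C : fieldType).

Lemma conj_delta_mx (g h : 'M[C]_n.+1) i j i' l :
  (g * delta_mx j i' * h) i l = g i j * h i' l.
Proof.
rewrite -[g * _ * h]/(g *m _ *m h) -(mul_delta_mx (0 : 'I_1)) mulmxA -mulmxA mxE.
by rewrite big_ord1 -colE -rowE !mxE.
Qed.

Lemma dhomog_det N m (X : 'M[{mpoly C[m]}]_N) :
  (forall i j, X i j \is 1.-homog) -> \det X \is N.-homog.
Proof.
move=> X1; apply: rpred_sum => s _; rewrite rpredMsign.
have := @dhomog_prod m C mdeg N [tuple of nseq N 1%N] [tuple X i (s i) | i < N].
have -> : (\sum_(i <- [tuple of nseq N 1]) i = N)%N.
  rewrite big_tuple; under eq_bigr do rewrite tnth_nseq.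
  by rewrite sum1_card card_ord.
rewrite big_tuple (eq_bigr (fun i => X i (s i))) => [|i _];
  last by rewrite tnth_mktuple.
by apply=> i; rewrite tnth_mktuple tnth_nseq.
Qed.

Lemma dhomog_generic_mx m i j : generic_mx m C i j \is 1.-homog.
Proof. by rewrite mxE dhomogX /= mdeg1. Qed.

Lemma PGL_conj_regular j i' i l :
  PGL_regular (fun x : PGL n C => PGL_conj x (delta_mx j i') i l).
Proof.
(* By Cramer's rule an entry of the inverse is a cofactor of degree [n] over the determinant; with
   the entry [i j] the degree is [n.+1], whence exponent 1. *)
exists (generic_mx n.+1 C i j * cofactor (generic_mx n.+1 C) l i'), 1%N; split.
  rewrite muln1 -[X in X.-homog]add1n; apply: dhomogM;
    first exact: dhomog_generic_mx.
  rewrite rpredMsign; apply: dhomog_det => ? ?; rewrite 2!mxE;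
    exact: dhomog_generic_mx.
move=> g; rewrite PGL_conjE conj_delta_mx expr1 mevalM -mulrA.
have ev i1 i2 : (generic_mx n.+1 C i1 i2).@[mxvec (val g) 0] = val g i1 i2.
  by rewrite mxE mevalXU mxvecE.
rewrite ev; congr (_ * _); rewrite /cofactor rmorphM rmorph_sign /=.
have -> : (\det (row' l (col' i' (generic_mx n.+1 C)))).@[mxvec (val g) 0] =
    \det (row' l (col' i' (val g))).
  rewrite -[LHS](det_map_mx (meval _)); congr (\det _); apply/matrixP=> ? ?.
  by rewrite !mxE /= mevalXU mxvecE.
rewrite -[_^-1]/(invmx (val g)) /invmx (valP g) !mxE.
by rewrite mulrC.
Qed.

End PGLCoefficients.

Section PhiRegular.
Variables (F K : deltaFieldType) (iota : deltaExt F K) (m : nat).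
Variables (a : 'M[F]_m) (k : 'M[K]_m) (n : nat).
Local Notation C := (constants F).
Local Notation gam := (const_ext iota).
Local Notation M := 'M[K]_n.+1.
Hypothesis constE : same_constants iota.
Hypothesis closed : GRing.closed_field_axiom C.
Hypothesis kU : k \in unitmx.
Hypothesis dk : map_mx delta k = map_mx iota a *m k.
Hypothesis gen_k : field_generated iota k.
Variables (A : deltaAlgType F) (psi : deltaIso M (tensor iota A)).
Variable r : deltaGal iota -> PGL n C.
Hypothesis rE : phi_spec psi r.

(** The images of the matrix units under [psi] have derivative 0, so the matrix [u] of their
    coordinates solves a linear system over [F], and a power of [\det k] is a common denominator.
    The coefficients of conjugation by [r s] are sums of terms [b t * s (y t)] with [y t] among the
    entries of [u]. *)
Lemma phi_regular f : PGL_regular f -> gal_regular k (f \o r).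
Proof.
pose u : 'M[K]_(n.+1 * n.+1, \dim {:A}) := \matrix_i psi (vec_mx (delta_mx 0 i)).
have uE i j : row (mxvec_index i j) u = psi (delta_mx i j).
  by rewrite rowK -mxvec_delta mxvecK.
have du : map_mx delta u = u *m map_mx iota (- structure_mx A).
  apply/row_matrixP=> t; case/mxvec_indexP: t => i j; rewrite row_mul -map_row uE.
  have : delta (psi (delta_mx i j)) = 0.
    rewrite -iso_delta (_ : delta _ = 0) ?rmorph0 //; apply/matrixP=> ? ?.
    by rewrite [delta _]/(map_mx delta _) !mxE; case: (_ && _);
      rewrite ?delta1 ?delta0.
  rewrite delta_tensorE map_mxN mulmxN => /eqP; rewrite addr_eq0 => /eqP; exact.
have [e ue] := fundamental_mx_regular constE closed kU dk gen_k du.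
have [psi' psiK psi'K] := deltaIso_inv psi.
have conj_reg i j i' l :
  gal_regular k (fun s => PGL_conj (r s) (delta_mx j i') i l).
  apply: (regular_of_sum constE kU dk
    (b := fun t => psi' (delta_mx 0 t : 'rV_(\dim {:A})) i l)
    (y := fun t => u (mxvec_index j i') t) (r := e)) => [t|s]; first exact: ue.
  have E := rE s (delta_mx j i'); rewrite map_delta_mx in E.
  have {E} E :
    map_mx gam (PGL_conj (r s) (delta_mx j i')) =
      psi' (gal_tensor s (psi (delta_mx j i'))).
    by rewrite E psiK.
  have := congr1 (fun X : M => X i l) E; rewrite mxE => ->.
  rewrite [gal_tensor s _]row_sum_delta linear_sum summxE; apply: eq_bigr => t _.
  by rewrite linearZ mxE mulrC -uE !mxE.
move=> [p [d [hp fE]]].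
pose g s := val (PGL_repr (r s)).
have gU s : g s \in unitmx by apply: (valP (PGL_repr (r s))).
have gconj i j i' l : gal_regular k (fun s => g s i j * invmx (g s) i' l).
  have := conj_reg i j i' l; congr gal_regular; apply/funext=> s.
  by rewrite -(PGL_reprK (r s)) PGL_conjE conj_delta_mx.
have := gal_regular_homog kU gconj hp; congr gal_regular; apply/funext=> s.
by rewrite /= -(PGL_reprK (r s)) fE.
Qed.

End PhiRegular.

(** * The algebra of a projective representation *)

Section Twist.
Variables (F K : deltaFieldType) (iota : deltaExt F K) (n : nat).
Local Notation C := (constants F).
Local Notation gam := (const_ext iota).
Local Notation M := 'M[K]_n.+1.
Implicit Types (x : PGL n C) (X Y : M).

Definition ext_conj x X : M :=
  map_mx gam (val (PGL_repr x)) * X * map_mx gam (val (PGL_repr x))^-1.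

Let hU x : map_mx gam (val (PGL_repr x)) \is a GRing.unit.
Proof.
have : map_mx gam (val (PGL_repr x)) \in unitmx by rewrite map_unitmx;
  apply: (valP (PGL_repr x)).
by [].
Qed.

Let hV x : map_mx gam (val (PGL_repr x))^-1 = (map_mx gam (val (PGL_repr x)))^-1.
Proof. by rewrite -[_^-1 in LHS]/(invmx _) map_invmx. Qed.

Lemma ext_conj_map x (X : 'M[C]_n.+1) :
  ext_conj x (map_mx gam X) = map_mx gam (PGL_conj x X).
Proof. by rewrite /ext_conj -!mulmxE -!map_mxM. Qed.

Lemma ext_conjD x X Y : ext_conj x (X + Y) = ext_conj x X + ext_conj x Y.
Proof. by rewrite /ext_conj mulrDr mulrDl. Qed.

Lemma ext_conjZ x c X : ext_conj x (c *: X) = c *: ext_conj x X.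
Proof. by rewrite /ext_conj -scalerAr -scalerAl. Qed.

Lemma ext_conjM x X Y : ext_conj x (X * Y) = ext_conj x X * ext_conj x Y.
Proof.
rewrite /ext_conj hV !mulrA; congr (_ * _ * _).
by rewrite mulrVK.
Qed.

Lemma ext_conj1 x : ext_conj x 1 = 1.
Proof. by rewrite /ext_conj hV mulr1 mulrV. Qed.

Lemma ext_conj_delta x X : ext_conj x (delta X) = delta (ext_conj x X).
Proof.
have d0 (Z : 'M[C]_n.+1) : delta (map_mx gam Z) = 0 :> M.
  by apply/matrixP=> i j; rewrite [delta _]/(map_mx delta _) !mxE delta_const_ext.
by rewrite /ext_conj !deltaM !d0 mul0r mulr0 add0r addr0.
Qed.

Lemma ext_conj_inj x : injective (ext_conj x).
Proof.
move=> X Y; rewrite /ext_conj hV => /(mulIr _) E; apply: (mulrI (hU x)).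
by apply: E; rewrite unitrV.
Qed.

Lemma ext_conj_surj x Y : exists X, Y = ext_conj x X.
Proof.
exists ((map_mx gam (val (PGL_repr x)))^-1 * Y * map_mx gam (val (PGL_repr x))).
by rewrite /ext_conj hV !mulrA mulrV // mul1r mulrK.
Qed.

End Twist.

(** * Descent of isomorphisms *)

Section Descent.
Variables (F K : deltaFieldType) (iota : deltaExt F K) (n : nat).
Local Notation C := (constants F).
Local Notation gam := (const_ext iota).
Local Notation M := 'M[K]_n.+1.
Hypothesis fixK : forall x, (forall s : deltaGal iota, s x = x) ->
  exists c, x = iota c.
Variables A B : deltaAlgType F.

(** [T] and its inverse preserve the fixed elements of the Galois action, which are [A] and [B]. *)
Lemma isomorphic_descent (T : deltaIso (tensor iota A) (tensor iota B)) :
  (forall (s : deltaGal iota) x, T (gal_tensor s x) = gal_tensor s (T x)) ->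
  isomorphic A B.
Proof.
move=> Tgal; have [U TK UK] := deltaIso_inv T.
have gal1 (D : deltaAlgType F) (s : deltaGal iota) (d : D) :
    gal_tensor s (pure iota d 1) = pure iota d 1.
  by rewrite gal_tensor_pure rmorph1.
have H a : exists b, T (pure iota a 1) = pure iota b 1.
  by apply: gal_tensor_fixed => // s; rewrite -Tgal gal1.
have H' b : exists a, U (pure iota b 1) = pure iota a 1.
  apply: gal_tensor_fixed => // s; apply: (bij_inj (iso_bij T)).
  by rewrite Tgal UK gal1.
pose f a := sval (cid (H a)); pose g b := sval (cid (H' b)).
have fE a : pure iota (f a) 1 = T (pure iota a 1) by rewrite /f; case: cid.
have gE b : pure iota (g b) 1 = U (pure iota b 1) by rewrite /g; case: cid.
have pZ (D : deltaAlgType F) c (d : D) :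
  pure iota (c *: d) 1 = iota c *: pure iota d 1.
  by rewrite pureZl pureZ.
have fl : linear f.
  move=> c x y; apply: (@pure1_inj _ _ iota).
  by rewrite fE !pureDl !pZ !fE linearD linearZ.
have fm : monoid_morphism f.
  split=> [|x y]; apply: (@pure1_inj _ _ iota); rewrite fE.
    exact: (rmorph1 T).
  have pM (D : deltaAlgType F) (d d' : D) :
    pure iota (d * d') 1 = pure iota d 1 * pure iota d' 1.
    by rewrite pureM mulr1.
  by rewrite !pM !fE rmorphM.
pose fL := GRing.isLinear.Build F A B *:%R f fl.
pose fM := GRing.isMonoidMorphism.Build A B f fm.
pose Phi : {lrmorphism A -> B} := HB.pack f fL fM.
have Phib : bijective Phi.
  by exists g => x; apply: (@pure1_inj _ _ iota); rewrite ?gE ?fE ?gE ?TK ?UK.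
have Phid x : Phi (delta x) = delta (Phi x).
  by apply: (@pure1_inj _ _ iota); rewrite fE -!delta_pure1 iso_delta fE.
by constructor; exact: DeltaIso Phib Phid.
Qed.

Lemma isomorphic_of_phi_equiv (psi : deltaIso M (tensor iota A))
    (psi' : deltaIso M (tensor iota B)) r r' x :
  phi_spec psi r -> phi_spec psi' r' ->
  (forall s, r' s = (x * r s * x^-1)%g) -> isomorphic A B.
Proof.
move=> rE rE' rr'; have [chi psiK chiK] := deltaIso_inv psi.
have [chi' psiK' chiK'] := deltaIso_inv psi'.
pose t y := psi' (ext_conj iota x (chi y)).
have tl : linear t.
  move=> c y z; rewrite /t linearD linearZ /= ext_conjD ext_conjZ linearD.
  by rewrite linearZ.
have tm : monoid_morphism t.
  split=> [|y z]; rewrite /t; first by rewrite (rmorph1 chi) ext_conj1 rmorph1.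
  by rewrite (rmorphM chi) ext_conjM rmorphM.
pose tL := GRing.isLinear.Build K (tensor iota A) (tensor iota B) *:%R t tl.
pose tM := GRing.isMonoidMorphism.Build (tensor iota A) (tensor iota B) t tm.
pose T : {lrmorphism tensor iota A -> tensor iota B} := HB.pack t tL tM.
pose v y := psi (sval (cid (ext_conj_surj iota x (chi' y)))).
have vK : cancel v T.
  by move=> y; rewrite /= /t /v psiK; case: cid => X /= <-; rewrite chiK'.
have TI : injective T.
  move=> y z /(bij_inj (iso_bij psi'))/ext_conj_inj; exact: (bij_inj (iso_bij chi)).
have Tb : bijective T by exists v => // y; apply: TI; rewrite vK.
have Td y : T (delta y) = delta (T y).
  by rewrite /= /t iso_delta ext_conj_delta iso_delta.
apply: (isomorphic_descent (T := DeltaIso Tb Td)) => s y /=; rewrite /t.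
have -> : y = psi (chi y) by rewrite chiK.
move: (chi y) => Y {y}; rewrite psiK.
rewrite [Y]matrix_sum_delta.
(* Both sides are additive and semilinear along [s] in [Y], and constant matrices span, so it is
   enough to treat these; there the identity is the equivalence of [r] and [r']. *)
pose P (Y : M) := psi' (ext_conj iota x (chi (gal_tensor s (psi Y)))) =
  gal_tensor s (psi' (ext_conj iota x Y)).
have PD Y1 Y2 : P Y1 -> P Y2 -> P (Y1 + Y2).
  move=> E1 E2; rewrite /P (linearD psi) gal_tensorD (linearD chi) !ext_conjD.
  by rewrite !(linearD psi') gal_tensorD; congr (_ + _).
have PZ c Y1 : P Y1 -> P (c *: Y1).
  move=> E1; rewrite /P (linearZ_LR psi) gal_tensorZ (linearZ_LR chi) !ext_conjZ.
  by rewrite !(linearZ_LR psi') gal_tensorZ; congr (_ *: _).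
have PC (X : 'M[C]_n.+1) : P (map_mx gam X).
  rewrite /P (rE s X) psiK !ext_conj_map (rE' s (PGL_conj x X)) rr'.
  congr (psi' (map_mx _ _)).
  have xx : PGL_conj x^-1%g (PGL_conj x X) = X.
    by rewrite -PGL_conjM mulVg PGL_conj1.
  by rewrite (PGL_conjM (x * r s)%g) xx PGL_conjM.
have P0 : P 0 by rewrite -(map_mx0 gam); apply: PC.
have PS I (r0 : seq I) (G : I -> M) : (forall i, P (G i)) -> P (\sum_(i <- r0) G i).
  by move=> PG; apply: (big_ind P).
by do 2!apply: (PS) => ?; apply: PZ; rewrite -(map_delta_mx gam).
Qed.

End Descent.

(** A delta-[F]-subalgebra of K-matrices, given by coordinates over [F]. Closure is stated by
    existence, which is all that fixed points of a group action provide; the record serves as the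
    parameter on which the algebra structures of [form_alg] are declared. *)
Record matrix_form (F K : deltaFieldType) (iota : deltaExt F K) (n : nat) :=
  MatrixForm {
  form_dim : nat;
  form_map : 'rV[F]_form_dim -> 'M[K]_n.+1;
  form_inj : injective form_map;
  form_mapD : forall x y, form_map (x + y) = form_map x + form_map y;
  form_mapZ : forall c x, form_map (c *: x) = iota c *: form_map x;
  form_one : exists x, form_map x = 1;
  form_mul : forall x y, exists z, form_map z = form_map x * form_map y;
  form_delta : forall x, exists y, form_map y = delta (form_map x)
}.

Section FormAlgebra.
Variables (F K : deltaFieldType) (iota : deltaExt F K) (n : nat).
Variable d : matrix_form iota n.

Definition form_alg : Type := 'rV[F]_(form_dim d).

HB.instance Definition _ := Vector.copy form_alg 'rV[F]_(form_dim d).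

Definition form_val (x : form_alg) : 'M[K]_n.+1 := form_map x.

Lemma form_val_inj : injective form_val. Proof. exact: form_inj. Qed.
Lemma form_valD x y : form_val (x + y) = form_val x + form_val y.
Proof. exact: form_mapD. Qed.
Lemma form_valZ c x : form_val (c *: x) = iota c *: form_val x.
Proof. exact: form_mapZ. Qed.

Definition fmul (x y : form_alg) : form_alg := sval (cid (form_mul x y)).
Definition fone : form_alg := sval (cid (form_one d)).

Let fmulE x y : form_val (fmul x y) = form_val x * form_val y.
Proof. by rewrite /fmul; case: cid. Qed.
Let foneE : form_val fone = 1. Proof. by rewrite /fone; case: cid. Qed.

Fact fmulA : associative fmul.
Proof. by move=> x y z; apply: form_val_inj; rewrite !fmulE mulrA. Qed.
Fact fmul1x : left_id fone fmul.
Proof. by move=> x; apply: form_val_inj; rewrite fmulE foneE mul1r. Qed.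
Fact fmulx1 : right_id fone fmul.
Proof. by move=> x; apply: form_val_inj; rewrite fmulE foneE mulr1. Qed.
Fact fmulDl : left_distributive fmul +%R.
Proof. by move=> x y z; apply: form_val_inj;
  rewrite !(fmulE, form_valD) mulrDl. Qed.
Fact fmulDr : right_distributive fmul +%R.
Proof. by move=> x y z; apply: form_val_inj;
  rewrite !(fmulE, form_valD) mulrDr. Qed.
Fact fone_neq0 : fone != 0.
Proof.
apply/eqP=> /(congr1 form_val);
  rewrite foneE -(scale0r 0) form_valZ rmorph0 scale0r.
by apply/eqP; apply: oner_neq0.
Qed.

HB.instance Definition _ := GRing.Zmodule_isNzRing.Build form_alg
  fmulA fmul1x fmulx1 fmulDl fmulDr fone_neq0.

Lemma form_valM (x y : form_alg) : form_val (x * y) = form_val x * form_val y.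
Proof. exact: fmulE. Qed.
Lemma form_val1 : form_val 1 = 1. Proof. exact: foneE. Qed.

Fact form_scalerAl c (x y : form_alg) : c *: (x * y) = (c *: x) * y.
Proof. by apply: form_val_inj; rewrite !(form_valM, form_valZ) scalerAl. Qed.

HB.instance Definition _ := GRing.Lmodule_isLalgebra.Build F form_alg form_scalerAl.

Fact form_scalerAr c (x y : form_alg) : c *: (x * y) = x * (c *: y).
Proof. by apply: form_val_inj; rewrite !(form_valM, form_valZ) scalerAr. Qed.

HB.instance Definition _ := GRing.Lalgebra_isAlgebra.Build F form_alg form_scalerAr.

HB.instance Definition _ := Algebra_isFalgebra.Build F form_alg.

Definition fdelta (x : form_alg) : form_alg := sval (cid (form_delta x)).

Let fdeltaE x : form_val (fdelta x) = delta (form_val x).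
Proof. by rewrite /fdelta; case: cid. Qed.

Fact fdeltaD : {morph fdelta : x y / x + y}.
Proof. by move=> x y; apply: form_val_inj;
  rewrite !(fdeltaE, form_valD) deltaD. Qed.
Fact fdeltaM x y : fdelta (x * y) = fdelta x * y + x * fdelta y.
Proof. by apply: form_val_inj; rewrite !(fdeltaE, form_valD, form_valM) deltaM. Qed.

HB.instance Definition _ := isDelta.Build form_alg fdeltaD fdeltaM.

Lemma form_val_delta (x : form_alg) : form_val (delta x) = delta (form_val x).
Proof. exact: fdeltaE. Qed.

Fact fdelta_alg (c : F) : delta (c%:A : form_alg) = (delta c)%:A.
Proof.
apply: form_val_inj; rewrite form_val_delta !form_valZ form_val1 ext_delta.
exact: (delta_alg (iota c)).
Qed.

HB.instance Definition _ := isDeltaAlgebra.Build F form_alg fdelta_alg.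

Lemma form_val_sum I (r : seq I) (P : pred I) (G : I -> form_alg) :
  form_val (\sum_(i <- r | P i) G i) = \sum_(i <- r | P i) form_val (G i).
Proof.
apply: (big_morph _ form_valD); apply: (addIr (form_val 0)).
by rewrite -form_valD !add0r.
Qed.

Lemma dim_form_alg : \dim {:form_alg} = form_dim d.
Proof. by rewrite dimvf /dim /= mul1n. Qed.

End FormAlgebra.

Lemma mxvec_mul_eq (R : comNzRingType) m1 n1 p (A B : 'M[R]_(m1 * n1, p)) :
  (forall i j, mxvec (delta_mx i j) *m A = mxvec (delta_mx i j) *m B) -> A = B.
Proof.
move=> E; apply/row_matrixP=> i; case/mxvec_indexP: i => i j.
by rewrite !rowE -mxvec_delta.
Qed.

Lemma central_mx_scalar (R : nzRingType) n (Z : 'M[R]_n.+1) :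
  (forall i j, Z * delta_mx i j = delta_mx i j * Z) -> Z = (Z 0 0)%:M.
Proof.
move=> ZC; apply/matrixP=> i j; have /matrixP/(_ i 0) := ZC j 0.
rewrite -mulmxE !mxE (bigD1 j) //= big1 => [|l lj]; last first.
  by rewrite mxE (negPf lj) mulr0.
rewrite addr0 mxE !eqxx mulr1 => ->; rewrite (bigD1 0) //= big1 => [|l l0];
  last first.
  by rewrite mxE (negPf l0) andbF mul0r.
by rewrite addr0 mxE eqxx andbT mulr_natl.
Qed.

Lemma delta_mx_sandwich (R : fieldType) n (Z : 'M[R]_n.+1) i p q j :
  delta_mx i p * Z * delta_mx q j = Z p q *: delta_mx i j.
Proof.
apply/matrixP=> i' j'.
have := conj_delta_mx (delta_mx i p * Z) 1 i' q j j'; rewrite mulr1 => ->.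
have := conj_delta_mx 1 Z i' i p q; rewrite mul1r => ->.
rewrite !mxE [j == j']eq_sym.
by case: (i' == i); case: (j' == j); rewrite ?(mulr0, mul0r, mulr1, mul1r).
Qed.

(** * Fixed matrices of the twisted action *)

Section Realization.
Variables (F K : deltaFieldType) (iota : deltaExt F K) (m : nat) (k : 'M[K]_m).
Variables (n : nat) (r : projRep iota k n).
Local Notation C := (constants F).
Local Notation gam := (const_ext iota).
Local Notation M := 'M[K]_n.+1.
Local Notation G := (deltaGal iota).
Hypothesis kU : k \in unitmx.
Hypothesis fixK : forall x, (forall s : G, s x = x) -> exists c, x = iota c.

Let conj_mx (R : comNzRingType) (g h : 'M[R]_n.+1) := lin_mulmx g *m lin_mulmxr h.

Let conj_mxE (R : comNzRingType) (g h X : 'M[R]_n.+1) :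
  mxvec X *m conj_mx g h = mxvec (g * X * h).
Proof. by rewrite /conj_mx mulmxA !mul_vec_lin. Qed.

(** The linear representation by conjugation on the space of matrices. It acts on row vectors from
    the right and therefore reverses products, as [regular_cocycle_trivial] expects. *)
Let L (s : G) : 'M[C]_(n.+1 * n.+1) :=
  conj_mx (val (PGL_repr (r s))) (val (PGL_repr (r s)))^-1.

Let LE s X : mxvec X *m L s = mxvec (PGL_conj (r s) X).
Proof. exact: conj_mxE. Qed.

Let LgE s (X : M) : mxvec X *m map_mx gam (L s) = mxvec (ext_conj iota (r s) X).
Proof.
have -> : map_mx gam (L s) = conj_mx (map_mx gam (val (PGL_repr (r s))))
    (map_mx gam (val (PGL_repr (r s)))^-1).
  apply: mxvec_mul_eq => i j; rewrite conj_mxE -[delta_mx _ _](map_delta_mx gam).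
  by rewrite -map_mxvec -map_mxM LE map_mxvec -ext_conj_map.
exact: conj_mxE.
Qed.

Let r1 : r 1%g = 1%g.
Proof. by apply: (mulgI (r 1%g)); rewrite -rep_mul !mulg1. Qed.

Lemma trivializing_mx_exists : exists2 u : 'M[K]_(n.+1 * n.+1), u \in unitmx &
  forall s : G, map_mx s u *m map_mx gam (L s) = u.
Proof.
apply: (regular_cocycle_trivial kU fixK (L := L)) => [|s t|i j].
- by apply: mxvec_mul_eq => i j; rewrite LE r1 PGL_conj1 mulmx1.
- apply: mxvec_mul_eq => i j; apply: etrans (LE _ _) _.
  rewrite rep_mul PGL_conjM -(LE s (PGL_conj (r t) _)) -(LE t).
  exact: (esym (mulmxA _ (L t) (L s))).
- case/mxvec_indexP: i => i j'; case/mxvec_indexP: j => i' j.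
  have := rep_regular r (PGL_conj_regular C i j' i' j); congr gal_regular;
    apply/funext=> s.
  have := congr1 (fun X : 'rV_ _ => X 0 (mxvec_index i' j)) (LE s (delta_mx i j')).
  by rewrite mxvec_delta -rowE mxvecE mxE.
Qed.

Let u := s2val (cid2 trivializing_mx_exists).
Let uU : u \in unitmx. Proof. by rewrite /u; case: cid2. Qed.
Let uL (s : G) : map_mx s u *m map_mx gam (L s) = u.
Proof. by rewrite /u; case: cid2 => ? ? /=; apply. Qed.

Let tw (s : G) (X : M) : M := ext_conj iota (r s) (map_mx s X).

Let twE s X : mxvec (tw s X) = map_mx s (mxvec X) *m map_mx gam (L s).
Proof. by rewrite -LgE map_mxvec. Qed.

Let theta (x : 'rV[F]_(n.+1 * n.+1)) : M := vec_mx (map_mx iota x *m u).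

(** Multiplication by [u] carries the entrywise Galois action to the twisted one, so the matrices
    fixed by [tw] are those with coordinates in the fixed field [F]. *)
Let thetaP X : (forall s, tw s X = X) <-> exists x, theta x = X.
Proof.
split=> [XE|[x <-] s]; last first.
  apply: (can_inj (@mxvecK _ _ _)); rewrite twE vec_mxK map_mxM -mulmxA uL.
  congr (_ *m _); apply/rowP=> i; rewrite !mxE; exact: gal_fix.
pose c := mxvec X *m invmx u.
have cE i : exists y, c 0 i = iota y.
  apply: fixK => s; suff /rowP/(_ i) : map_mx s c = c by rewrite mxE.
  apply: (can_inj (mulmxK uU)); rewrite /c mulmxKV // -{2}(XE s) twE.
  by rewrite -{2}(uL s) mulmxA -map_mxM mulmxKV.
exists (\row_i sval (cid (cE i))); rewrite /theta (_ : map_mx _ _ = c).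
  by rewrite /c mulmxKV // mxvecK.
by apply/rowP=> i; rewrite !mxE; case: cid.
Qed.

Let twM s X Y : tw s (X * Y) = tw s X * tw s Y.
Proof. by rewrite /tw -mulmxE map_mxM mulmxE ext_conjM. Qed.

Let tw_theta s x : tw s (theta x) = theta x.
Proof. by move: s; apply/thetaP; exists x. Qed.

Let theta_one : exists x, theta x = 1.
Proof. by apply/thetaP => s; rewrite /tw map_mx1 ext_conj1. Qed.

Let theta_mul x y : exists z, theta z = theta x * theta y.
Proof. by apply/thetaP => s; rewrite twM !tw_theta. Qed.

Let theta_delta x : exists y, theta y = delta (theta x).
Proof.
apply/thetaP => s; rewrite -{2}(tw_theta s x) /tw -ext_conj_delta;
  congr (ext_conj _ _ _).
by apply/matrixP=> i j;
  rewrite [delta _]/(map_mx delta _) [delta _ in RHS]/(map_mx delta _) !mxE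
    gal_delta.
Qed.

Let thetaI : injective theta.
Proof.
move=> x y /(can_inj (@vec_mxK _ _ _))/(can_inj (mulmxK uU)).
exact: map_mx_inj.
Qed.

Let thetaD x y : theta (x + y) = theta x + theta y.
Proof. by rewrite /theta map_mxD mulmxDl linearD. Qed.

Let thetaZ c x : theta (c *: x) = iota c *: theta x.
Proof. by rewrite /theta map_mxZ -scalemxAl linearZ. Qed.

Let A := form_alg (MatrixForm thetaI thetaD thetaZ theta_one theta_mul theta_delta).
Let v : A -> M := @form_val _ _ _ _ _.

Let vE (x : A) : v x = theta x. Proof. by []. Qed.

Let split_map (x : tensor iota A) : M :=
  \sum_(i < \dim {:A}) x 0 i *: v (vbasis {:A})`_i.

Let split_mapD x y : split_map (x + y) = split_map x + split_map y.
Proof. by rewrite -big_split; apply: eq_bigr => i _; rewrite mxE scalerDl. Qed.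

Let split_map_pure a c : split_map (pure iota a c) = c *: v a.
Proof.
rewrite {2}(coord_vbasis (memvf a)) [v _]form_val_sum scaler_sumr;
  apply: eq_bigr => i _.
by rewrite mxE -scalerA -form_valZ.
Qed.

Let split_mapM x y : split_map (x * y) = split_map x * split_map y.
Proof.
elim/tensor_ind: x => [x1 x2|a l];
  first by rewrite mulrDl !split_mapD mulrDl => -> ->.
elim/tensor_ind: y => [y1 y2|b t];
  first by rewrite mulrDr !split_mapD mulrDr => -> ->.
by rewrite pureM !split_map_pure [v _]form_valM -scalerAl -scalerAr scalerA.
Qed.

Let split_mapZ c x : split_map (c *: x) = c *: split_map x.
Proof.
elim/tensor_ind: x => [x1 x2|a l];
  first by rewrite scalerDr !split_mapD scalerDr => -> ->.
by rewrite pureZ !split_map_pure scalerA.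
Qed.

Let split_map_delta x : split_map (delta x) = delta (split_map x).
Proof.
elim/tensor_ind: x => [x1 x2|a l];
  first by rewrite deltaD !split_mapD deltaD => -> ->.
by rewrite delta_pure split_mapD !split_map_pure [v (delta a)]form_val_delta
  delta_scale addrC.
Qed.

Let split_map_gal (s : G) x : split_map (gal_tensor s x) = tw s (split_map x).
Proof.
elim/tensor_ind: x => [x1 x2|a l].
  by rewrite gal_tensorD !split_mapD /tw map_mxD ext_conjD => -> ->.
by rewrite gal_tensor_pure !split_map_pure /tw map_mxZ ext_conjZ -/(tw _ _)
  tw_theta.
Qed.

Let std (i : 'I_(n.+1 * n.+1)) : A := delta_mx 0 i.

Let std_expand (a : A) : a = \sum_i (a : 'rV_(n.+1 * n.+1)) 0 i *: std i.
Proof. exact: row_sum_delta. Qed.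

Let merge (X : M) : tensor iota A :=
  \sum_i pure iota (std i) ((mxvec X *m invmx u) 0 i).

Let mergeK : cancel merge split_map.
Proof.
move=> X; rewrite /merge (big_morph split_map split_mapD (id1 := 0)); last first.
  by rewrite -(scale0r 0) split_mapZ scale0r.
apply: (can_inj (@mxvecK _ _ _)); rewrite linear_sum -[RHS](mulmxKV uU).
rewrite [in RHS](row_sum_delta (mxvec X *m invmx u)) mulmx_suml;
  apply: eq_bigr => i _.
rewrite split_map_pure linearZ /= -scalemxAl; congr (_ *: _).
by rewrite -[LHS]/(mxvec (theta (std i))) /theta vec_mxK map_delta_mx.
Qed.

Let splitK : cancel split_map merge.
Proof.
have mD X Y : merge (X + Y) = merge X + merge Y.
  by rewrite -big_split; apply: eq_bigr => i _; rewrite linearD mulmxDl mxE pureDr.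
elim/tensor_ind=> [x y|a l]; first by rewrite split_mapD mD => -> ->.
rewrite split_map_pure /merge vE /theta linearZ /= vec_mxK -scalemxAl mulmxK //.
rewrite [in RHS](std_expand a).
rewrite (big_morph (fun a => pure iota a l) (id1 := 0) (op1 := +%R)) => [|b c|].
- by apply: eq_bigr => i _; rewrite pureZl !mxE mulrC.
- exact: pureDl.
- by rewrite -(scale0r (0 : A)) pureZl rmorph0 mul0r pure0r.
Qed.

Lemma projRep_realized :
  exists (B : deltaCSA iota n) (psi : deltaIso M (tensor iota B)), phi_spec psi r.
Proof.
have sl : linear split_map by move=> c x y; rewrite split_mapD split_mapZ.
have s1 : split_map 1 = 1.
  by rewrite -[1]/(pure iota (1 : A) 1) split_map_pure scale1r [v _]form_val1.
have sm : monoid_morphism split_map by split=> // x y; apply: split_mapM.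
pose sL := GRing.isLinear.Build K (tensor iota A) M *:%R split_map sl.
pose sM := GRing.isMonoidMorphism.Build (tensor iota A) M split_map sm.
pose S : {lrmorphism tensor iota A -> M} := HB.pack split_map sL sM.
have Sb : bijective S by exists merge; [apply: splitK | apply: mergeK].
pose T : deltaIso (tensor iota A) M := @DeltaIso _ _ _ S Sb split_map_delta.
(* The image of [A] spans all matrices over [K], which reduces centrality and simplicity to the
   matrix algebra. *)
have spanM X : X = \sum_i (mxvec X *m invmx u) 0 i *: v (std i).
  rewrite -{1}[X]mergeK /merge (big_morph split_map split_mapD (id1 := 0));
    last first.
    by rewrite -(scale0r 0) split_mapZ scale0r.
  by apply: eq_bigr => i _; rewrite split_map_pure.
have Acentral : central_alg A.
  apply/eqP; rewrite eqEsubv; apply/andP; split; apply/subvP => x; last first.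
    move=> /vlineP[c ->]; rewrite memv_cap memvf; apply/centvP => y _.
    by rewrite -scalerAl -scalerAr mul1r mulr1.
  rewrite memv_cap => /andP[_ /centvP xC].
  have vC X : v x * X = X * v x.
    rewrite (spanM X) mulr_sumr mulr_suml; apply: eq_bigr => i _.
    by rewrite -scalerAl -scalerAr -[v x * _]form_valM -[v _ * v x]form_valM xC
      ?memvf.
  have vx := central_mx_scalar (fun i j => vC (delta_mx i j)).
  (* Conjugation does not move scalar matrices, so invariance under [tw] says that the Galois group
     fixes the scalar. *)
  have [c cE] : exists c, v x 0 0 = iota c.
    apply: fixK => s; have /matrixP/(_ 0 0) : (s (v x 0 0))%:M = v x.
      transitivity (tw s (v x 0 0)%:M); last by rewrite -vx; apply: tw_theta.
      rewrite -[X in tw s X]scalemx1 /tw map_mxZ ext_conjZ map_mx1 ext_conj1.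
      by rewrite scalemx1.
    by rewrite mxE eqxx mulr1n.
  apply/vlineP; exists c; apply: form_val_inj; rewrite form_valZ form_val1 -cE.
  by rewrite [LHS]vx scalemx1.
have Asimple : simple_alg A.
  move=> I lI rI; have [->|I0] := eqVneq I 0%VS; [by left | right].
  set z := vpick I; have z0 : z != 0 by rewrite vpick0.
  have [p [q zpq]] : exists p q, v z p q != 0.
    apply: contrapT => H; move/eqP: z0; apply; apply: form_val_inj.
    rewrite -(scale0r z) form_valZ rmorph0 scale0r; apply/matrixP=> p q;
      rewrite [RHS]mxE.
    by apply/eqP; apply: contraT => zpq; case: H; exists p, q; apply: zpq.
  (* The [K]-span of [I] is a nonzero two-sided ideal of the matrix algebra, hence everything; its
     rank bounds the dimension of [I] from below. *)
  pose B : 'M[K]_(\dim I, n.+1 * n.+1) :=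
    \matrix_(j < \dim I) mxvec (v (vbasis I)`_j).
  have IB x : x \in I -> (mxvec (v x) <= B)%MS.
    move=> xI; rewrite (coord_vbasis xI) [v _]form_val_sum linear_sum.
    apply: summx_sub => j _; rewrite form_valZ linearZ; apply: scalemx_sub.
    by have := row_sub j B; rewrite rowK.
  have XB X Y : (mxvec (X * v z * Y) <= B)%MS.
    rewrite (spanM X) (spanM Y) mulr_suml mulr_sumr linear_sum;
      apply: summx_sub => i _.
    rewrite !mulr_suml linear_sum; apply: summx_sub => j _.
    rewrite -scalerAr -!scalerAl !linearZ; do 2!apply: scalemx_sub.
    rewrite -[v _ * v z]form_valM -[_ * v _]form_valM; apply: IB.
    apply: (subvP rI); apply: memv_mul; last exact: memvf.
    by apply: (subvP lI); apply: memv_mul; [exact: memvf | exact: memv_pick].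
  have fB : row_full B.
    rewrite -sub1mx; apply/row_subP=> i; case/mxvec_indexP: i => i j.
    rewrite row1 -mxvec_delta.
    have -> : delta_mx i j = (v z p q)^-1 *: (delta_mx i p * v z * delta_mx q j).
      by rewrite delta_mx_sandwich scalerA mulVf // scale1r.
    by rewrite linearZ; apply: scalemx_sub; apply: XB.
  have rB : (n.+1 * n.+1 <= \rank B)%N by move: fB => /eqP->.
  apply/eqP; rewrite eqEdim subvf; apply: leq_trans (rank_leq_row B).
  by apply: leq_trans rB; rewrite dim_form_alg.
have Adim : \dim {:A} = (n.+1 ^ 2)%N by rewrite dim_form_alg /= mulnn.
have Asplit : isomorphic (tensor iota A) M by constructor.
have [psi TK psiK] := deltaIso_inv T.
exists (DeltaCSA Acentral Asimple Adim Asplit), psi => s X.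
apply: (bij_inj (iso_bij T));
  rewrite -[T (gal_tensor _ _)]/(split_map _) split_map_gal.
rewrite -[split_map _]/(T _) !psiK /tw -ext_conj_map; congr (ext_conj _ _ _).
by apply/matrixP=> i j; rewrite !mxE gal_const.
Qed.

End Realization.

(** * The correspondence between split algebras and projective representations *)

Theorem theorem1p2 (F K : deltaFieldType) (iota : deltaExt F K)
    (char0 : [pchar F] =i pred0)
    (closed : GRing.closed_field_axiom (constants F))
    (M : deltaModType F) (PV : picard_vessiot iota M)
    (m : nat) (e : m.-tuple M) (basis_e : basis_of fullv e)
    (k : 'M[K]_m) (fund_k : fundamental_mx iota e k)
    (gen_k : field_generated iota k)
    (n : nat) :
  exists Gamma : classes (@csa_iso F K iota n) ->
                 classes (@rep_equiv F K iota m k n),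
    (forall (A : deltaCSA iota n)
            (psi : deltaIso 'M[K]_n.+1 (tensor iota A)),
       exists2 phi : projRep iota k n, phi_spec psi phi &
         Gamma (eqv_class _ A) = eqv_class _ phi) /\
    bijective Gamma.
Proof.
have [constE _] := PV; have [kU dk] := fund_k.
have fixK := fixed_field char0 constE closed kU dk gen_k.
have phiP (A : deltaCSA iota n) (psi : deltaIso 'M[K]_n.+1 (tensor iota A)) :
    exists phi : projRep iota k n, phi_spec psi phi.
  have [r rE] := phi_exists constE psi.
  by exists (ProjRep (phi_mul rE) (phi_regular constE closed kU dk gen_k rE)).
have psiP (A : deltaCSA iota n) :
    exists psi : deltaIso 'M[K]_n.+1 (tensor iota A), True.
  by have [f] := csa_split A; have [psi _ _] := deltaIso_inv f; exists psi.
pose psi_of A := sval (cid (psiP A)).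
pose phi_of A := sval (cid (phiP A (psi_of A))).
have phi_ofP A : phi_spec (psi_of A) (phi_of A) by rewrite /phi_of; case: cid.
have repE := @eqv_classP _ (@rep_equiv F K iota m k n) (@rep_equiv_refl _ _ _ _ _ _)
  (@rep_equiv_sym _ _ _ _ _ _) (@rep_equiv_trans _ _ _ _ _ _).
have csaE := @eqv_classP _ (@csa_iso F K iota n) (fun A => isomorphic_refl A)
  (fun A B => @isomorphic_sym F A B) (fun A B D => @isomorphic_trans F A B D).
(* From left to right this makes [Gamma] independent of all choices; from right to left it makes
   [Gamma] injective. *)
have phiE (A B : deltaCSA iota n) (psi : deltaIso 'M[K]_n.+1 (tensor iota A))
    (psi' : deltaIso 'M[K]_n.+1 (tensor iota B)) (phi phi' : projRep iota k n) :
    phi_spec psi phi -> phi_spec psi' phi' ->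
    eqv_class (@csa_iso F K iota n) A = eqv_class _ B <->
    eqv_class (@rep_equiv F K iota m k n) phi = eqv_class _ phi'.
  move=> phiS phiS'; split=> [/csaE[f]|/repE[x E]].
    by apply/repE; exact: (phi_equiv constE f phiS phiS').
  by apply/csaE; exact: (isomorphic_of_phi_equiv fixK phiS phiS' E).
pose alg_of (c : classes (@csa_iso F K iota n)) := sval (cid (svalP c)).
have alg_ofK c : eqv_class _ (alg_of c) = c.
  by case: c => X XE; apply: eq_exist; rewrite /alg_of; case: cid.
pose Gamma c := eqv_class (@rep_equiv F K iota m k n) (phi_of (alg_of c)).
have GammaE (A : deltaCSA iota n) (psi : deltaIso 'M[K]_n.+1 (tensor iota A))
  (phi : projRep iota k n) :
    phi_spec psi phi -> Gamma (eqv_class _ A) = eqv_class _ phi.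
  by move=> phiS; apply/(phiE _ _ _ _ _ _ (phi_ofP _) phiS); rewrite alg_ofK.
exists Gamma; split=> [A psi|].
  by have [phi phiS] := phiP A psi; exists phi => //; apply: GammaE phiS.
have surj y : exists c, Gamma c = y.
  case: (y) => X [r XE]; have [B [psi rS]] := projRep_realized r kU fixK.
  exists (eqv_class _ B); rewrite (GammaE _ _ _ rS).
  by apply: eq_exist; rewrite XE.
have inj : injective Gamma.
  move=> c c' /(phiE _ _ _ _ _ _ (phi_ofP _) (phi_ofP _)).
  by rewrite !alg_ofK.
exists (fun y => sval (cid (surj y))) => [c|y]; last by case: cid.
by apply: inj; case: cid.
Qed.
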